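(* Let $d\ge 2$, $0\le a<b$, and let $(\mathbb P^u)_{u\in(a,b)}$ be a family of probability measures on $(\{0,1\}^{\mathbb Z^d},\mathcal F)$ satisfying conditions P1, P2, P3, S1 and S2 (listed in the context). Then for every $u\in(a,b)$ there exist constants $c=c(u)>0$ and $C=C(u)<\infty$ such that for all $R\ge 1$, $$\mathbb P^u\left[\text{for all }x,y\in\mathcal S_R\cap \mathrm B(R),\ \rho_{\mathcal S}(x,y)\le CR\right]\ \ge\ 1-C e^{-c(\log R)^{1+\Delta_S}},$$ where $\Delta_S=\Delta_S(u)>0$ is the exponent from condition S1.
   Context: Notation. $\mathcal F$ is the product sigma-algebra on $\{0,1\}^{\mathbb Z^d}$, generated by the coordinate maps $\Psi_x(\xi)=\xi_x$, $x\in\mathbb Z^d$. For $\xi\in\{0,1\}^{\mathbb Z^d}$, $\mathcal S=\mathcal S(\xi)=\{x\in\mathbb Z^d:\xi_x=1\}$, viewed as a subgraph of $\mathbb Z^d$ with edges between vertices of $\mathcal S$ at $\ell^1$-distance $1$. For $r\in[0,\infty]$, $\mathcal S_r$ is the set of vertices of $\mathcal S$ in connected components of $\mathcal S$ of $\ell^1$-diameter $\ge r$; in particular $\mathcal S_\infty$ is the set of vertices in infinite connected components. $\mathrm B(x,r)=\{y\in\mathbb Z^d:|x-y|_\infty\le\lfloor r\rfloor\}$ and $\mathrm B(r)=\mathrm B(0,r)$. For $x,y\in\mathcal S$, $\rho_{\mathcal S}(x,y)\in\mathbb Z_+\cup\{\infty\}$ is the graph distance in $\mathcal S$ (equal to $\infty$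 if $x,y$ are in different components). An event $G\in\mathcal F$ is increasing (resp. decreasing) if $\xi\in G$ and $\xi_y\le\xi'_y$ (resp. $\xi_y\ge\xi_y'$) for all $y$ imply $\xi'\in G$. Conditions on a family $(\mathbb P^u)_{u\in(a,b)}$: P1. For each $u\in(a,b)$, $\mathbb P^u$ is invariant and ergodic with respect to the lattice shifts (invariant under all shifts of $\mathbb Z^d$, and ergodic under each nonzero shift). P2. For $u<u'$ in $(a,b)$ and any increasing $G\in\mathcal F$, $\mathbb P^u[G]\le\mathbb P^{u'}[G]$. P3. There exist $R_P,L_P<\infty$, $\varepsilon_P,\chi_P>0$ and a real-valued function $f_P$ with $f_P(L)\ge e^{(\log L)^{\varepsilon_P}}$ for all $L\ge L_P$, such that the following holds for every integer $L\ge1$, all $x_1,x_2\in\mathbb Z^d$, all decreasing events $A_i$ and increasing events $B_i$ in $\sigma(\Psi_y:y\in \mathrm B(x_i,10L))$, $i=1,2$, every integer $R\ge R_P$ and all $a<\widehat u<u<b$ with $u\ge(1+R^{-\chi_P})\widehat u$: if $|x_1-x_2|_\infty\ge R L$, then $\mathbb P^u[A_1\cap A_2]\le\mathbb P^{\widehat u}[A_1]\,\mathbb P^{\widehat u}[A_2]+e^{-f_P(L)}$ and $\mathbb P^{\widehat u}[B_1\cap B_2]\le\mathbb P^{u}[B_1]\,\mathbb P^{u}[B_2]+e^{-f_P(L)}$. S1. There is a function $f_S:(a,b)\times\mathbb Z_+\to\mathbb R$ such that for each $u\in(a,b)$ there are $\Delta_S=\Delta_S(u)>0$ and $R_S=R_S(u)<\infty$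 with $f_S(u,R)\ge(\log R)^{1+\Delta_S}$ for all $R\ge R_S$, and for all $u\in(a,b)$ and integers $R\ge1$: $\mathbb P^u[\mathcal S_R\cap\mathrm B(R)\ne\emptyset]\ge1-e^{-f_S(u,R)}$ and $\mathbb P^u[\text{all }x,y\in\mathcal S_{R/10}\cap\mathrm B(R)\text{ are connected to each other in }\mathcal S\cap\mathrm B(2R)]\ge1-e^{-f_S(u,R)}$. S2. The function $\eta(u)=\mathbb P^u[0\in\mathcal S_\infty]$ is positive and continuous on $(a,b)$. *)

(* Defs.v *)
From HB Require Import structures.
From mathcomp Require Import all_boot all_order all_algebra.
From mathcomp Require Import all_classical all_reals all_analysis.

Set Implicit Arguments.
Unset Strict Implicit.
Unset Printing Implicit Defensive.

Import Order.TTheory GRing.Theory Num.Theory.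
Import numFieldNormedType.Exports.

Local Open Scope classical_set_scope.
Local Open Scope ring_scope.

Notation lattice d := 'rV[int]_d.

Definition norm1 (d : nat) (x : lattice d) : nat := (\sum_(i < d) `|x ord0 i|)%N.

Definition normoo (d : nat) (x : lattice d) : nat := (\max_(i < d) `|x ord0 i|)%N.

Definition box (R : realType) (d : nat) (x : lattice d) (r : R) : set (lattice d) :=
  [set y | (normoo (x - y))%:Z <= Num.floor r].

Definition cfg (d : nat) := lattice d -> bool.

Definition Psi (d : nat) (x : lattice d) (xi : cfg d) : bool := xi x.

Definition cylinders (d : nat) (K : set (lattice d)) : set (set (cfg d)) :=
  \bigcup_(x in K) preimage_set_system setT (@Psi d x) measurable.

Definition sigma_coord (d : nat) (K : set (lattice d)) : set (set (cfg d)) :=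
  <<s cylinders K >>.

(* {0,1}^(Z^d) with its product sigma-algebra *)
Notation configuration d := (g_sigma_algebraType (@cylinders d setT)).

Definition increasing (d : nat) (G : set (cfg d)) : Prop :=
  forall xi xi' : cfg d, G xi -> (forall y, xi y ==> xi' y) -> G xi'.

Definition decreasing (d : nat) (G : set (cfg d)) : Prop :=
  forall xi xi' : cfg d, G xi -> (forall y, xi' y ==> xi y) -> G xi'.

Definition lattice_shift (d : nat) (x : lattice d) (xi : cfg d) : cfg d :=
  fun y => xi (y + x).

Definition adjacent (d : nat) : rel (lattice d) :=
  fun x y => norm1 (x - y) == 1%N.

(* [x :: p] is a nearest-neighbour path from [x] to [y] inside [A];
   its length (number of edges) is [size p]. *)
Definition walk (d : nat) (A : set (lattice d)) (x y : lattice d)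
    (p : seq (lattice d)) : Prop :=
  [/\ path (@adjacent d) x p, last x p = y & forall z, z \in x :: p -> A z].

Definition connected_in (d : nat) (A : set (lattice d)) (x y : lattice d) : Prop :=
  exists p, walk A x y p.

Definition component (d : nat) (A : set (lattice d)) (x : lattice d) :
    set (lattice d) :=
  [set y | connected_in A x y].

Definition diameter (R : realType) (d : nat) (A : set (lattice d)) : \bar R :=
  ereal_sup [set e | exists y z, [/\ A y, A z & e = (norm1 (y - z))%:R%:E]].

(* The infimum of the empty set is +oo, so this is +oo when x and y are in
   different components. *)
Definition graph_dist (R : realType) (d : nat) (A : set (lattice d))
    (x y : lattice d) : \bar R :=
  ereal_inf [set (size p)%:R%:E | p in walk A x y].

Definition occupied (d : nat) (xi : cfg d) : set (lattice d) := [set x | xi x].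

(* The vertices of S(xi) in components of diameter at least r; [r = +oo] gives
   the vertices in infinite components. *)
Definition occupied_ge (R : realType) (d : nat) (r : \bar R) (xi : cfg d) :
    set (lattice d) :=
  [set x | occupied xi x /\ (r <= diameter R (component (occupied xi) x))%E].

Section conditions.
Variables (R : realType) (d : nat) (a b : R).
Variable P : R -> probability (configuration d) R.

Definition condP1 : Prop :=
  forall u, a < u < b ->
    (forall (x : lattice d) (G : set (configuration d)), measurable G ->
       P u (lattice_shift x @^-1` G) = P u G) /\
    (forall (x : lattice d) (G : set (configuration d)), x != 0 -> measurable G ->
       lattice_shift x @^-1` G = G -> P u G = 0%E \/ P u G = 1%E).

Definition condP2 : Prop :=
  forall u u', a < u -> u < u' -> u' < b ->
  forall G : set (configuration d), measurable G -> increasing G ->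
    (P u G <= P u' G)%E.

Definition condP3 : Prop :=
  exists (RP LP epsP chiP : R) (fP : nat -> R),
  [/\ 0 < epsP, 0 < chiP,
      forall L : nat, LP <= L%:R -> expR (ln L%:R `^ epsP) <= fP L &
      forall (L : nat) (x1 x2 : lattice d) (A1 A2 B1 B2 : set (cfg d))
             (r : nat) (u' u : R),
      (1 <= L)%N ->
      sigma_coord (box x1 (10 * L%:R : R)) A1 -> decreasing A1 ->
      sigma_coord (box x2 (10 * L%:R : R)) A2 -> decreasing A2 ->
      sigma_coord (box x1 (10 * L%:R : R)) B1 -> increasing B1 ->
      sigma_coord (box x2 (10 * L%:R : R)) B2 -> increasing B2 ->
      RP <= r%:R ->
      a < u' -> u' < u -> u < b -> (1 + r%:R `^ (- chiP)) * u' <= u ->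
      (r * L <= normoo (x1 - x2))%N ->
      (P u (A1 `&` A2) <= P u' A1 * P u' A2 + (expR (- fP L))%:E)%E /\
      (P u' (B1 `&` B2) <= P u B1 * P u B2 + (expR (- fP L))%:E)%E].

Definition condS1 (DeltaS : R -> R) : Prop :=
  exists fS : R -> nat -> R,
  (forall u, a < u < b ->
     0 < DeltaS u /\
     exists RS : R, forall r : nat, RS <= r%:R ->
       ln r%:R `^ (1 + DeltaS u) <= fS u r) /\
  (forall u (r : nat), a < u < b -> (1 <= r)%N ->
     (P u [set xi | occupied_ge (r%:R : R)%:E xi `&` box 0 (r%:R : R) !=set0]
        >= (1 - expR (- fS u r))%:E)%E /\
     (P u [set xi | forall x y,
             (occupied_ge (r%:R / 10 : R)%:E xi `&` box 0 (r%:R : R)) x ->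
             (occupied_ge (r%:R / 10 : R)%:E xi `&` box 0 (r%:R : R)) y ->
             connected_in (occupied xi `&` box 0 (2 * r%:R : R)) x y]
        >= (1 - expR (- fS u r))%:E)%E).

Definition eta (u : R) : R :=
  fine (P u [set xi | occupied_ge (+oo : \bar R)%E xi 0]).

Definition condS2 : Prop :=
  (forall u, a < u < b -> 0 < eta u) /\ {in `]a, b[, continuous eta}.

End conditions.

(* Main.v *)
(** A multi-scale renormalization. For a scale [L0] call a cube of side [L0] good
    if some cluster fills 3/4 of the expected density [eta(u)] in it and in its
    neighbours (an increasing event) while at most 5/4 of the density lies in
    clusters of diameter at least [k] (a decreasing event); since 3/4 + 3/4 > 5/4,
    the clusters of adjacent good cubes meet. Both events are likely for large [L0]:
    by P3 the events that far apart sites lie in long clusters are nearly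
    uncorrelated, so Chebyshev's inequality gives a law of large numbers, and S1
    glues the long clusters together.

    A vertex of level [n+1] is bad if its window contains two far apart bad vertices
    of level [n]. P3 and sprinkling give probability at most [exp (- Q (3/2)^n)] to
    this, whereas the scales grow so slowly that this beats any power of
    [log L_n]. Inside a good vertex of level [n+1] the bad vertices of level [n]
    lie in two small boxes, and can be avoided at a relative cost
    [O(r_n / l_n)], which is summable: good vertices of level [n] are joined by
    paths of length [O(L_n)], uniformly in [n].

    For radius [r], take [rho ~ r^(1/d)] and the largest [L_n <= rho / 20]. With
    the required probability all vertices of level [n] near the ball are good, and
    by S1 at scale [rho] each site of a large cluster is joined to a nearby good
    cube inside a box of volume [O(rho^d) = O(r)]. *)

From mathcomp Require Import all_boot all_order all_algebra.
From mathcomp Require Import all_classical all_reals all_analysis.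
From mathcomp Require Import zify ring lra.
Require Import Defs.

Set Implicit Arguments.
Unset Strict Implicit.
Unset Printing Implicit Defensive.

Import Order.TTheory GRing.Theory Num.Theory.
Import numFieldNormedType.Exports.

Local Open Scope classical_set_scope.
Local Open Scope ring_scope.

(** * Paths in the lattice *)

(** P3 speaks of monotone events only, while connectedness is increasing and sparsity decreasing, so
    a combined notion of a bad vertex is out of its reach. Hence there are two cascades, sprinkled
    in opposite directions, and the geometry must avoid both at once: this is why three candidates
    (centres or routes) are always pitted against two obstacles. The scale ratios meet opposite
    demands. With [r_n = 2^(K (n+1)^th)] and [l_n = r_n^2], the sprinkling cost [r_n^(-chi)] and the
    detour cost [r_n / l_n] decay at least geometrically, and [th >= 1 / eps] makes [(log L_n)^eps]
    grow at least linearly, which pushes the error of P3 below [exp (- 2 Q (3/2)^n)]. Yet [log L_n]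
    stays polynomial in [n], so that [(3/2)^n] dominates its powers. Taking 3/2 instead of the 2
    that squaring would give leaves room for the number of pairs in a window. The d-th root in the
    last step comes from bounding the length of a connection by the volume of its box; it changes
    the logarithm of the radius by a constant factor only. *)

Section Lattice.
Variable d : nat.
Implicit Types (x y z w : lattice d) (A B D I : set (lattice d)).

Definition axis (i : 'I_d) (s : int) : lattice d :=
  \row_j (if j == i then s else 0).

Lemma coordD x y i : (x + y) ord0 i = x ord0 i + y ord0 i :> int.
Proof. by rewrite mxE. Qed.

Lemma coordN x i : (- x) ord0 i = - x ord0 i :> int.
Proof. by rewrite mxE. Qed.

Lemma coordZ (l : int) x i : (l *: x) ord0 i = l * x ord0 i :> int.
Proof. by rewrite mxE. Qed.

Lemma coord0 i : (0%R : lattice d) ord0 i = 0%R :> int.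
Proof. by rewrite mxE. Qed.

Lemma coord_axis i s j : axis i s ord0 j = if j == i then s else 0 :> int.
Proof. by rewrite mxE. Qed.

Lemma coord_inj x y : (forall i, x ord0 i = y ord0 i) -> x = y.
Proof. by move=> xy; apply/rowP. Qed.

Definition coordE := (coordD, coordN, coordZ, coord0, coord_axis).

Lemma norm1_axis x i s :
  (norm1 (x + axis i s)%R + `|x ord0 i| = norm1 x + `|(x ord0 i + s)%R|)%N.
Proof.
rewrite /norm1 (bigD1 i) //= [in RHS](bigD1 i) //= !coordE eqxx.
have -> : (\sum_(j < d | j != i) `|(x + axis i s)%R ord0 j| =
           \sum_(j < d | j != i) `|x ord0 j|)%N.
  by apply: eq_bigr => j /negbTE ji; rewrite !coordE ji addr0.
by rewrite addnC addnCA addnC.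
Qed.

Lemma norm1_0 : norm1 (0 : lattice d) = 0%N.
Proof. by rewrite /norm1 big1 // => i _; rewrite coordE. Qed.

Lemma norm1_axis0 i s : norm1 (axis i s) = `|s|%N.
Proof. by have := norm1_axis 0 i s; rewrite norm1_0 coordE !add0r absz0 addn0. Qed.

Lemma norm1N x : norm1 (- x) = norm1 x.
Proof. by apply: eq_bigr => i _; rewrite coordE abszN. Qed.

Lemma norm1D x y : (norm1 (x + y)%R <= norm1 x + norm1 y)%N.
Proof. rewrite /norm1 -big_split /=; apply: leq_sum => i _; rewrite coordE /=; lia. Qed.

Lemma norm1_distC x y : norm1 (x - y) = norm1 (y - x).
Proof. by rewrite -norm1N opprB. Qed.

Lemma normooP x k : reflect (forall i, (`|x ord0 i| <= k)%N) (normoo x <= k)%N.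
Proof.
by apply: (iffP (bigmax_leqP _ _ _)) => h i; [exact: h | move=> _; exact: h].
Qed.

Lemma normoo_coord x i : (`|x ord0 i| <= normoo x)%N.
Proof. exact/normooP. Qed.

Lemma normooN x : normoo (- x) = normoo x.
Proof. by apply: eq_bigr => i _; rewrite coordE abszN. Qed.

Lemma normoo_distC x y : normoo (x - y) = normoo (y - x).
Proof. by rewrite -normooN opprB. Qed.

Lemma normooD x y : (normoo (x + y)%R <= normoo x + normoo y)%N.
Proof.
apply/normooP => i; rewrite coordE.
by have := normoo_coord x i; have := normoo_coord y i; lia.
Qed.

Lemma normoo_dist3 y x z :
  (normoo (x - z)%R <= normoo (x - y)%R + normoo (y - z)%R)%N.
Proof. by rewrite -[x - z](subrKA y) normooD. Qed.

Lemma normoo0 : normoo (0 : lattice d) = 0%N.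
Proof. by apply/eqP; rewrite -leqn0; apply/normooP => i; rewrite coordE. Qed.

Lemma normoo_axis i s : normoo (axis i s) = `|s|%N.
Proof.
apply/eqP; rewrite eqn_leq; apply/andP; split.
  by apply/normooP => j; rewrite coordE; case: ifP.
by have := normoo_coord (axis i s) i; rewrite coordE eqxx.
Qed.

Lemma normooZ (l : nat) x : normoo (l%:Z *: x) = (l * normoo x)%N.
Proof.
apply/eqP; rewrite eqn_leq; apply/andP; split.
  apply/normooP => i; rewrite coordE abszM /= leq_mul2l normoo_coord.
  by rewrite orbT.
have [->//|l0] := posnP l.
rewrite mulnC -leq_divRL //; apply/normooP => i; rewrite leq_divRL //.
by have := normoo_coord (l%:Z *: x) i; rewrite coordE abszM /= mulnC.
Qed.

Lemma normoo_le_norm1 x : (normoo x <= norm1 x)%N.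
Proof.
by apply/normooP => i; rewrite /norm1 (bigD1 i) //= leq_addr.
Qed.

Lemma norm1_le_normoo x : (norm1 x <= d * normoo x)%N.
Proof.
apply: (@leq_trans (\sum_(i < d) normoo x)%N); last first.
  by rewrite sum_nat_const card_ord.
by apply: leq_sum => i _; exact: normoo_coord.
Qed.

Lemma adjacentC x y : adjacent x y = adjacent y x.
Proof. by rewrite /adjacent norm1_distC. Qed.

Lemma adjacent_normoo x y : adjacent x y -> (normoo (x - y)%R <= 1)%N.
Proof. by move=> /eqP xy; rewrite (leq_trans (normoo_le_norm1 _)) ?xy. Qed.

Lemma adjacent_axisP x y : adjacent x y ->
  exists i s, `|s|%N = 1%N /\ y = x + axis i s.
Proof.
rewrite adjacentC /adjacent => /eqP xy.
have [i hi] : exists i, (0 < `|(y - x)%R ord0 i|)%N.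
  apply: contrapT => /forallNP h; move: xy; rewrite /norm1 big1 // => i _.
  by have := h i; move/negP; rewrite lt0n negbK => /eqP.
exists i, ((y - x) ord0 i).
move: xy hi; rewrite /norm1 (bigD1 i) //=.
set S := (X in (_ + X)%N); set K := absz _ => xy hi.
have [/eqP S0 K1] : S = 0%N /\ K = 1%N by move: S K xy hi => S K; lia.
move: S0; rewrite /S sum_nat_eq0 => /forallP h.
split=> //.
apply: coord_inj => j; rewrite !coordE.
have := h j; rewrite !coordE; case: eqVneq => [->|ji]; last by rewrite /=; lia.
by rewrite /= addrC subrK.
Qed.

(** The length is bounded, not prescribed, so that estimates add under concatenation and can be
    weakened. *)
Definition joined A (n : nat) x y :=
  exists p, walk A x y p /\ (size p <= n)%N.

Lemma joined_refl A x : A x -> joined A 0 x x.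
Proof. by move=> Ax; exists [::]; split=> //; split=> // z; rewrite inE => /eqP->. Qed.

Lemma walk_cat A x y z p q :
  walk A x y p -> walk A y z q -> walk A x z (p ++ q).
Proof.
move=> [pp lp Ap] [pq lq Aq]; split.
- by rewrite cat_path pp lp pq.
- by rewrite last_cat lp.
- move=> w; rewrite in_cons mem_cat => /or3P[/eqP->|wp|wq].
  + by apply: Ap; rewrite mem_head.
  + by apply: Ap; rewrite in_cons wp orbT.
  + by apply: Aq; rewrite in_cons wq orbT.
Qed.

Lemma joined_trans A m n y x z :
  joined A m x y -> joined A n y z -> joined A (m + n) x z.
Proof.
move=> [p [wp sp]] [q [wq sq]]; exists (p ++ q).
by rewrite size_cat leq_add //; split => //; exact: walk_cat wp wq.
Qed.

Lemma joined_sym A n x y : joined A n x y -> joined A n y x.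
Proof.
move=> [p [[pp lp Ap] sp]]; exists (rev (belast x p)); split; last first.
  by rewrite size_rev size_belast.
split.
- rewrite -lp rev_path; apply: sub_path pp => u v; by rewrite adjacentC.
- case: p pp lp Ap {sp} => [|a p] //= _ _ _.
  by rewrite rev_cons last_rcons.
- move=> z; rewrite -lp -rev_rcons mem_rev -lastI; exact: Ap.
Qed.

Lemma joined_mono A B m n x y :
  (forall z, A z -> B z) -> (m <= n)%N -> joined A m x y -> joined B n x y.
Proof.
move=> AB mn [p [[pp lp Ap] sp]]; exists p; split; last exact: leq_trans mn.
by split=> // z zp; apply: AB; exact: Ap.
Qed.

Lemma joined_step A x y : A x -> A y -> adjacent x y -> joined A 1 x y.
Proof.
move=> Ax Ay xy; exists [:: y]; split=> //; split=> //=; first by rewrite xy.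
by move=> z; rewrite !inE => /orP[] /eqP->.
Qed.

Lemma joined_connected A n x y : joined A n x y -> connected_in A x y.
Proof. by case=> p [wp _]; exists p. Qed.

Lemma connected_joined A x y : connected_in A x y -> exists n, joined A n x y.
Proof. by case=> p wp; exists (size p), p. Qed.

Lemma connected_sym A x y : connected_in A x y -> connected_in A y x.
Proof. by move/connected_joined => [n /joined_sym/joined_connected]. Qed.

Lemma connected_trans A y x z :
  connected_in A x y -> connected_in A y z -> connected_in A x z.
Proof. by case=> p wp [q wq]; exists (p ++ q); exact: walk_cat wp wq. Qed.

Lemma connected_mono A B x y :
  (forall z, A z -> B z) -> connected_in A x y -> connected_in B x y.
Proof.
by move=> AB /connected_joined [n /(joined_mono AB (leqnn n))/joined_connected].
Qed.

Lemma connected_meml A x y : connected_in A x y -> A x.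
Proof. by case=> p [_ _ Ap]; apply: Ap; exact: mem_head. Qed.

(** The rectangle spanned by two points. If they differ in one coordinate it is a segment, which is
    how the legs of the routes in [detour] are described. *)
Definition hull x y : set (lattice d) :=
  [set z | forall i, x ord0 i <= z ord0 i <= y ord0 i \/
                     y ord0 i <= z ord0 i <= x ord0 i].

(** Induction on the distance: one step towards [y] in a coordinate where the points differ stays in
    the rectangle, and the rectangle of the new pair lies inside the old one. *)
Lemma joined_hull x y : joined (hull x y) (norm1 (y - x)) x y.
Proof.
move nE : (norm1 (y - x)) => n; elim: n => [|n IH] in x nE *.
  have -> : y = x.
    apply: coord_inj => i; move/eqP: nE; rewrite /norm1 sum_nat_eq0 => /forallP/(_ i).
    by rewrite !coordE /=; lia.
  by apply: joined_refl => i; lia.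
have [i hi] : exists i, (0 < `|(y - x)%R ord0 i|)%N.
  apply: contrapT => /forallNP h; move: nE; rewrite /norm1 big1 // => i _.
  by have := h i; move/negP; rewrite lt0n negbK => /eqP.
pose s : int := if x ord0 i < y ord0 i then 1 else -1.
have ns : norm1 (y - (x + axis i s)) = n.
  have -> : y - (x + axis i s) = (y - x) + axis i (- s).
    apply: coord_inj => j; rewrite !coordE; case: ifP => _; lia.
  have := norm1_axis (y - x) i (- s); rewrite nE.
  by move: hi; rewrite /s !coordE; case: ifP; lia.
rewrite -add1n; apply: joined_trans (joined_mono _ _ (IH _ ns)) => //; last first.
  move=> z hz j; have := hz j; rewrite !coordE.
  case: eqP => [->|_]; last by lia.
  by move: hi; rewrite /s !coordE; case: ifP; lia.
apply: joined_step.
- by move=> j; lia.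
- move=> j; rewrite !coordE; case: eqP => [->|_]; last by lia.
  by move: hi; rewrite /s !coordE; case: ifP; lia.
- rewrite /adjacent opprD addrA subrr add0r norm1N norm1_axis0 /s.
  by case: ifP.
Qed.

End Lattice.

(** * Volume bounds and detours around two small obstacles *)

Section Geometry.
Variable d : nat.
Implicit Types (x y z w c : lattice d) (A B D I : set (lattice d)).

Definition nball c (m : nat) : set (lattice d) :=
  [set z | (normoo (c - z)%R <= m)%N].

Lemma size_uniq_nball c m (s : seq (lattice d)) :
  uniq s -> (forall z, z \in s -> nball c m z) -> (size s <= (m.*2.+1) ^ d)%N.
Proof.
move=> us sc.
(* Inside the ball the shifted coordinates lie between 0 and 2m, so neither the absolute value nor
   [inord] loses information. *)
pose f z : {ffun 'I_d -> 'I_(m.*2.+1)} :=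
  [ffun i => inord `|(z ord0 i - c ord0 i + m%:Z)%R|].
have fi : {in s &, injective f}.
  move=> z w /sc hz /sc hw /ffunP fzw; apply: coord_inj => i.
  have := congr1 val (fzw i); rewrite !ffunE /=.
  have := normoo_coord (c - z) i; have := normoo_coord (c - w) i.
  move: hz hw; rewrite /nball /= => hz hw; rewrite !coordE => h1 h2.
  rewrite !inordK; lia.
rewrite -(size_map f) -(card_uniqP _) ?map_inj_in_uniq //.
by rewrite (leq_trans (max_card _)) // card_ffun !card_ord.
Qed.

(** A walk without repetitions is no longer than the number of points available. This turns the
    connections given by S1, which carry no length, into length bounds. *)
Lemma joined_nball A c m x y :
  connected_in A x y -> (forall z, A z -> nball c m z) ->
  joined A ((m.*2.+1) ^ d) x y.
Proof.
move=> [p [pp lp Ap]] Ac; move: lp.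
case: (shortenP pp) => p' pp' up' sp' lp'.
have Ap' z : z \in x :: p' -> A z.
  rewrite inE => /orP[/eqP->|zp']; first by apply: Ap; rewrite mem_head.
  by apply: Ap; rewrite in_cons (sp' _ zp') orbT.
exists p'; split; first by split.
have := size_uniq_nball up' (fun z zp => Ac z (Ap' z zp)).
by move=> /= /ltnW.
Qed.

Lemma hull_nball c m x y z :
  nball c m x -> nball c m y -> hull x y z -> nball c m z.
Proof.
rewrite /nball /= => /normooP hx /normooP hy hz; apply/normooP => i.
by have := hx i; have := hy i; have := hz i; rewrite !coordE; lia.
Qed.

Lemma joined_nball_hull A c m x y : nball c m x -> nball c m y ->
  (forall z, nball c m z -> A z) -> joined A (norm1 (y - x)) x y.
Proof.
move=> cx cy cA; apply: joined_mono (joined_hull x y) => // z hz.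
exact/cA/(hull_nball cx cy hz).
Qed.

(** Unlike the usual sign it never vanishes, so the outer routes of [detour] are displaced even when
    a leg has length 0. *)
Let sgn (s : int) : int := if 0 <= s then 1 else -1.

(* The three routes are the L-shaped path from [x] to [x + a e_i + b e_j],
   translated by -r, 0 and r along the antidiagonal; they are at mutual sup
   distance at least [r], so [D] and [I] can block at most two of them. *)
Lemma detour A D I r x (i j : 'I_d) (a b : int) :
  i != j -> (0 < r)%N ->
  let y := x + axis i a + axis j b in
  (forall z w, D z -> D w -> (normoo (z - w)%R < r)%N) ->
  (forall z w, I z -> I w -> (normoo (z - w)%R < r)%N) ->
  (forall z, (normoo (z - x)%R <= maxn `|a| `|b| + r)%N -> A z \/ D z \/ I z) ->
  (forall z, nball x r z -> A z) -> (forall z, nball y r z -> A z) ->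
  joined A (`|a| + `|b| + 4 * r) x y.
Proof.
move=> ij r0 y Dr Ir cov Ax Ay.
(* Moving against the first leg and along the second makes the three routes nested corners: any two
   legs of different routes, parallel or not, are apart in coordinate [i] or in coordinate [j]. *)
pose sh (t : int) := axis i (- (t * r%:Z * sgn a)) + axis j (t * r%:Z * sgn b).
pose M (t : int) : set (lattice d) :=
  hull (x + sh t) (x + sh t + axis i a) `|`
  hull (x + sh t + axis i a) (x + sh t + axis i a + axis j b).
have coordij k : k = i \/ k = j \/ (k != i /\ k != j).
  by case: (eqVneq k i) => [|ki]; [left|case: (eqVneq k j); [right;left|right;right]].
have iji : (i == j) = false by apply/negbTE.
have jii : (j == i) = false by rewrite eq_sym.
have sep t t' z w : t \in [:: -1; 0; 1] -> t' \in [:: -1; 0; 1] -> t < t' ->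
    M t z -> M t' w -> (r <= normoo (z - w)%R)%N.
  move=> ht ht' tt' Mz Mw.
  have tr : t' * r%:Z - t * r%:Z >= r%:Z.
    by move: ht ht' tt'; rewrite !inE => /or3P[] /eqP-> /or3P[] /eqP->; lia.
  suff : (r <= `|(z - w)%R ord0 i|)%N \/ (r <= `|(z - w)%R ord0 j|)%N.
    by case=> h; apply: leq_trans h (normoo_coord _ _).
  move: Mz Mw; rewrite !coordE /M /hull /=.
  move=> [] Mz [] Mw; move: (Mz i) (Mz j) (Mw i) (Mw j);
    rewrite !coordE ?eqxx ?iji ?jii /sgn;
    move: (t * r%:Z) (t' * r%:Z) tr => u u' tr;
    case: ifP => ha; case: ifP => hb; rewrite ?mulr1 ?mulrN1; lia.
have free : exists2 t, t \in [:: -1; 0; 1] &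
    forall z, M t z -> ~ D z /\ ~ I z.
  apply: contrapT => nex.
  have hit t : t \in [:: -1; 0; 1] -> exists z, M t z /\ (D z \/ I z).
    move=> ht; apply: contrapT => /forallNP nz; apply: nex; exists t => // z Mz.
    by split=> ?; apply: (nz z); split=> //; [left|right].
  have [|z1 [M1 h1]] := hit (-1); first by rewrite !inE.
  have [|z2 [M2 h2]] := hit 0; first by rewrite !inE.
  have [|z3 [M3 h3]] := hit 1; first by rewrite !inE.
  have s12 : (r <= normoo (z1 - z2)%R)%N by apply: (sep (-1) 0).
  have s13 : (r <= normoo (z1 - z3)%R)%N by apply: (sep (-1) 1).
  have s23 : (r <= normoo (z2 - z3)%R)%N by apply: (sep 0 1).
  case: h1 h2 h3 => h1 [] h2 [] h3;
    by [have := Dr _ _ h1 h2; lia | have := Dr _ _ h1 h3; lia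
       |have := Dr _ _ h2 h3; lia | have := Ir _ _ h1 h2; lia
       |have := Ir _ _ h1 h3; lia | have := Ir _ _ h2 h3; lia].
have [t ht Mt] := free.
have tr : (`|(t * r%:Z)%R| <= r)%N.
  by move: ht; rewrite !inE => /or3P[] /eqP->; lia.
have trs (s : int) : (`|(t * r%:Z * sgn s)%R| <= r)%N.
  by move: tr; rewrite /sgn; case: ifP => _; lia.
have shr : (normoo (sh t) <= r)%N.
  apply/normooP => k; rewrite /sh !coordE; case: (coordij k) => [->|[->|[/negbTE-> /negbTE->]]].
  - by rewrite eqxx iji addr0 abszN.
  - by rewrite eqxx jii add0r.
  - by rewrite addr0.
have sh1 : (norm1 (sh t) <= 2 * r)%N.
  rewrite (leq_trans (norm1D _ _)) // !norm1_axis0 abszN.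
  by have := trs a; have := trs b; lia.
have MA z : M t z -> A z.
  move=> Mz; have [nD nI] := Mt _ Mz.
  suff : (normoo (z - x)%R <= maxn `|a| `|b| + r)%N by move=> /cov [|[]].
  apply/normooP => k.
  have ta := trs a; have tb := trs b.
  by case: Mz => Mz; move: (Mz k); rewrite !coordE;
    case: (coordij k) => [->|[->|[/negbTE ki /negbTE kj]]];
    rewrite ?eqxx ?iji ?jii ?ki ?kj; move: ta tb;
    rewrite /sh ?coordE ?ki ?kj;
    move: (t * r%:Z * sgn a) (t * r%:Z * sgn b) => u v; lia.
have -> : y = x + sh t + axis i a + axis j b - sh t.
  by rewrite /y (addrAC x (sh t)) (addrAC _ (sh t)) addrK.
(* The shift costs [2 * r] inside the clear ball around [x] and again inside the one around [y]; in
   between lie the two legs. *)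
rewrite (_ : (_ + _ + 4 * r = 2 * r + (`|a| + (`|b| + 2 * r)))%N); last by lia.
apply: (@joined_trans _ _ _ _ (x + sh t)).
  apply: joined_mono (joined_nball_hull (c := x) (m := r) _ _ Ax) => //.
  - by rewrite addrC addKr.
  - by rewrite /nball /= subrr normoo0.
  - by rewrite /nball /= opprD addrA subrr add0r normooN.
apply: (@joined_trans _ _ _ _ (x + sh t + axis i a)).
  apply: joined_mono (joined_hull _ _) => [z hz|].
    by apply: MA; left.
  by rewrite [_ + axis i a]addrC addrK norm1_axis0.
apply: (@joined_trans _ _ _ _ (x + sh t + axis i a + axis j b)).
  apply: joined_mono (joined_hull _ _) => [z hz|].
    by apply: MA; right.
  by rewrite [_ + axis j b]addrC addrK norm1_axis0.
have ysh : x + sh t + axis i a + axis j b = y + sh t.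
  by rewrite /y (addrAC x (sh t)) (addrAC _ (sh t)).
rewrite ysh addrK.
apply: joined_mono (joined_nball_hull (c := y) (m := r) _ _ Ay) => //.
- by rewrite opprD addrA subrr add0r norm1N.
- by rewrite /nball /= opprD addrA subrr add0r normooN.
- by rewrite /nball /= subrr normoo0.
Qed.

End Geometry.

(** * Cascades of bad vertices *)

Section Cascade.
Variable d : nat.
Implicit Types (x y z w c : lattice d) (A B : set (lattice d)).
Variables l r : nat -> nat.

(* At level [n] the index [z] stands for the site [L_n z], where [L_n] is [L_0]
   times the product of the [l i], [i < n]; [B0] holds the bad seeds. *)
Fixpoint cascade (B0 : set (lattice d)) (n : nat) : set (lattice d) :=
  match n with
  | 0 => B0
  | n.+1 => [set z | exists z1 z2,
      [/\ nball ((l n)%:Z *: z) (2 * l n) z1, nball ((l n)%:Z *: z) (2 * l n) z2,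
          (r n <= normoo (z1 - z2)%R)%N, cascade B0 n z1 & cascade B0 n z2]]
  end.

Variables D0 I0 : set (lattice d).

Definition good (n : nat) : set (lattice d) :=
  [set z | ~ cascade D0 n z /\ ~ cascade I0 n z].

Hypothesis hd : (2 <= d)%N.
Hypothesis r_gt0 : forall n, (0 < r n)%N.
Hypothesis rl : forall n, (16 * r n <= l n)%N.

Let i0 : 'I_d := Ordinal (ltnW hd).
Let i1 : 'I_d := Ordinal hd.

Lemma joined_map A B (k m : nat) (f : lattice d -> lattice d) x y :
  (forall z, A z -> B (f z)) ->
  (forall z w, A z -> A w -> adjacent z w -> joined B k (f z) (f w)) ->
  joined A m x y -> joined B (m * k) (f x) (f y).
Proof.
move=> AB step [p [[pp lp Ap] sp]].
suff : joined B (size p * k) (f x) (f y).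
  by apply: joined_mono => //; rewrite leq_mul2r sp orbT.
elim: p x pp lp Ap {sp} => [|a p IH] x /= => [_ <- Ap|/andP[xa pa] lp Ap].
  by rewrite mul0n; apply/joined_refl/AB/Ap; rewrite mem_head.
rewrite mulSn; apply: joined_trans (IH _ pa lp _).
  by apply: step => //; apply: Ap; rewrite !inE eqxx ?orbT.
by move=> z zp; apply: Ap; rewrite in_cons zp orbT.
Qed.

(* Of the three balls around [l z], [l z + 3 r e_0] and [l z + 6 r e_0], which are
   at mutual distance at least [r], each of the two bad sets meets at most one. *)
Lemma clear_center n z : good n.+1 z ->
  exists m : int, 0 <= m <= (6 * r n)%N%:Z /\
    forall w, nball ((l n)%:Z *: z + axis i0 m) (r n) w -> good n w.
Proof.
move=> [nD nI]; set o := (l n)%:Z *: z.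
have rn0 := r_gt0 n; have rln := rl n.
apply: contrapT => nex.
have hit (k : nat) : (k <= 2)%N -> exists w,
    nball (o + axis i0 (k%:Z * (3 * r n)%N%:Z)) (r n) w /\
    (cascade D0 n w \/ cascade I0 n w).
  move=> k2; apply: contrapT => /forallNP nw; apply: nex.
  exists (k%:Z * (3 * r n)%N%:Z); split; first by nia.
  move=> w hw; split=> bw; apply: (nw w); split=> //; by [left|right].
have inwin (k : nat) w : (k <= 2)%N ->
    nball (o + axis i0 (k%:Z * (3 * r n)%N%:Z)) (r n) w -> nball o (2 * l n) w.
  rewrite /nball /= => k2 hw.
  have := normoo_dist3 (o + axis i0 (k%:Z * (3 * r n)%N%:Z)) o w.
  by rewrite opprD addrA subrr sub0r normooN normoo_axis; nia.
have sep (k k' : nat) w w' : (k < k')%N ->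
    nball (o + axis i0 (k%:Z * (3 * r n)%N%:Z)) (r n) w ->
    nball (o + axis i0 (k'%:Z * (3 * r n)%N%:Z)) (r n) w' ->
    (r n <= normoo (w - w')%R)%N.
  rewrite /nball /= => kk' /normooP/(_ i0) hw /normooP/(_ i0) hw'.
  apply: leq_trans (normoo_coord _ i0); move: hw hw'.
  rewrite !coordE eqxx; nia.
have [//|w1 [M1 h1]] := hit 0%N.
have [//|w2 [M2 h2]] := hit 1%N.
have [//|w3 [M3 h3]] := hit 2%N.
have s12 : (r n <= normoo (w1 - w2)%R)%N by apply: sep M1 M2.
have s13 : (r n <= normoo (w1 - w3)%R)%N by apply: sep M1 M3.
have s23 : (r n <= normoo (w2 - w3)%R)%N by apply: sep M2 M3.
have wi1 := inwin 0%N _ isT M1; have wi2 := inwin 1%N _ isT M2.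
have wi3 := inwin 2%N _ isT M3.
case: h1 h2 h3 => h1 [] h2 [] h3.
- by apply: nD; exists w1, w2.
- by apply: nD; exists w1, w2.
- by apply: nD; exists w1, w3.
- by apply: nI; exists w2, w3.
- by apply: nD; exists w2, w3.
- by apply: nI; exists w1, w3.
- by apply: nI; exists w1, w2.
- by apply: nI; exists w1, w2.
Qed.

(** Clear centres of adjacent vertices differ by [l n] along axis [k] and by at most [6 * r n] along
    axis 0; [detour] adds [4 * r n]. When [k] is axis 0, axis 1 supplies the plane in which to go
    around, with a leg of length 0. *)
Lemma detour_good n z (m m' : int) (k : 'I_d) (s : int) :
  good n.+1 z -> `|s|%N = 1%N ->
  0 <= m <= (6 * r n)%N%:Z -> 0 <= m' <= (6 * r n)%N%:Z ->
  let x := (l n)%:Z *: z + axis i0 m in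
  let y := (l n)%:Z *: (z + axis k s) + axis i0 m' in
  (forall w, nball x (r n) w -> good n w) ->
  (forall w, nball y (r n) w -> good n w) ->
  joined (good n) (l n + 10 * r n) x y.
Proof.
move=> [nD nI] s1 hm hm' x y xg yg; set o := (l n)%:Z *: z.
have rn0 := r_gt0 n; have rln := rl n.
have ls : `|((l n)%:Z * s)%R|%N = l n by rewrite abszM s1 muln1.
pose Db := [set w | nball o (2 * l n) w /\ cascade D0 n w].
pose Ib := [set w | nball o (2 * l n) w /\ cascade I0 n w].
have [i [j [a [b [ij yE ab]]]]] : exists i j a b, [/\ i != j,
    y = x + axis i a + axis j b &
    (maxn `|a| `|b| <= l n + 6 * r n /\ `|a| + `|b| <= l n + 6 * r n)%N].
  case: (eqVneq k i0) => [ki|ki].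
    exists i0, i1, (m' - m + (l n)%:Z * s), 0; split=> //; last first.
      by move: ls hm hm'; move: (_ * s) => t; lia.
    apply: coord_inj => q; rewrite /y /x !coordE ki.
    case: (q == i0); case: (q == i1); nia.
  exists i0, k, (m' - m), ((l n)%:Z * s); split=> //.
  - by rewrite eq_sym.
  - apply: coord_inj => q; rewrite /y /x !coordE.
    case: (eqVneq q i0) => [->|]; last by case: (q == k); nia.
    by rewrite [i0 == k]eq_sym (negbTE ki); nia.
  - by move: ls hm hm'; move: (_ * s) => t; lia.
rewrite yE; apply: joined_mono (@detour _ (good n) Db Ib (r n) x i j a b ij rn0 _ _ _ _ _) => //.
- by case: ab; lia.
- move=> u v [uw ud] [vw vd]; rewrite ltnNge; apply/negP => uv.
  by apply: nD; exists u, v.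
- move=> u v [uw ud] [vw vd]; rewrite ltnNge; apply/negP => uv.
  by apply: nI; exists u, v.
- move=> w wx.
  (* [w] is within [l n + 7 * r n] of [x], and [x] within [6 * r n] of [o]; [16 * r n <= l n] keeps
     the whole detour in the window where goodness confines the bad vertices. *)
  have wo : nball o (2 * l n) w.
    rewrite /nball /= normoo_distC.
    have := normoo_dist3 x w o.
    have -> : x - o = axis i0 m by rewrite /x addrC addKr.
    by rewrite normoo_axis; case: ab; lia.
  case: (pselect (cascade D0 n w)) => dw; first by right; left.
  case: (pselect (cascade I0 n w)) => iw; first by right; right.
  by left.
- by rewrite -yE.
Qed.

(* The recursion [K_(n+1) = (l n + 10 r n) K_n] for the path length keeps
   [K_n] comparable to the product of the [l i] as long as the sum of
   [r n / l n] converges; this is why the detour must cost only [O(r n)]. *)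
Lemma good_representatives n : exists h : lattice d -> lattice d,
  (forall z, good n z -> good 0 (h z) /\
     (normoo ((h z) - (\prod_(i < n) l i)%N%:Z *: z)%R <= \prod_(i < n) l i)%N) /\
  (forall z z', good n z -> good n z' -> adjacent z z' ->
     joined (good 0) (\prod_(i < n) (l i + 10 * r i)) (h z) (h z')).
Proof.
elim: n => [|n [h [hg hj]]].
  exists id; rewrite !big_ord0; split=> [z gz|z z' gz gz' zz'].
    by split=> //; rewrite scale1r subrr normoo0.
  exact: joined_step.
have rn0 := r_gt0 n; have rln := rl n.
have /choice[c hc] : forall z, exists m : int, good n.+1 z ->
    0 <= m <= (6 * r n)%N%:Z /\
    forall w, nball ((l n)%:Z *: z + axis i0 m) (r n) w -> good n w.
  move=> z; case: (pselect (good n.+1 z)) => gz; last by exists 0.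
  by have [m hm] := clear_center gz; exists m.
pose cz z := (l n)%:Z *: z + axis i0 (c z).
have czg z : good n.+1 z -> good n (cz z).
  by move=> /hc[_]; apply; rewrite /nball /= subrr normoo0.
exists (h \o cz); split=> [z gz|z z' gz gz' zz'].
  have [h0 hl] := hg _ (czg _ gz); split=> //.
  have [cm _] := hc _ gz.
  rewrite !big_ord_recr /=; set L := (\prod_(i < n) l i)%N in hl *.
  have -> : h (cz z) - (L * l n)%N%:Z *: z =
      (h (cz z) - L%:Z *: cz z) + L%:Z *: axis i0 (c z).
    by rewrite /cz scalerDr PoszM scalerA opprD addrA subrK.
  rewrite (leq_trans (normooD _ _)) // normooZ normoo_axis; nia.
have [k [s [s1 zE]]] := adjacent_axisP zz'.
rewrite !big_ord_recr /= mulnC; apply: (joined_map (A := good n)).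
- by move=> w /hg[].
- exact: hj.
have [cm cg] := hc _ gz; have [cm' cg'] := hc _ gz'.
have ozE : (l n)%:Z *: z' + axis i0 (c z') =
  (l n)%:Z *: (z + axis k s) + axis i0 (c z') by rewrite -zE.
by rewrite /cz ozE; apply: detour_good => //; rewrite -ozE.
Qed.

End Cascade.

(** * Local events and measurability *)

Section LocalEvents.
Variable d : nat.
Implicit Types (x y z : lattice d) (K A : set (lattice d)) (xi : cfg d).
Implicit Types (G : set (cfg d)).

(** Dependence on the coordinates in [K], stated pointwise because this is easy to check for path
    events; [sigma_coord_nball] converts it to membership in the sigma-algebra when a ball
    suffices. *)
Definition local K G : Prop :=
  forall xi xi', (forall y, K y -> xi y = xi' y) -> G xi -> G xi'.

Lemma sigma_coord_mono K K' G :
  K `<=` K' -> sigma_coord K G -> sigma_coord K' G.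
Proof.
move=> KK'; apply: sub_smallest2r; first exact: smallest_sigma_algebra.
by move=> B [x Kx Bx]; exists x => //; exact: KK'.
Qed.

(** Induction on the list: split [G] by the value at the first site. Once this value is overwritten,
    each half is a cylinder met with an event that depends on the remaining sites only. An event
    depending on no site is full or empty. *)
Lemma sigma_coord_seq (s : seq (lattice d)) K G :
  (forall y, y \in s -> K y) -> local [set` s] G -> sigma_coord K G.
Proof.
elim: s G => [|x s IH] G sK Gs.
  rewrite /sigma_coord.
  have [[xi Gxi]|nG] := pselect (exists xi, G xi).
    have -> : G = setT by apply/seteqP; split=> // xi' _; apply: Gs Gxi => y.
    exact: (@measurableT _ (g_sigma_algebraType (cylinders K))).
  have -> : G = set0 by apply/seteqP; split=> // xi' Gxi'; apply: nG; exists xi'.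
  exact: (@measurable0 _ (g_sigma_algebraType (cylinders K))).
pose upd (b : bool) xi : cfg d := fun y => if y == x then b else xi y.
pose Gb b := [set xi | G (upd b xi)].
have GE : G = (Psi x @^-1` [set true] `&` Gb true) `|`
              (Psi x @^-1` [set false] `&` Gb false).
  have updE b xi : Psi x xi = b -> G (upd b xi) <-> G xi.
    rewrite /Psi /upd => xb; split; apply: Gs => y _; case: eqP => [->|//] //.
  apply/seteqP; split=> xi.
    move=> Gxi; case xb : (Psi x xi); [left|right]; split=> //=.
      by apply/updE. by apply/updE.
  by case=> -[/= xb]; rewrite /Gb /= updE.
have mPsi b : sigma_coord K (Psi x @^-1` [set b]).
  apply: sub_gen_smallest; exists x; first by apply: sK; rewrite mem_head.
  by exists [set b] => //; rewrite setTI.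
have mGb b : sigma_coord K (Gb b).
  apply: IH => [y ys|xi xi' h]; first by apply: sK; rewrite in_cons ys orbT.
  apply: Gs => y /=; rewrite inE /upd => /orP[->//|ys]; case: ifP => // _.
  exact: h.
rewrite GE.
apply: (@measurableU _ (g_sigma_algebraType (cylinders K)));
   apply: (@measurableI _ (g_sigma_algebraType (cylinders K))); first [exact: mPsi|exact: mGb].
Qed.

Lemma nball_seq x m :
  exists s : seq (lattice d), forall y, (y \in s) <-> nball x m y.
Proof.
pose f (g : {ffun 'I_d -> 'I_(m.*2.+1)}) : lattice d :=
  \row_i (x ord0 i - m%:Z + (g i)%:Z).
have fE g i : f g ord0 i = x ord0 i - m%:Z + (g i)%:Z :> int by rewrite mxE.
exists [seq f g | g <- enum {: {ffun 'I_d -> 'I_(m.*2.+1)}}] => y; split.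
  move=> /mapP[g _ ->]; apply/normooP => i; rewrite coordD coordN fE.
  by move: (nat_of_ord _) (ltn_ord (g i)) => k; move: (x _ _) => u; lia.
move=> /normooP hy; apply/mapP.
exists [ffun i => inord `|(y ord0 i - x ord0 i + m%:Z)%R|]; first by rewrite mem_enum.
apply: coord_inj => i; rewrite fE ffunE inordK; have := hy i; rewrite coordD coordN; lia.
Qed.

Lemma sigma_coord_nball x m K G :
  nball x m `<=` K -> local (nball x m) G -> sigma_coord K G.
Proof.
have [s hs] := nball_seq x m; move=> sK Gs; apply: (@sigma_coord_seq s).
  by move=> y /hs; exact: sK.
by move=> xi xi' h; apply: Gs => y /hs; exact: h.
Qed.

Lemma boxE (R : realType) x m : box x (m%:R : R) = nball x m.
Proof. by rewrite /box /nball -[m%:R]/(m%:Z%:~R) intrKfloor. Qed.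

Lemma measurable_sigma_coord K G :
  sigma_coord K G -> measurable (G : set (configuration d)).
Proof. exact: sigma_coord_mono. Qed.

Lemma measurable_local x m G :
  local (nball x m) G -> measurable (G : set (configuration d)).
Proof. exact: sigma_coord_nball. Qed.

Lemma measurable_exists (T : countType) (G : T -> set (configuration d)) :
  (forall i, measurable (G i)) -> measurable [set xi | exists i, G i xi].
Proof.
move=> mG.
rewrite (_ : [set xi | _] = \bigcup_i G i); last first.
  by apply/seteqP; split=> xi [i]; [exists i | move=> _; exists i].
by apply: countable_bigcupT_measurable => //; exact: countableP.
Qed.

Lemma measurable_forall (T : countType) (G : T -> set (configuration d)) :
  (forall i, measurable (G i)) -> measurable [set xi | forall i, G i xi].
Proof.
move=> mG.
rewrite (_ : [set xi | _] = ~` [set xi | exists i, ~ G i xi]).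
  by apply: measurableC; apply: measurable_exists => i; exact: measurableC.
apply/seteqP; split=> xi /= h; first by case=> i; apply.
by move=> i; apply: contrapT => n; apply: h; exists i.
Qed.

Lemma measurable_imply (G H : set (configuration d)) :
  measurable G -> measurable H -> measurable [set xi | G xi -> H xi].
Proof.
move=> mG mH; rewrite (_ : [set xi | _] = ~` G `|` H).
  by apply: measurableU => //; exact: measurableC.
apply/seteqP; split=> xi /=; last by case.
by move=> h; case: (pselect (G xi)) => [/h|]; [right|left].
Qed.

Lemma measurable_constant (Q : Prop) : measurable [set xi : configuration d | Q].
Proof.
case: (pselect Q) => q.
  by rewrite (_ : [set _ | _] = setT) //; apply/seteqP; split.
by rewrite (_ : [set _ | _] = set0) //; apply/seteqP; split.
Qed.

Lemma measurable_walk A x y p :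
  measurable [set xi : configuration d | walk (occupied xi `&` A) x y p].
Proof.
apply: (@measurable_sigma_coord setT); apply: (@sigma_coord_seq (x :: p)) => //.
move=> xi xi' h [pp lp Ap]; split=> // z zp; have [oz Az] := Ap _ zp.
by split=> //; rewrite /occupied /= -(h z zp).
Qed.

Lemma measurable_connected A x y :
  measurable [set xi : configuration d | connected_in (occupied xi `&` A) x y].
Proof. apply: measurable_exists => p; exact: measurable_walk. Qed.

Lemma measurable_connectedT x y :
  measurable [set xi : configuration d | connected_in (occupied xi) x y].
Proof.
have := measurable_connected setT x y.
by under [X in measurable X]eq_set do rewrite setIT.
Qed.

Lemma measurable_occupied x : measurable [set xi : configuration d | occupied xi x].
Proof.
apply: (@measurable_sigma_coord setT); apply: (@sigma_coord_seq [:: x]) => //.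
by move=> xi xi' h; rewrite /occupied /= (h x) //= mem_head.
Qed.

End LocalEvents.

(** * Long and infinite clusters as measurable events *)

Section Clusters.
Variables (R : realType) (d : nat).
Implicit Types (x y z : lattice d) (K A : set (lattice d)) (xi : cfg d).

(** Distances are integers, so a diameter of at least [t] is witnessed by a pair: otherwise the
    ceiling of [t] minus 1, which is below [t], would bound them all. *)
Lemma occupied_geP (t : R) xi x :
  occupied_ge t%:E xi x <-> occupied xi x /\
   exists y z, [/\ connected_in (occupied xi) x y, connected_in (occupied xi) x z &
     t <= (norm1 (y - z))%:R].
Proof.
split=> -[ox h]; split=> //; last first.
  case: h => y [z [xy xz tyz]].
  apply: (@le_trans _ _ (norm1 (y - z))%:R%:E); first by rewrite lee_fin.
  by apply: ereal_sup_ubound; exists y, z.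
apply: contrapT => nyz.
have : (diameter R (component (occupied xi) x) <= (Num.ceil t - 1)%:~R%:E)%E.
  apply: ge_ereal_sup => _ [y [z [xy xz ->]]]; rewrite lee_fin.
  have : (norm1 (y - z))%:R < t.
    by rewrite ltNge; apply/negP => tyz; apply: nyz; exists y, z.
  by rewrite pmulrn -ceil_gt_int ler_int lerBrDr lezD1.
move=> /(le_trans h); rewrite lee_fin => tc.
have := ceilB1_lt t.
by rewrite ltNge tc.
Qed.

Lemma occupied_geyP xi x :
  occupied_ge (+oo : \bar R)%E xi x <->
  forall n : nat, occupied_ge (n%:R : R)%:E xi x.
Proof.
split=> [[ox h] n|h]; first by split=> //; apply: le_trans h; rewrite leey.
have [ox _] := h 0%N; split=> //.
have {h} h n := proj2 (h n).
case: (diameter R _) h => [s h| //|h]; last by have := h 0%N.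
have := h (Num.trunc s).+1; rewrite lee_fin.
by rewrite leNgt truncnS_gt.
Qed.

Lemma occupied_ge_le (s t : R) xi x : s <= t ->
  occupied_ge t%:E xi x -> occupied_ge s%:E xi x.
Proof. by move=> st [ox h]; split=> //; apply: le_trans h; rewrite lee_fin. Qed.

Lemma connected_occupied_ge (t : R) xi x y :
  connected_in (occupied xi) x y -> t <= (normoo (x - y))%:R ->
  occupied_ge t%:E xi x.
Proof.
move=> xy txy; apply/occupied_geP; split; first exact: connected_meml xy.
exists x, y; split=> //; last by rewrite (le_trans txy) // ler_nat normoo_le_norm1.
by exists [::]; split=> // z; rewrite inE => /eqP->; exact: connected_meml xy.
Qed.

(** Lengths are integers, so an infimum at most [t] is attained by a walk: otherwise the floor of
    [t] plus 1 would be a lower bound. *)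
Lemma graph_dist_leP A x y (t : R) :
  (graph_dist R A x y <= t%:E)%E <-> exists p, walk A x y p /\ (size p)%:R <= t.
Proof.
split=> [h|[p [wp pt]]]; last first.
  by apply: le_trans (_ : (size p)%:R%:E <= _)%E;
    [apply: ereal_inf_lbound; exists p | rewrite lee_fin].
apply: contrapT => np.
have : ((Num.floor t + 1)%:~R%:E <= graph_dist R A x y)%E.
  apply: le_ereal_inf_tmp => _ [p wp <-]; rewrite lee_fin.
  have : t < (size p)%:R by rewrite ltNge; apply/negP => pt; apply: np; exists p.
  by rewrite pmulrn -floor_lt_int ler_int lezD1.
move=> /le_trans /(_ h); rewrite lee_fin => tc.
by have := floorD1_gt t; rewrite ltNge tc.
Qed.

Lemma measurable_occupied_ge (t : R) x :
  measurable [set xi : configuration d | occupied_ge t%:E xi x].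
Proof.
have -> : [set xi : configuration d | occupied_ge t%:E xi x] =
  [set xi | occupied xi x] `&` [set xi | exists y, exists z,
    connected_in (occupied xi) x y /\ (connected_in (occupied xi) x z /\
     t <= (norm1 (y - z))%:R)].
  apply/seteqP; split=> xi.
    by move=> /occupied_geP [ox [y [z [? ? ?]]]]; split=> //; exists y, z.
  by move=> [ox [y [z [? [? ?]]]]]; apply/occupied_geP; split=> //; exists y, z.
apply: measurableI; first exact: measurable_occupied.
apply: measurable_exists => y; apply: measurable_exists => z.
apply: measurableI; first exact: measurable_connectedT.
apply: measurableI; first exact: measurable_connectedT.
exact: measurable_constant.
Qed.

Lemma measurable_graph_dist x y (t : R) :
  measurable [set xi : configuration d | (graph_dist R (occupied xi) x y <= t%:E)%E].
Proof.
have -> : [set xi : configuration d | (graph_dist R (occupied xi) x y <= t%:E)%E] =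
  [set xi | exists p, walk (occupied xi `&` setT) x y p /\ (size p)%:R <= t].
  by apply/seteqP; split=> xi /=; rewrite setIT => /graph_dist_leP.
apply: measurable_exists => p.
apply: measurableI; [exact: measurable_walk|exact: measurable_constant].
Qed.

(* A local increasing event standing in for [x \in S_oo]; its probability
   decreases to [eta] as [k] grows. *)
Definition far (k : nat) xi x : Prop :=
  exists y, (k <= normoo (x - y)%R)%N /\ connected_in (occupied xi) x y.

(** Stop the walk at its first site at distance at least [k]: up to then it has not left the ball.
    This is what makes [far] a local event. *)
Lemma far_exit k xi x : far k xi x ->
  exists y, (k <= normoo (x - y)%R)%N /\
    connected_in (occupied xi `&` nball x k) x y.
Proof.
move=> [y [kxy [p [pp lp Ap]]]].
suff H q z : connected_in (occupied xi `&` nball x k) x z ->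
    path (@adjacent d) z q -> (forall w, w \in z :: q -> occupied xi w) ->
    (k <= normoo (x - last z q)%R)%N ->
    exists y, (k <= normoo (x - y)%R)%N /\
    connected_in (occupied xi `&` nball x k) x y.
  apply: (H p x) => //; last by rewrite lp.
  exists [::]; split=> // w; rewrite inE => /eqP->; split.
    by apply: Ap; rewrite mem_head.
  by rewrite /nball /= subrr normoo0.
elim: q z => [|w q IH] z xz; first by move=> _ _ kz; exists z.
case: (leqP k (normoo (x - z)%R)) => [kz _ _ _|kz]; first by exists z.
move=> /= /andP[zw wq] Aq kl; apply: (IH w) => //; last first.
  by move=> v vq; apply: Aq; rewrite in_cons vq orbT.
apply: connected_trans xz _; exists [:: w]; split=> //=; first by rewrite zw.
have hz : nball x k z by rewrite /nball /= ltnW.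
have hw : nball x k w.
  rewrite /nball /=; have := normoo_dist3 z x w.
  by have := adjacent_normoo zw; lia.
move=> v; rewrite !inE => /orP[] /eqP->; split=> //; apply: Aq.
  by rewrite mem_head.
by rewrite !inE eqxx orbT.
Qed.

Lemma local_far k x : local (nball x k) [set xi | far k xi x].
Proof.
move=> xi xi' h /far_exit [y [kxy [p [pp lp Ap]]]]; exists y; split=> //.
exists p; split=> // z /Ap [oz kz]; by rewrite /occupied /= -h.
Qed.

Lemma connected_increasing xi xi' A x y : (forall z, xi z ==> xi' z) ->
  connected_in (occupied xi `&` A) x y -> connected_in (occupied xi' `&` A) x y.
Proof.
move=> h; apply: connected_mono => z [oz Az]; split=> //.
by have := h z; rewrite /occupied /= in oz *; rewrite oz.
Qed.

Lemma far_increasing k x : increasing [set xi | far k xi x].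
Proof.
move=> xi xi' [y [kxy xy]] h; exists y; split=> //.
by move: xy; rewrite -[occupied xi]setIT -[occupied xi']setIT;
  exact: connected_increasing.
Qed.

Lemma far_le k k' xi x : (k <= k')%N -> far k' xi x -> far k xi x.
Proof. by move=> kk' [y [h c]]; exists y; split=> //; exact: leq_trans h. Qed.

Lemma infinite_far xi x :
  occupied_ge (+oo : \bar R)%E xi x <-> (forall k, far k xi x).
Proof.
rewrite occupied_geyP; split=> [h k|h n].
  (* Two sites at l1 distance above [2 * d * k] are more than [2 * k] apart in sup norm, so one of
     them is at distance at least [k] from [x]. *)
  have /occupied_geP [ox [y [z [xy xz]]]] := h (d * (k + k)).+1%N.
  rewrite ler_nat => yz.
  case: (leqP k (normoo (x - y)%R)) => ky; first by exists y.
  exists z; split=> //; rewrite leqNgt; apply/negP => kz.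
  have := norm1_le_normoo (y - z); have := normoo_dist3 x y z.
  by rewrite [normoo (y - x)%R]normoo_distC; nia.
have [y [nxy xy]] := h n.
by apply: connected_occupied_ge xy _; rewrite ler_nat.
Qed.

End Clusters.

(** * Counting finitely many events *)

Section Prob.
Variables (dd : measure_display) (T : measurableType dd) (R : realType).
Variable mu : probability T R.
Implicit Types (A B : set T).

Definition prob A : R := fine (mu A).

Lemma EFin_prob A : measurable A -> (prob A)%:E = mu A.
Proof. by move=> mA; rewrite /prob fineK // fin_num_measure. Qed.

Lemma prob_ge0 A : 0 <= prob A.
Proof. by rewrite /prob fine_ge0 // measure_ge0. Qed.

Lemma prob_le A B : measurable A -> measurable B -> A `<=` B -> prob A <= prob B.
Proof.
move=> mA mB AB; rewrite -lee_fin !EFin_prob //.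
by apply: le_measure => //; rewrite inE.
Qed.

Lemma prob_le1 A : measurable A -> prob A <= 1.
Proof. by move=> mA; rewrite -lee_fin EFin_prob // probability_le1. Qed.

Lemma prob0 : prob set0 = 0.
Proof. by rewrite /prob measure0. Qed.

Lemma probC A : measurable A -> prob (~` A) = 1 - prob A.
Proof.
move=> mA; apply: EFin_inj; rewrite EFinB !EFin_prob //; last exact: measurableC.
exact: probability_setC.
Qed.

Lemma probU A B : measurable A -> measurable B -> A `&` B = set0 ->
  prob (A `|` B) = prob A + prob B.
Proof.
move=> mA mB AB; apply: EFin_inj; rewrite EFinD !EFin_prob ?measureU //.
exact: measurableU.
Qed.

Lemma probU2 A B : measurable A -> measurable B ->
  prob (A `|` B) <= prob A + prob B.
Proof.
move=> mA mB; rewrite -lee_fin EFinD !EFin_prob ?measureU2 //.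
exact: measurableU.
Qed.

Lemma union_seq_cons (I : eqType) (i : I) (s : seq I) (F : I -> set T) :
  [set t | exists2 j, j \in i :: s & F j t] =
  F i `|` [set t | exists2 j, j \in s & F j t].
Proof.
apply/seteqP; split=> t /=.
  by move=> [j]; rewrite in_cons => /orP[/eqP->|js] Fj; [left|right; exists j].
by move=> [Fi|[j js Fj]]; [exists i => //; rewrite mem_head|
  exists j => //; rewrite in_cons js orbT].
Qed.

Lemma measurable_union_seq (I : eqType) (s : seq I) (F : I -> set T) :
  (forall i, i \in s -> measurable (F i)) ->
  measurable [set t | exists2 i, i \in s & F i t].
Proof.
elim: s => [|i s IH] mF.
  by rewrite (_ : [set _ | _] = set0) //; apply/seteqP; split=> // t [].
rewrite union_seq_cons; apply: measurableU; first by apply: mF; rewrite mem_head.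
by apply: IH => j js; apply: mF; rewrite in_cons js orbT.
Qed.

Lemma prob_union_seq (I : eqType) (s : seq I) (F : I -> set T) (e : R) :
  (forall i, i \in s -> measurable (F i)) ->
  (forall i, i \in s -> prob (F i) <= e) ->
  prob [set t | exists2 i, i \in s & F i t] <= (size s)%:R * e.
Proof.
elim: s => [|i s IH] mF Fe.
  rewrite (_ : [set _ | _] = set0) ?prob0 ?mul0r //.
  by apply/seteqP; split=> // t [].
have mF' j : j \in s -> measurable (F j).
  by move=> js; apply: mF; rewrite in_cons js orbT.
rewrite union_seq_cons; apply: le_trans (probU2 _ _) _.
- by apply: mF; rewrite mem_head.
- exact: measurable_union_seq.
rewrite /= -add1n natrD mulrDl mul1r lerD //.
  by apply: Fe; rewrite mem_head.
by apply: IH => // j js; apply: Fe; rewrite in_cons js orbT.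
Qed.

Lemma prob_union_fin (I : finType) (F : I -> set T) (e : R) :
  (forall i, measurable (F i)) -> (forall i, prob (F i) <= e) ->
  prob [set t | exists i, F i t] <= #|I|%:R * e.
Proof.
move=> mF Fe; rewrite cardE.
have -> : [set t | exists i, F i t] = [set t | exists2 i, i \in enum I & F i t].
  apply/seteqP; split=> t [i]; last by exists i.
  by exists i => //; rewrite mem_enum.
by apply: prob_union_seq => i _.
Qed.

Lemma prob_fiber (J : finType) (f : T -> J) (phi : pred J) :
  (forall j, measurable [set t | f t = j]) ->
  measurable [set t | phi (f t)] /\
  prob [set t | phi (f t)] = \sum_(j | phi j) prob [set t | f t = j].
Proof.
move=> mf.
suff H (s : seq J) : uniq s -> measurable [set t | f t \in s] /\
    prob [set t | f t \in s] = \sum_(j <- s) prob [set t | f t = j].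
  have [] := H (enum phi) (enum_uniq _).
  have -> : [set t | f t \in enum phi] = [set t | phi (f t)].
    by apply/seteqP; split=> t /=; rewrite mem_enum.
  by rewrite big_enum.
elim: s => [_|j s IH /= /andP[js us]].
  rewrite big_nil (_ : [set _ | _] = set0) ?prob0 //.
  by apply/seteqP; split.
have [ms ps] := IH us.
have -> : [set t | f t \in j :: s] = [set t | f t = j] `|` [set t | f t \in s].
  apply/seteqP; split=> t /=; rewrite in_cons.
    by move=> /orP[/eqP|]; [left|right].
  by case=> [->|->]; rewrite ?eqxx ?orbT.
split; first exact: measurableU.
rewrite big_cons probU ?ps //; apply/seteqP; split=> t //= -[tj ts].
by rewrite tj (negbTE js) in ts.
Qed.

Variables (I : finType) (F : I -> set T).
Hypothesis mF : forall i, measurable (F i).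

(* Moments of the number of events [F i] that occur become finite sums over the
   possible values of [pattern]. *)
Definition pattern (t : T) : {set I} := [set i | `[< F i t >]].

Lemma measurable_pattern S : measurable [set t | pattern t = S].
Proof.
have -> : [set t | pattern t = S] =
    ~` [set t | exists2 i, i \in enum I & ~ (F i t <-> i \in S)].
  apply/seteqP; split=> t /=.
    by move=> tS [i _]; apply; rewrite -tS inE; split=> /asboolP.
  move=> h; apply/setP => i; rewrite inE; apply/idP/idP => [/asboolP|] Fi.
    apply: contrapT => iS; apply: h; exists i; rewrite ?mem_enum //.
    by case=> /(_ Fi).
  apply/asboolP; apply: contrapT => nFi; apply: h; exists i; rewrite ?mem_enum //.
  by case=> _ /(_ Fi).
apply: measurableC; apply: measurable_union_seq => i _.
have -> : (fun t : T => ~ (F i t <-> i \in S)) = if i \in S then ~` F i else F i.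
  case: ifP => iS; apply/seteqP; split=> t /= h.
  - by move=> Fi; apply: h.
  - by move=> [_ /(_ isT)].
  - by apply: contrapT => nF; apply: h.
  - by case=> /(_ h).
by case: ifP => _ //; exact: measurableC.
Qed.

Lemma measurable_pattern_pred (phi : pred {set I}) :
  measurable [set t | phi (pattern t)].
Proof.
have -> : [set t | phi (pattern t)] =
    [set t | exists2 S, S \in enum phi & pattern t = S].
  apply/seteqP; split=> t /=; first by exists (pattern t); rewrite ?mem_enum.
  by case=> S; rewrite mem_enum => ? ->.
by apply: measurable_union_seq => S _; exact: measurable_pattern.
Qed.

Let q S : R := prob [set t | pattern t = S].

Lemma prob_pattern (phi : pred {set I}) :
  measurable [set t | phi (pattern t)] /\
  prob [set t | phi (pattern t)] = \sum_(S | phi S) q S.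
Proof. by apply: prob_fiber; exact: measurable_pattern. Qed.

Lemma prob_coord i : prob (F i) = \sum_S q S * (i \in S)%:R.
Proof.
have [_] := prob_pattern (fun S => i \in S).
have -> : [set t | i \in pattern t] = F i.
  by apply/seteqP; split=> t /=; rewrite inE => /asboolP.
move=> ->; rewrite [RHS](bigID (fun S : {set I} => i \in S)) /=.
rewrite [X in _ + X]big1 ?addr0; last by move=> S /negbTE->; rewrite mulr0.
by apply: eq_bigr => S ->; rewrite mulr1.
Qed.

Lemma prob_coord2 i j :
  prob (F i `&` F j) = \sum_S q S * ((i \in S)%:R * (j \in S)%:R).
Proof.
have [_] := prob_pattern (fun S => (i \in S) && (j \in S)).
have -> : [set t | (i \in pattern t) && (j \in pattern t)] = F i `&` F j.
  apply/seteqP; split=> t /=; rewrite !inE.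
    by move=> /andP[/asboolP ? /asboolP].
  by move=> [? ?]; apply/andP; split; apply/asboolP.
move=> ->; rewrite [RHS](bigID (fun S : {set I} => (i \in S) && (j \in S))) /=.
rewrite [X in _ + X]big1 ?addr0; last first.
  by move=> S; case: (i \in S); case: (j \in S); rewrite //= ?mulr0 ?mul0r ?mulr0.
by apply: eq_bigr => S /andP[-> ->]; rewrite !mulr1.
Qed.

Lemma card_indicator (S : {set I}) : #|S|%:R = \sum_i (i \in S)%:R :> R.
Proof.
rewrite -sum1_card natr_sum [RHS](bigID (mem S)) /=.
rewrite [X in _ = _ + X]big1 ?addr0; last by move=> i /negbTE->.
by apply: eq_bigr => i ->.
Qed.

(** The centre [c] is arbitrary: it is used with the density [eta] while the events counted have the
    slightly larger probability [etak]. *)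
Lemma chebyshev_card (c e : R) : 0 < e ->
  prob [set t | e <= `| #|pattern t|%:R - c |] * e ^+ 2 <=
  \sum_i \sum_j prob (F i `&` F j) - c *+ 2 * \sum_i prob (F i) + c ^+ 2.
Proof.
move=> e0.
have [_ ->] := prob_pattern (fun S => e <= `| #|S|%:R - c |).
have q1 : \sum_S q S = 1.
  have [_ <-] := prob_pattern (fun=> true).
  rewrite (_ : [set _ | _] = setT); last by apply/seteqP; split.
  by rewrite /prob probability_setT.
have -> : \sum_i \sum_j prob (F i `&` F j) = \sum_S q S * #|S|%:R ^+ 2.
  under eq_bigr do under eq_bigr do rewrite prob_coord2.
  under eq_bigr do rewrite exchange_big /=.
  rewrite exchange_big /=; apply: eq_bigr => S _.
  under eq_bigr do rewrite -mulr_sumr -mulr_sumr -card_indicator.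
  by rewrite -mulr_sumr -mulr_suml -card_indicator expr2.
have -> : \sum_i prob (F i) = \sum_S q S * #|S|%:R.
  under eq_bigr do rewrite prob_coord.
  rewrite exchange_big /=; apply: eq_bigr => S _.
  by rewrite -mulr_sumr -card_indicator.
have -> : c ^+ 2 = \sum_S q S * c ^+ 2 by rewrite -mulr_suml q1 mul1r.
rewrite mulr_sumr -sumrB -big_split /= mulr_suml.
rewrite [leRHS](bigID (fun S : {set I} => e <= `| #|S|%:R - c |)) /=.
have E S : q S * #|S|%:R ^+ 2 - c *+ 2 * (q S * #|S|%:R) + q S * c ^+ 2 =
  q S * (#|S|%:R - c) ^+ 2 by ring.
rewrite -[leLHS]addr0; apply: lerD.
  apply: ler_sum => S eS; rewrite E ler_wpM2l ?prob_ge0 //.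
  by rewrite -[leRHS]real_normK ?num_real // ler_pXn2r ?nnegrE // ltW.
by apply: sumr_ge0 => S _; rewrite E mulr_ge0 ?prob_ge0 ?sqr_ge0.
Qed.

Lemma markov_card (e : R) : 0 < e ->
  prob [set t | e <= #|pattern t|%:R] * e <= \sum_i prob (F i).
Proof.
move=> e0; have [_ ->] := prob_pattern (fun S => e <= #|S|%:R).
have -> : \sum_i prob (F i) = \sum_S q S * #|S|%:R.
  under eq_bigr do rewrite prob_coord.
  rewrite exchange_big /=; apply: eq_bigr => S _.
  by rewrite -mulr_sumr -card_indicator.
rewrite mulr_suml [leRHS](bigID (fun S : {set I} => e <= #|S|%:R)) /=.
rewrite -[leLHS]addr0; apply: lerD.
  by apply: ler_sum => S eS; rewrite ler_wpM2l ?prob_ge0.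
by apply: sumr_ge0 => S _; rewrite mulr_ge0 ?prob_ge0.
Qed.

End Prob.

(** * Elementary limits *)

Section Analysis.
Variable R : realType.
Implicit Types (x t e : R).

Lemma ln_pow_large (e X : R) : 0 < e -> 0 <= X ->
  exists n0 : nat, forall n : nat, (n0 <= n)%N -> X <= ln n%:R `^ e.
Proof.
move=> e0 X0; exists (Num.trunc (expR (X `^ e^-1))).+1 => n hn.
have hx : expR (X `^ e^-1) <= n%:R.
  by apply/ltW/(lt_le_trans (truncnS_gt _)); rewrite ler_nat.
have l : X `^ e^-1 <= ln n%:R.
  by rewrite -[leLHS]expRK ler_ln // posrE ?expR_gt0 // (lt_le_trans (expR_gt0 _) hx).
have -> : X = (X `^ e^-1) `^ e by rewrite -powRrM mulVf ?gt_eqF // powRr1.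
apply: (ge0_ler_powR _ _ _ l); rewrite ?nnegrE ?powR_ge0 ?(ltW e0) //.
exact: le_trans (powR_ge0 _ _) l.
Qed.

Lemma powRN_small (c t : R) : 0 < c -> 0 < t ->
  exists n0 : nat, forall n : nat, (n0 <= n)%N -> n%:R `^ (- c) <= t.
Proof.
move=> c0 t0; exists (Num.trunc (t `^ (- c^-1))).+1 => n hn.
have hx : t `^ (- c^-1) < n%:R.
  by apply: (lt_le_trans (truncnS_gt _)); rewrite ler_nat.
have n0 : (0 : R) < n%:R by apply: le_lt_trans hx; rewrite powR_ge0.
have -> : t = (t `^ (- c^-1)) `^ (- c).
  by rewrite -powRrM mulrNN mulVf ?gt_eqF // powRr1 // ltW.
rewrite !powRN lef_pV2 ?posrE ?powR_gt0 // -?powRN ?powR_gt0 //.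
by apply: ge0_ler_powR; rewrite ?nnegrE ?powR_ge0 ?ltW.
Qed.

End Analysis.

(** * Density of long clusters *)

Section Translation.
Variables (R : realType) (d : nat).
Implicit Types (x y z c : lattice d) (A B : set (lattice d)) (xi : cfg d).

Lemma translateB x y c : (x + c) - (y + c) = x - y.
Proof. by rewrite opprD addrACA subrr addr0. Qed.

Lemma connected_translate A B c y z : (forall w, A w -> B (w + c)) ->
  connected_in A y z -> connected_in B (y + c) (z + c).
Proof.
move=> AB /connected_joined [n yz]; apply: joined_connected.
apply: (@joined_map _ A B 1 n (+%R^~ c)) yz => // u v Au Av uv.
apply: joined_step; [exact: AB|exact: AB|].
by rewrite /adjacent translateB.
Qed.

Lemma connected_shiftI c xi x m y z :
  connected_in (occupied (lattice_shift c xi) `&` nball x m) y z <->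
  connected_in (occupied xi `&` nball (x + c) m) (y + c) (z + c).
Proof.
split; last rewrite -{2}[y](addrK c) -{2}[z](addrK c); apply: connected_translate => w [ow bw];
  split.
- exact: ow.
- by move: bw; rewrite /nball /= translateB.
- by rewrite /occupied /= /lattice_shift subrK.
- by move: bw; rewrite /nball /= opprB addrA.
Qed.

Lemma connected_shift c xi y z :
  connected_in (occupied (lattice_shift c xi)) y z <->
  connected_in (occupied xi) (y + c) (z + c).
Proof.
split; last rewrite -{2}[y](addrK c) -{2}[z](addrK c); apply: connected_translate => w ow //.
by rewrite /occupied /= /lattice_shift subrK.
Qed.

Lemma far_shift c k xi x : far k (lattice_shift c xi) x <-> far k xi (x + c).
Proof.
split=> -[y [kxy xy]]; [exists (y + c) | exists (y - c)]; split.
- by rewrite translateB.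
- exact/connected_shift.
- by rewrite opprB addrA.
- by apply/connected_shift; rewrite subrK.
Qed.

Lemma occupied_ge_shift (t : R) c xi x :
  occupied_ge t%:E (lattice_shift c xi) x <-> occupied_ge t%:E xi (x + c).
Proof.
rewrite !occupied_geP; split=> -[ox [y [z [xy xz tyz]]]]; split=> //.
  exists (y + c), (z + c); split; rewrite ?translateB //; exact/connected_shift.
exists (y - c), (z - c); split; rewrite ?translateB //.
  by apply/connected_shift; rewrite subrK.
by apply/connected_shift; rewrite subrK.
Qed.

End Translation.

Section Cubes.
Variable d : nat.
Implicit Types (y : lattice d).

Definition cube_pt (n : nat) (y : lattice d) (i : {ffun 'I_d -> 'I_n}) : lattice d :=
  n%:Z *: y + \row_j (i j)%:Z.

Lemma coord_cube_pt n y (i : {ffun 'I_d -> 'I_n}) j :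
  cube_pt y i ord0 j = n%:Z * y ord0 j + (i j)%:Z.
Proof. by rewrite /cube_pt coordD coordZ; congr (_ + _); rewrite mxE. Qed.

Lemma cube_pt_inj n y : injective (@cube_pt n y).
Proof.
move=> i i' ii'; apply/ffunP => j; apply: val_inj => /=.
by have := congr1 (fun z : lattice d => z ord0 j) ii'; rewrite !coord_cube_pt; lia.
Qed.

End Cubes.

Section Density.
Variables (R : realType) (d : nat) (a b : R).
Variable P : R -> probability (configuration d) R.
Implicit Types (x y z : lattice d) (xi : cfg d).
Hypothesis d_gt0 : (0 < d)%N.
Hypothesis a_ge0 : 0 <= a.

Lemma prob_shift u x (G H : set (configuration d)) : condP1 a b P -> a < u < b ->
  measurable G -> (forall xi, H xi <-> G (lattice_shift x xi)) ->
  prob (P u) H = prob (P u) G.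
Proof.
move=> hP1 /hP1[inv _] mG GH; rewrite /prob -(inv x G mG); congr (fine (P u _)).
by apply/seteqP; split=> xi /GH.
Qed.

Lemma prob_increasing u v (G : set (configuration d)) : condP2 a b P ->
  a < u -> u <= v -> v < b -> measurable G -> increasing G ->
  prob (P u) G <= prob (P v) G.
Proof.
move=> hP2 au; rewrite le_eqVlt => /orP[/eqP<-//|uv] vb mG iG.
by rewrite -lee_fin !EFin_prob //; exact: hP2.
Qed.

Lemma prob_decreasing u v (G : set (configuration d)) : condP2 a b P ->
  a < u -> u <= v -> v < b -> measurable G -> decreasing G ->
  prob (P v) G <= prob (P u) G.
Proof.
move=> hP2 au uv vb mG dG.
have : prob (P u) (~` G) <= prob (P v) (~` G).
  apply: prob_increasing => //; first exact: measurableC.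
  by move=> xi xi' nG h /dG G'; apply: nG; exact: G'.
by rewrite !probC // lerD2l lerN2.
Qed.

Lemma measurable_far k x : measurable [set xi : configuration d | far k xi x].
Proof. exact: (measurable_local (@local_far _ k x)). Qed.

Definition etak (k : nat) u : R := prob (P u) [set xi | far k xi 0].

Lemma prob_far u k x : condP1 a b P -> a < u < b ->
  prob (P u) [set xi | far k xi x] = etak k u.
Proof.
move=> hP1 hu; apply: (prob_shift (x := x) hP1 hu (measurable_far k 0)) => xi.
by rewrite /= far_shift add0r.
Qed.

Definition infinite x xi : Prop := occupied_ge (+oo : \bar R)%E xi x.

Lemma measurable_infinite x : measurable [set xi : configuration d | infinite x xi].
Proof.
have -> : [set xi : configuration d | infinite x xi] =
    [set xi | forall k, far k xi x].
  by apply/seteqP; split=> xi /(infinite_far R xi x).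
by apply: measurable_forall => k; exact: measurable_far.
Qed.

Lemma etaE u : eta P u = prob (P u) [set xi | infinite 0 xi].
Proof. by []. Qed.

Lemma prob_infinite u x : condP1 a b P -> a < u < b ->
  prob (P u) [set xi | infinite x xi] = eta P u.
Proof.
move=> hP1 hu; rewrite etaE; apply: (prob_shift (x := x) hP1 hu (measurable_infinite 0)) => xi.
rewrite /= /infinite !infinite_far.
by split=> h k; have := h k; rewrite far_shift add0r.
Qed.

Lemma eta_le_etak u k : eta P u <= etak k u.
Proof.
rewrite etaE; apply: prob_le;
  [exact: measurable_infinite|exact: measurable_far|].
by move=> xi /infinite_far h; exact: h.
Qed.

Lemma etak_cvg u (e : R) : 0 < e ->
  exists k0 : nat, forall k, (k0 <= k)%N -> etak k u <= eta P u + e.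
Proof.
move=> e0; pose F k := [set xi : configuration d | far k xi (0 : lattice d)].
have capF : \bigcap_k F k = [set xi | infinite 0 xi].
  apply/seteqP; split=> xi h; first by apply/infinite_far => k; exact: h.
  by move=> k _; move/infinite_far : h => h; exact: h.
have : (P u \o F) x @[x --> \oo] --> P u (\bigcap_k F k).
  apply: (@nonincreasing_cvg_mu _ _ _ (P u) F).
  - by rewrite (le_lt_trans (probability_le1 _ _)) ?ltry //; exact: measurable_far.
  - by move=> k; exact: measurable_far.
  - by rewrite capF; exact: measurable_infinite.
  - move=> n m nm; apply/subsetPset => xi; exact: far_le.
rewrite capF -(EFin_prob (P u) (measurable_infinite 0)) => /fine_cvgP[_].
move=> /cvgrPdist_le /(_ _ e0) [k0 _ h]; exists k0 => k /h /=.
rewrite ler_distlC => /andP[_]; rewrite etaE /etak => le.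
by rewrite (le_trans le).
Qed.

Lemma eta_near u (e : R) : condS2 a b P -> a < u < b -> 0 < e ->
  exists2 s : R, 0 < s & forall v, `|v - u| < s -> `|eta P v - eta P u| <= e.
Proof.
move=> [_ hc] hu e0.
have : {for u, continuous (eta P)} by apply: hc; rewrite ?in_itv.
move=> /cvgrPdist_le /(_ _ e0) [s /= s0 h]; exists s => // v vs.
by rewrite distrC; apply: h; rewrite /= distrC.
Qed.

Definition far_in (k n : nat) (y : lattice d) (i : {ffun 'I_d -> 'I_n}) :
  set (configuration d) := [set xi | far k xi (cube_pt y i)].

(* P3 compares [u] with a slightly larger [v]; the continuity of [eta] makes the
   loss small. This decorrelation is used in place of the ergodic theorem. *)
Lemma far_decoupling u (e : R) : condP1 a b P -> condP2 a b P -> condP3 a b P ->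
  condS2 a b P -> a < u < b -> 0 < e <= 1 ->
  exists k0 : nat, forall k, (k0 <= k)%N -> exists M : nat, forall x y,
    (M <= normoo (x - y)%R)%N ->
    prob (P u) ([set xi | far k xi x] `&` [set xi | far k xi y])
      <= eta P u ^+ 2 + 9 * e.
Proof.
move=> hP1 hP2 [RP [LP [epsP [chiP [fP [eps0 chi0 hf h3]]]]]] hS2 hu /andP[e0 e1].
have /andP[au ub] := hu; have u0 : 0 < u by exact: le_lt_trans au.
have [s s0 hs] := eta_near hS2 hu e0.
(* Close enough to [u] for the continuity of [eta], and still below [b]. *)
pose v := u + Num.min (s / 2) ((b - u) / 2).
have m0 : 0 < Num.min (s / 2) ((b - u) / 2).
  by rewrite lt_min !divr_gt0 //= subr_gt0.
have uv : u < v by rewrite ltrDl.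
have vb : v < b.
  have : Num.min (s / 2) ((b - u) / 2) <= (b - u) / 2 by rewrite ge_min lexx orbT.
  by rewrite /v; move: ub; lra.
have hv : a < v < b by rewrite (lt_trans au uv).
have etav : eta P v <= eta P u + e.
  have : `|v - u| < s.
    rewrite /v addrC addKr gtr0_norm //.
    have : Num.min (s / 2) ((b - u) / 2) <= s / 2 by rewrite ge_min lexx.
    by move: s0; lra.
  by move=> /hs; rewrite ler_distl => /andP[].
have [k0 hk0] := etak_cvg v e0; exists k0 => k /hk0 ekv.
have vu0 : 0 < (v - u) / u by rewrite divr_gt0 // subr_gt0.
have [r0 hr0] := powRN_small chi0 vu0.
pose r := (maxn r0 (Num.trunc RP).+1).
have X0 : 0 <= - ln e by rewrite oppr_ge0 ln_le0.
have [l0 hl0] := ln_pow_large eps0 X0.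
(* [L >= k] makes the events local to the windows of P3; the other two bounds make its error at most
   [e]. *)
pose L := (maxn (maxn l0 k) (Num.trunc LP).+1).
have l0L : (l0 <= L)%N by rewrite /L !leq_max leqnn.
have kL : (k <= L)%N by rewrite /L !leq_max leqnn orbT.
have L1 : (1 <= L)%N by rewrite /L leq_max orbT.
have fL : expR (- fP L) <= e.
  rewrite -[leRHS]lnK ?posrE // ler_expR lerNl.
  have LPL : LP <= L%:R.
    by apply/ltW/(lt_le_trans (truncnS_gt _)); rewrite ler_nat leq_maxr.
  apply: le_trans (hf _ LPL).
  apply: le_trans (hl0 L l0L) (le_trans _ (expR_ge1Dx _)).
  by rewrite lerDr.
exists (r * L)%N => x y hxy.
have loc z : sigma_coord (box z (10 * L%:R : R)) [set xi | far k xi z].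
  apply: sigma_coord_nball (@local_far _ k z).
  rewrite -natrM boxE /nball => w /= /leq_trans; apply.
  by rewrite (leq_trans kL) // leq_pmull.
(* P3 takes a decreasing and an increasing pair together; the empty event fills the decreasing
   slots. *)
have sc0 z : sigma_coord (box z (10 * L%:R : R)) set0.
  exact: (@measurable0 _ (g_sigma_algebraType (cylinders _))).
have inc z : increasing [set xi | far k xi z] by exact: far_increasing.
have dec0 : @decreasing d set0 by [].
have rP : RP <= r%:R.
  by apply/ltW/(lt_le_trans (truncnS_gt _)); rewrite ler_nat leq_maxr.
have ruv : (1 + r%:R `^ (- chiP)) * u <= v.
  rewrite mulrDl mul1r addrC -lerBrDr -ler_pdivlMr //.
  by apply: hr0; rewrite /r leq_maxl.
have [_] := h3 L x y set0 set0 _ _ r u v L1 (sc0 x) dec0 (sc0 y) dec0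
  (loc x) (inc x) (loc y) (inc y) rP au uv vb ruv hxy.
rewrite -!EFin_prob; try exact: measurable_far; last first.
  by apply: measurableI; exact: measurable_far.
rewrite -EFinM -EFinD lee_fin !prob_far // => hle.
apply: (le_trans hle).
have g0 : 0 <= eta P u by rewrite etaE prob_ge0.
have g1 : eta P u <= 1 by rewrite etaE prob_le1 //; exact: measurable_infinite.
have ek : etak k v <= eta P u + 2 * e by move: ekv etav; lra.
have ek0 : 0 <= etak k v by exact: prob_ge0.
(* As [eta] and [e] are at most 1, the square exceeds [eta ^ 2] by at most [8 * e]; the error of P3
   adds the ninth [e]. *)
have : etak k v * etak k v <= (eta P u + 2 * e) * (eta P u + 2 * e).
  by apply: ler_pM.
move: fL; nra.
Qed.

(** A site has fewer than a ball's worth of partners closer than [M]; these pairs are bounded by 1,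
    all others by [c]. *)
Lemma sum_pairs_bound u k n y M (c : R) : 0 <= c ->
  (forall x z, (M <= normoo (x - z)%R)%N ->
    prob (P u) ([set xi | far k xi x] `&` [set xi | far k xi z]) <= c) ->
  \sum_i \sum_j prob (P u) (@far_in k n y i `&` @far_in k n y j) <=
    (n ^ d)%:R * ((n ^ d)%:R * c + ((M.*2.+1) ^ d)%:R).
Proof.
move=> c0 hM.
have cI : #|{: {ffun 'I_d -> 'I_n}}| = (n ^ d)%N by rewrite card_ffun !card_ord.
apply: (@le_trans _ _ (\sum_(i : {ffun 'I_d -> 'I_n}) ((n ^ d)%:R * c + ((M.*2.+1) ^ d)%:R))); last first.
  by rewrite sumr_const cI -[leLHS]mulr_natl.
apply: ler_sum => i _.
rewrite (bigID (fun j => (M <= normoo (cube_pt y i - cube_pt y j)%R)%N)) /=.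
apply: lerD.
  apply: (@le_trans _ _ (\sum_(j | (M <= normoo (cube_pt y i - cube_pt y j)%R)%N) c)).
    by apply: ler_sum => j hj; exact: hM.
  rewrite sumr_const -[leLHS]mulr_natl ler_wpM2r // ler_nat -cI; exact: max_card.
apply: (@le_trans _ _ (\sum_(j | ~~ (M <= normoo (cube_pt y i - cube_pt y j)%R)%N) 1)).
  by apply: ler_sum => j hj; apply: prob_le1; apply: measurableI; exact: measurable_far.
rewrite sumr_const ler_nat cardE -(size_map (@cube_pt d n y)).
apply: (@size_uniq_nball _ (cube_pt y i)).
  by rewrite map_inj_uniq ?enum_uniq //; exact: cube_pt_inj.
move=> z /mapP[j]; rewrite mem_enum => hj ->; rewrite /nball /=.
by move: hj; rewrite ?unfold_in /= -ltnNge => /ltnW.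
Qed.

Lemma density_lln u (e : R) : condP1 a b P -> condP2 a b P -> condP3 a b P ->
  condS2 a b P -> a < u < b -> 0 < e <= 1 ->
  exists k0 : nat, forall k, (k0 <= k)%N -> exists n0 : nat, forall n y,
    (n0 <= n)%N ->
    prob (P u) [set xi | e * (n ^ d)%:R <=
      `| #|pattern (@far_in k n y) xi|%:R - eta P u * (n ^ d)%:R |] <= e.
Proof.
move=> hP1 hP2 hP3 hS2 hu /andP[e0 e1].
(* The second moment about [g N] is at most [9 e' N^2 + N K], where [K] is the volume of the ball of
   radius [M]. This [e'] and the choice of [n] make each term at most [e^3 N^2 / 2], and division by
   [(e N)^2] leaves [e]. *)
pose e' := e ^+ 3 / 18.
have e3 : 0 < e ^+ 3 <= 1 by rewrite exprn_gt0 //= exprn_ile1 // ltW.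
have e'0 : 0 < e' <= 1 by rewrite /e'; move: e3; lra.
have [k0 hk0] := far_decoupling hP1 hP2 hP3 hS2 hu e'0; exists k0 => k /hk0 [M hM].
exists (Num.trunc (2 * ((M.*2.+1) ^ d)%:R / e ^+ 3)).+1 => n y hn.
set N := (n ^ d)%:R : R; set g := eta P u in hM *.
have Mn : 2 * ((M.*2.+1) ^ d)%:R <= N * e ^+ 3.
  rewrite -ler_pdivrMr; last by case/andP: e3.
  apply/ltW/(lt_le_trans (truncnS_gt _)); rewrite ler_nat.
  by rewrite (leq_trans hn) // -{1}[n]expn1 leq_pexp2l // (leq_trans _ hn).
have N0 : 0 < N.
  by rewrite ltr0n expn_gt0; apply/orP; left; apply: leq_trans hn.
have g0 : 0 <= g by rewrite /g etaE prob_ge0.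
have mF i : measurable (@far_in k n y i) by exact: measurable_far.
have := chebyshev_card (P u) mF (g * N) (mulr_gt0 e0 N0).
have c0 : 0 <= g ^+ 2 + 9 * e' by rewrite addr_ge0 ?sqr_ge0 // mulr_ge0 //; lra.
have := @sum_pairs_bound u k n y M _ c0 hM.
have : N * g <= \sum_i prob (P u) (@far_in k n y i).
  under eq_bigr do rewrite prob_far //.
  rewrite sumr_const card_ffun !card_ord -[leRHS]mulr_natl; apply: ler_wpM2l; first exact: ltW.
  exact: eta_le_etak.
pose S1 := \sum_i prob (P u) (@far_in k n y i).
pose S2 := \sum_i \sum_j prob (P u) (@far_in k n y i `&` @far_in k n y j).
rewrite -/N -/S1 -/S2; move: S1 S2 => S1 S2.
set p := prob _ _; set K := ((M.*2.+1) ^ d)%:R => h1 h2 h3.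
have : p * (e * N) ^+ 2 <= e * (e * N) ^+ 2.
  apply: (le_trans h3).
  have : (g * N) *+ 2 * S1 >= (g * N) *+ 2 * (N * g).
    by apply: (ler_wpM2l _ h1); apply: mulrn_wge0; apply: mulr_ge0.
  have : N * K * 2 <= N * (N * e ^+ 3).
    by rewrite -mulrA; apply: ler_wpM2l; rewrite ?(ltW N0) // mulrC.
  move: h2; rewrite -mulr_natl /e'; nra.
by rewrite ler_pM2r // exprn_gt0 // mulr_gt0.
Qed.

End Density.

(** * Seed events *)

Section Seeds.
Variables (R : realType) (d : nat).
Implicit Types (x y z c : lattice d) (xi : cfg d).

(** The values 0, 1, 2 encode the offsets -1, 0, 1, so [z] itself and its diagonal neighbours are
    included; a finite index type permits a union bound. *)
Definition nbr z (w : {ffun 'I_d -> 'I_3}) : lattice d :=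
  z + \row_j ((w j)%:Z - 1).

Lemma coord_nbr z w j : nbr z w ord0 j = z ord0 j + ((w j)%:Z - 1) :> int.
Proof. by rewrite /nbr coordD; congr (_ + _); rewrite mxE. Qed.

Lemma nbrP z y : (normoo (z - y)%R <= 1)%N -> exists w, y = nbr z w.
Proof.
move=> /normooP h.
exists [ffun j => inord `|(y ord0 j - z ord0 j + 1)%R|].
apply: coord_inj => j; rewrite coord_nbr ffunE; have := h j.
rewrite coordD coordN => hj; rewrite inordK; lia.
Qed.

Lemma cube_pt_nball n z w (i : {ffun 'I_d -> 'I_n}) :
  nball (n%:Z *: z) (2 * n) (cube_pt (nbr z w) i).
Proof.
apply/normooP => j; rewrite coordD coordN coord_cube_pt coord_nbr coordZ.
have := ltn_ord (i j); have := ltn_ord (w j).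
move: (nat_of_ord (i j)) (nat_of_ord (w j)) (z _ _) => p q s; nia.
Qed.

Lemma cube_pt_nball0 n z (i : {ffun 'I_d -> 'I_n}) :
  nball (n%:Z *: z) n (cube_pt z i).
Proof.
apply/normooP => j; rewrite coordD coordN coord_cube_pt coordZ.
by have := ltn_ord (i j); move: (nat_of_ord (i j)) (_ * _) => p q; lia.
Qed.

(** The ball of radius [2 * n] contains the cube of [z] and all adjacent ones; S1 at that scale
    connects inside the doubled ball, hence [4 * n]. *)
Definition reach (n : nat) z c y (i : {ffun 'I_d -> 'I_n}) : set (configuration d) :=
  [set xi | connected_in (occupied xi `&` nball (n%:Z *: z) (4 * n)) c (cube_pt y i)].

(* A site of a cluster occupying at least the proportion 3/4 of the density [g]
   in the cube of [z] and in all adjacent cubes. *)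
Definition hub (n : nat) (g : R) z xi c : Prop :=
  forall w, 3 / 4 * g * (n ^ d)%:R <= #|pattern (@reach n z c (nbr z w)) xi|%:R.

Definition connected_seed n g z : set (configuration d) :=
  [set xi | exists c, hub n g z xi c].

(* Every cluster counted by a hub consists of [far] points, so a cube satisfying
   this bound has no room for two disjoint such clusters. *)
Definition sparse_seed n k (g : R) z : set (configuration d) :=
  [set xi | #|pattern (@far_in d k n z) xi|%:R <= 5 / 4 * g * (n ^ d)%:R].

Lemma hub_mem n g z xi c : 0 < g -> (0 < n)%N -> hub n g z xi c ->
  (occupied xi `&` nball (n%:Z *: z) (4 * n)) c.
Proof.
move=> g0 n0 /(_ [ffun=> 0]) h.
have : 0 < #|pattern (@reach n z c (nbr z [ffun=> 0])) xi|%:R :> R.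
  apply: lt_le_trans h; apply: mulr_gt0; last by rewrite ltr0n expn_gt0 n0.
  by apply: mulr_gt0.
by rewrite ltr0n card_gt0 => /set0Pn[i]; rewrite inE => /asboolP /connected_meml.
Qed.

(** If one reached site were not far, all reached sites would lie within [k] of it, which leaves
    room for fewer than the assumed number. *)
Lemma reach_far n k g z c y xi :
  ((k.*2.+1) ^ d)%:R < (3 : R) / 4 * g * (n ^ d)%:R ->
  3 / 4 * g * (n ^ d)%:R <= #|pattern (@reach n z c y) xi|%:R ->
  pattern (@reach n z c y) xi \subset pattern (@far_in d k n y) xi.
Proof.
move=> kn h; apply/fintype.subsetP => i iX.
have ci : @reach n z c y i xi by move: iX; rewrite inE => /asboolP.
rewrite inE; apply/asboolP; rewrite /far_in /=; apply: contrapT => nfar.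
have := lt_le_trans kn h; rewrite ltr_nat ltnNge => /negP; apply.
rewrite cardE -(size_map (@cube_pt d n y)).
apply: (@size_uniq_nball _ (cube_pt y i)).
  by rewrite map_inj_uniq ?enum_uniq //; exact: cube_pt_inj.
move=> v /mapP[j]; rewrite mem_enum inE => /asboolP cj ->.
rewrite /nball /= leqNgt; apply/negP => kj; apply: nfar.
exists (cube_pt y j); split; first exact: ltnW.
apply: connected_mono (connected_trans (connected_sym ci) cj).
by move=> ? [].
Qed.

Lemma dense_meet (I : finType) (X Y F : {set I}) (t : R) : 0 < t ->
  X \subset F -> Y \subset F -> #|F|%:R <= 5 / 4 * t ->
  3 / 4 * t <= #|X|%:R -> 3 / 4 * t <= #|Y|%:R -> exists i, i \in X /\ i \in Y.
Proof.
move=> t0 XF YF Ft Xt Yt.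
have UF : #|X :|: Y|%:R <= #|F|%:R :> R.
  by rewrite ler_nat subset_leq_card // finset.subUset XF YF.
have := congr1 (fun m => m%:R : R) (cardsUI X Y); rewrite !natrD => UI.
have : 0 < #|X :&: Y|%:R :> R by lra.
by rewrite ltr0n card_gt0 => /set0Pn[i]; rewrite inE => /andP[? ?]; exists i.
Qed.

(** Both clusters are compared in the cube of [z']: the cluster of [c] is dense there because a hub
    is dense in adjacent cubes too. So sparsity is needed at one end only. Each half of the
    connection is bounded by the volume of its box. *)
Lemma hub_joined n k g z z' xi c c' :
  0 < g -> (0 < n)%N -> ((k.*2.+1) ^ d)%:R < (3 : R) / 4 * g * (n ^ d)%:R ->
  hub n g z xi c -> hub n g z' xi c' -> sparse_seed n k g z' xi ->
  adjacent z z' -> joined (occupied xi) (2 * ((4 * n).*2.+1) ^ d) c c'.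
Proof.
move=> g0 n0 kn hc hc' sp zz'.
have [w wE] := nbrP (adjacent_normoo zz').
have [w' wE'] : exists w, z' = nbr z' w by apply: nbrP; rewrite subrr normoo0.
have := hc w; rewrite -wE => h; have := hc' w'; rewrite -wE' => h'.
have gN : 0 < g * (n ^ d)%:R by rewrite mulr_gt0 // ltr0n expn_gt0 n0.
move: (h) (h') (sp); rewrite /sparse_seed /= -!(mulrA _ g) => h1 h2 h3.
have [i []] := dense_meet gN (reach_far kn h) (reach_far kn h') h3 h1 h2.
rewrite !finset.in_set => /asboolP ci /asboolP ci'.
have jo y s v : connected_in (occupied xi `&` nball y (4 * n)) s v ->
    joined (occupied xi) ((4 * n).*2.+1 ^ d) s v.
  move=> sv; have := joined_nball sv (c := y) (m := 4 * n).
  by move=> /(_ (fun _ => @proj2 _ _)); apply: joined_mono => // ? [].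
rewrite [(2 * _ ^ d)%N]mul2n -[(_ ^ d).*2]addnn; apply: (joined_trans (jo _ _ _ ci)).
exact: joined_sym (jo _ _ _ ci').
Qed.

Lemma pattern_mono (I : finType) (F : I -> set (configuration d)) xi xi' :
  (forall i, F i xi -> F i xi') -> pattern F xi \subset pattern F xi'.
Proof.
by move=> h; apply/fintype.subsetP => i; rewrite !finset.in_set => /asboolP Fi; apply/asboolP; exact: h.
Qed.

Lemma connected_local xi xi' (A : set (lattice d)) x y :
  (forall z, A z -> xi z = xi' z) ->
  connected_in (occupied xi `&` A) x y -> connected_in (occupied xi' `&` A) x y.
Proof.
move=> h; apply: connected_mono => z [oz Az]; split=> //.
by rewrite /occupied /= -h.
Qed.

Lemma increasing_connected_seed n g z : increasing (connected_seed n g z).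
Proof.
move=> xi xi' [c hc] h; exists c => w; apply: le_trans (hc w) _.
rewrite ler_nat subset_leq_card // pattern_mono // => i.
exact: connected_increasing.
Qed.

Lemma local_connected_seed n g z :
  local (nball (n%:Z *: z) (4 * n)) (connected_seed n g z).
Proof.
move=> xi xi' h [c hc]; exists c => w; apply: le_trans (hc w) _.
rewrite ler_nat subset_leq_card // pattern_mono // => i.
exact: connected_local.
Qed.

Lemma decreasing_sparse_seed n k g z : decreasing (sparse_seed n k g z).
Proof.
move=> xi xi' hs h; apply: le_trans hs.
rewrite ler_nat subset_leq_card // pattern_mono // => i hi.
exact: far_increasing hi h.
Qed.

Lemma local_sparse_seed n k g z : (k <= n)%N ->
  local (nball (n%:Z *: z) (4 * n)) (sparse_seed n k g z).
Proof.
move=> kn xi xi' h hs; apply: le_trans hs.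
rewrite ler_nat subset_leq_card // pattern_mono // => i.
apply: (@local_far _ k (cube_pt z i)) => y hy; rewrite h //.
rewrite /nball /=; have := cube_pt_nball0 z i; rewrite /nball /=.
have := normoo_dist3 (cube_pt z i) (n%:Z *: z) y; move: hy; rewrite /nball /=.
lia.
Qed.

End Seeds.

(** * Seeds are likely at large scales *)

Section SeedProb.
Variables (R : realType) (d : nat) (a b : R).
Variables (P : R -> probability (configuration d) R) (DeltaS : R -> R).
Implicit Types (x y z : lattice d) (xi : cfg d).
Hypothesis d_gt0 : (0 < d)%N.
Hypothesis a_ge0 : 0 <= a.
Hypotheses (hP1 : condP1 a b P) (hP2 : condP2 a b P) (hP3 : condP3 a b P).
Hypotheses (hS1 : condS1 a b P DeltaS) (hS2 : condS2 a b P).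

Definition unique_at (r : nat) x : set (configuration d) :=
  [set xi | forall y z,
    occupied_ge (r%:R / 10 : R)%:E xi y -> nball x r y ->
    occupied_ge (r%:R / 10 : R)%:E xi z -> nball x r z ->
    connected_in (occupied xi `&` nball x (2 * r)) y z].

Lemma measurable_unique_at r x : measurable (unique_at r x).
Proof.
apply: measurable_forall => y; apply: measurable_forall => z.
apply: measurable_imply; first exact: measurable_occupied_ge.
apply: measurable_imply; first exact: measurable_constant.
apply: measurable_imply; first exact: measurable_occupied_ge.
apply: measurable_imply; first exact: measurable_constant.
exact: measurable_connected.
Qed.

Lemma unique_at_shift r x xi : unique_at r x xi <-> unique_at r 0 (lattice_shift x xi).
Proof.
have nb m y : nball 0 m y <-> nball x m (y + x).
  by rewrite /nball /= opprD addrCA subrr addr0 sub0r.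
split=> h y z.
  move=> /(iffLR (occupied_ge_shift _ _ _ _)) oy /nb ny.
  move=> /(iffLR (occupied_ge_shift _ _ _ _)) oz /nb nz.
  by apply/connected_shiftI; rewrite add0r; exact: h.
have H v w : occupied_ge (r%:R / 10 : R)%:E xi (v + x) -> nball x r (v + x) ->
    occupied_ge (r%:R / 10 : R)%:E xi (w + x) -> nball x r (w + x) ->
    connected_in (occupied xi `&` nball x (2 * r)) (v + x) (w + x).
  move=> /(iffRL (occupied_ge_shift _ _ _ _)) ov /nb nv.
  move=> /(iffRL (occupied_ge_shift _ _ _ _)) ow /nb nw.
  by have /connected_shiftI := h _ _ ov nv ow nw; rewrite add0r.
by have := H (y - x) (z - x); rewrite !subrK.
Qed.

Lemma unique_at_prob u : a < u < b -> 0 < DeltaS u /\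
  exists r0 : nat, forall r x, (r0 <= r)%N ->
    prob (P u) (~` unique_at r x) <= expR (- ln r%:R `^ (1 + DeltaS u)).
Proof.
move=> hu; have [fS [hf h]] := hS1; have [D0 [RS hRS]] := hf u hu.
split=> //; exists (maxn 1 (Num.trunc RS).+1) => r x.
rewrite geq_max => /andP[r1 rR].
rewrite probC; last exact: measurable_unique_at.
rewrite (prob_shift hP1 hu (measurable_unique_at r 0) (unique_at_shift r x)).
have [_] := h u r hu r1.
rewrite (_ : [set xi | _] = unique_at r 0); last first.
  rewrite /unique_at -natrM !boxE; apply/seteqP; split=> xi hxi y z.
    by move=> oy ny oz nz; apply: hxi.
  by move=> [oy ny] [oz nz]; apply: hxi.
rewrite -EFin_prob; last exact: measurable_unique_at.
rewrite lee_fin lerBlDr addrC -lerBlDr => /le_trans; apply.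
rewrite ler_expR lerN2; apply: hRS.
by apply/ltW/(lt_le_trans (truncnS_gt _)); rewrite ler_nat.
Qed.

Lemma measurable_connected_seed n (g : R) z : measurable (connected_seed n g z).
Proof. exact: (measurable_local (@local_connected_seed R d n g z)). Qed.

Lemma measurable_sparse_seed n k (g : R) z : measurable (sparse_seed n k g z).
Proof.
apply: (@measurable_pattern_pred _ _ _ (@far_in d k n z) _
  (fun S => #|S|%:R <= 5 / 4 * g * (n ^ d)%:R)).
by move=> i; exact: measurable_far.
Qed.

Lemma sparse_seed_prob u (g e : R) : a < u < b -> 0 < g <= 1 -> 0 < e <= 1 ->
  eta P u <= 9 / 8 * g ->
  exists k n0 : nat, forall n z, (n0 <= n)%N ->
    prob (P u) (~` sparse_seed n k g z) <= e.
Proof.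
move=> hu /andP[g0 g1] /andP[e0 e1] ug.
(* A fluctuation of [g / 8] is the gap between the density bound [9 / 8 * g] and the threshold
   [5 / 4 * g]. *)
pose e' := Num.min e (g / 8).
have e'0 : 0 < e' <= 1.
  by rewrite lt_min e0 divr_gt0 //= ge_min e1.
have [k hk] := density_lln d_gt0 a_ge0 hP1 hP2 hP3 hS2 hu e'0.
have [n0 hn0] := hk k (leqnn k); exists k, n0 => n z /(hn0 n z) h.
have e'e : e' <= e by rewrite ge_min lexx.
have e'g : e' <= g / 8 by rewrite ge_min lexx orbT.
apply: le_trans e'e; apply: le_trans h; apply: prob_le.
- apply: measurableC; exact: measurable_sparse_seed.
- apply: (@measurable_pattern_pred _ _ _ (@far_in d k n z) _
    (fun S => e' * (n ^ d)%:R <= `| #|S|%:R - eta P u * (n ^ d)%:R |)).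
  by move=> i; exact: measurable_far.
move=> xi /negP; rewrite -ltNge /= => h.
apply: le_trans (ler_norm _); rewrite lerBrDr -mulrDl; apply: le_trans (ltW h).
by rewrite ler_wpM2r //; lra.
Qed.

(** The law of large numbers was proved for the local events [far]. Far sites in finite clusters
    have small density for large [k], so Markov's inequality allows them to be discarded. *)
Lemma infinite_count_prob u (g e : R) : a < u < b -> 0 < g <= 1 -> 0 < e <= 1 ->
  7 / 8 * g <= eta P u ->
  exists n0 : nat, forall n y, (n0 <= n)%N ->
    prob (P u) [set xi |
      #|pattern (fun i : {ffun 'I_d -> 'I_n} =>
          [set xi : configuration d | infinite R (cube_pt y i) xi]) xi|%:R
        < 3 / 4 * g * (n ^ d)%:R] <= e.
Proof.
move=> hu /andP[g0 g1] /andP[e0 e1] ug.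
(* The fluctuation and the discarded sites cost [g / 16] each, which brings [7 / 8 * g] down to
   [3 / 4 * g]. *)
pose e' := Num.min (e / 2) (g / 16).
have e'e : e' <= e / 2 by rewrite ge_min lexx.
have e'g : e' <= g / 16 by rewrite ge_min lexx orbT.
have e'0 : 0 < e' <= 1.
  by rewrite lt_min !divr_gt0 //=; move: e'e; lra.
have [k1 hk1] := density_lln d_gt0 a_ge0 hP1 hP2 hP3 hS2 hu e'0.
(* Density [e' * e'] of discarded sites, so that Markov's inequality at the threshold [e' * N]
   yields probability [e']. *)
have e'2 : 0 < e' * e' by move: e'0 => /andP[? _]; rewrite mulr_gt0.
have [k2 hk2] := etak_cvg P u e'2.
pose k := maxn k1 k2.
have [n0 hn0] := hk1 k (leq_maxl _ _); have hk := hk2 k (leq_maxr _ _).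
exists (maxn 1 n0) => n y; rewrite geq_max => /andP[n1 /(hn0 n y) h].
set N := (n ^ d)%:R : R in h *.
have N0 : 0 < N by rewrite ltr0n expn_gt0 n1.
pose F (i : {ffun 'I_d -> 'I_n}) : set (configuration d) :=
  [set xi : configuration d | infinite R (cube_pt y i) xi].
pose G (i : {ffun 'I_d -> 'I_n}) : set (configuration d) :=
  @far_in d k n y i `&` ~` F i.
have mF i : measurable (F i) by exact: measurable_infinite.
have mf i : measurable (@far_in d k n y i) by exact: measurable_far.
have mG i : measurable (G i) by apply: measurableI => //; exact: measurableC.
have pG i : prob (P u) (G i) <= e' * e'.
  have : prob (P u) (@far_in d k n y i) = prob (P u) (F i) + prob (P u) (G i).
    rewrite -probU //; last by rewrite /G setIC -setIA setICl setI0.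
    congr (prob _ _); rewrite /G setUIr setUv setIT setUC.
    symmetry; apply/setUidPl => xi /infinite_far h'; exact: h'.
  have -> : prob (P u) (@far_in d k n y i) = etak P k u.
    exact: prob_far hP1 hu.
  have -> : prob (P u) (F i) = eta P u by exact: prob_infinite hP1 hu.
  by move: hk; lra.
have mk : prob (P u) [set xi | e' * N <= #|pattern G xi|%:R] <= e'.
  have eN : 0 < e' * N by rewrite mulr_gt0 //; case/andP: e'0.
  rewrite -(ler_pM2r eN); apply: le_trans (markov_card (P u) mG eN) _.
  apply: (@le_trans _ _ (\sum_(i : {ffun 'I_d -> 'I_n}) (e' * e'))).
    exact: ler_sum.
  by rewrite sumr_const card_ffun !card_ord -[leLHS]mulr_natl mulrC mulrA.
apply: (@le_trans _ _ (e' + e')); last by move: e'e; lra.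
apply: le_trans (lerD h mk); apply: le_trans (probU2 _ _ _); last 2 first.
- by apply: (@measurable_pattern_pred _ _ _ _ mf
    (fun S => e' * N <= `| #|S|%:R - eta P u * N |)).
- by apply: (@measurable_pattern_pred _ _ _ _ mG (fun S => e' * N <= #|S|%:R)).
apply: prob_le.
- by apply: (@measurable_pattern_pred _ _ _ _ mF (fun S => #|S|%:R < 3 / 4 * g * N)).
- apply: measurableU.
    by apply: (@measurable_pattern_pred _ _ _ _ mf
      (fun S => e' * N <= `| #|S|%:R - eta P u * N |)).
  by apply: (@measurable_pattern_pred _ _ _ _ mG (fun S => e' * N <= #|S|%:R)).
move=> xi /= hF; apply/orP; apply: contraLR hF; rewrite negb_or -!ltNge -leNgt.
move=> /andP[h1 h2].
have : #|pattern (@far_in d k n y) xi|%:R <=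
    #|pattern F xi|%:R + #|pattern G xi|%:R :> R.
  rewrite -natrD ler_nat -cardsUI (leq_trans _ (leq_addr _ _)) //.
  apply: subset_leq_card; apply/fintype.subsetP => i; rewrite finset.in_setU !finset.in_set => /asboolP hi.
  case: (pselect (F i xi)) => Fi; apply/orP; [left|right]; exact/asboolP.
move: h1; rewrite ltr_norml => /andP[h1 _] h3.
have : 7 / 8 * g * N <= eta P u * N by rewrite ler_wpM2r // ltW.
have : e' * N <= g / 16 * N by rewrite ler_wpM2r // ltW.
by move: h1 h2 h3; lra.
Qed.

(** All of the adjacent cubes contain enough infinite sites, and S1 at scale [2 * n] connects all
    these sites inside the ball of radius [4 * n]. Any one of them is then a hub. *)
Lemma connected_seed_prob u (g e : R) : a < u < b -> 0 < g <= 1 -> 0 < e <= 1 ->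
  7 / 8 * g <= eta P u ->
  exists n0 : nat, forall n z, (n0 <= n)%N ->
    prob (P u) (~` connected_seed n g z) <= e.
Proof.
move=> hu hg /andP[e0 e1] ug; have /andP[g0 g1] := hg.
have T0 : (0 : R) < (3 ^ d)%:R by rewrite ltr0n expn_gt0.
pose e' := e / 2 / (3 ^ d)%:R.
have e'0 : 0 < e' <= 1.
  rewrite !divr_gt0 //= ler_pdivrMr // mul1r.
  by apply: (@le_trans _ _ 1); [lra | rewrite ler1n expn_gt0].
have [n1 hn1] := infinite_count_prob hu hg e'0 ug.
have [D0 [n2 hn2]] := unique_at_prob hu.
have X0 : 0 <= - ln (e / 2) by rewrite oppr_ge0 ln_le0 //; lra.
have [n3 hn3] := @ln_pow_large R (1 + DeltaS u) (- ln (e / 2)) ltac:(lra) X0.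
exists (maxn 1 (maxn n1 (maxn n2 n3))) => n z.
rewrite !geq_max => /and4P[n_1 n_n1 n_n2 n_n3].
pose F (w : {ffun 'I_d -> 'I_3}) : set (configuration d) := [set xi |
      #|pattern (fun i : {ffun 'I_d -> 'I_n} =>
          [set xi : configuration d | infinite R (cube_pt (nbr z w) i) xi]) xi|%:R
        < 3 / 4 * g * (n ^ d)%:R].
have mF w : measurable (F w).
  apply: (@measurable_pattern_pred _ _ _ (fun i : {ffun 'I_d -> 'I_n} =>
          [set xi : configuration d | infinite R (cube_pt (nbr z w) i) xi]) _
      (fun S => #|S|%:R < 3 / 4 * g * (n ^ d)%:R)).
  by move=> i; exact: measurable_infinite.
have U1 : prob (P u) (~` unique_at (2 * n) (n%:Z *: z)) <= e / 2.
  apply: le_trans (hn2 _ _ _) _; first by rewrite (leq_trans n_n2) // leq_pmull.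
  rewrite -[leRHS]lnK ?posrE ?divr_gt0 // ler_expR lerNl; apply: hn3.
  by rewrite (leq_trans n_n3) // leq_pmull.
have U2 : prob (P u) [set xi | exists w, F w xi] <= e / 2.
  apply: le_trans (prob_union_fin mF (e := e') _) _.
    by move=> w; exact: hn1.
  by rewrite card_ffun !card_ord /e' mulrC divfK // gt_eqF.
have mU : measurable [set xi | exists w, F w xi] by exact: measurable_exists.
have -> : e = e / 2 + e / 2 by lra.
apply: le_trans (lerD U1 U2); apply: le_trans (probU2 _ _ mU); last first.
  by apply: measurableC; exact: measurable_unique_at.
apply: prob_le.
- by apply: measurableC; exact: measurable_connected_seed.
- by apply: measurableU => //; apply: measurableC; exact: measurable_unique_at.
move=> xi nseed; apply: contrapT => /not_orP[/contrapT uq /forallNP nF].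
apply: nseed.
have cnt w : 3 / 4 * g * (n ^ d)%:R <= #|pattern (fun i : {ffun 'I_d -> 'I_n} =>
          [set xi : configuration d | infinite R (cube_pt (nbr z w) i) xi]) xi|%:R.
  by rewrite leNgt; apply/negP; exact: nF.
have oge x : infinite R x xi -> occupied_ge ((2 * n)%:R / 10 : R)%:E xi x.
  move=> [ox h]; split=> //; apply: le_trans h; by rewrite leey.
have [i hi] : exists i : {ffun 'I_d -> 'I_n}, infinite R (cube_pt (nbr z [ffun=> 0]) i) xi.
  have : 0 < #|pattern (fun i : {ffun 'I_d -> 'I_n} =>
          [set xi : configuration d | infinite R (cube_pt (nbr z [ffun=> 0]) i) xi]) xi|%:R :> R.
    apply: lt_le_trans (cnt _); apply: mulr_gt0; first by apply: mulr_gt0.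
    by rewrite ltr0n expn_gt0 n_1.
  rewrite ltr0n card_gt0 => /set0Pn[i]; rewrite inE => /asboolP hi.
  by exists i.
exists (cube_pt (nbr z [ffun=> 0]) i) => w; apply: le_trans (cnt w) _.
rewrite ler_nat; apply: subset_leq_card; apply/fintype.subsetP => j.
rewrite !finset.in_set => /asboolP hj; apply/asboolP.
have n4 : (4 * n)%N = (2 * (2 * n))%N by rewrite mulnA.
rewrite /reach n4.
by apply: uq; [exact: oge|exact: cube_pt_nball|exact: oge|exact: cube_pt_nball].
Qed.

End SeedProb.

(** * Probability of the cascade *)

Section CascadeProb.
Variables (R : realType) (d : nat).
Implicit Types (x y z w : lattice d) (xi : cfg d).
Variables l r : nat -> nat.

Lemma nball_enum x m : exists s : seq (lattice d),
  (forall y, (y \in s) <-> nball x m y) /\ (size s <= m.*2.+1 ^ d)%N.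
Proof.
have [s hs] := nball_seq x m; exists (undup s); split.
  by move=> y; rewrite mem_undup.
apply: (@size_uniq_nball _ x); first exact: undup_uniq.
by move=> z; rewrite mem_undup => /hs.
Qed.

Lemma cascade_mono (B B' : set (lattice d)) n z :
  (forall w, B w -> B' w) -> cascade l r B n z -> cascade l r B' n z.
Proof.
move=> BB'; elim: n z => [|n IH] z /=; first exact: BB'.
by move=> [z1 [z2 [h1 h2 h12 /IH c1 /IH c2]]]; exists z1, z2.
Qed.

Variables (L0 : nat) (E : lattice d -> set (configuration d)).

Definition scale (n : nat) : nat := (L0 * \prod_(i < n) l i)%N.

Lemma scaleS n : scale n.+1 = (scale n * l n)%N.
Proof. by rewrite /scale big_ord_recr mulnA. Qed.

Definition bad (n : nat) z : set (configuration d) :=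
  [set xi | cascade l r (fun w => E w xi) n z].

Hypothesis l2 : forall n, (2 <= l n)%N.
Hypothesis loc : forall z, local (nball (L0%:Z *: z) (4 * L0)) (E z).

(** The factor 10 is that of the windows in P3. It survives the induction because
    [2 * l n + 10 <= 10 * l n] for [l n >= 2]. *)
Lemma local_bad n z : local (nball ((scale n)%:Z *: z) (10 * scale n)) (bad n z).
Proof.
elim: n z => [|n IH] z xi xi' h.
  apply: loc => y hy; apply: h; rewrite /scale big_ord0 muln1.
  by move: hy; rewrite /nball /=; lia.
move=> [z1 [z2 [h1 h2 h12 c1 c2]]]; exists z1, z2.
have sub w : nball ((l n)%:Z *: z) (2 * l n) w ->
    nball ((scale n)%:Z *: w) (10 * scale n) `<=` nball ((scale n.+1)%:Z *: z) (10 * scale n.+1).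
  move=> hw y; rewrite /nball /= => hy.
  have := normoo_dist3 ((scale n)%:Z *: w) ((scale n.+1)%:Z *: z) y.
  rewrite scaleS PoszM -scalerA -scalerBr normooZ.
  have : (scale n * normoo ((l n)%:Z *: z - w)%R <= scale n * (2 * l n))%N.
    by rewrite leq_mul2l hw orbT.
  by have := l2 n; move: (normoo _) (normoo _) (normoo _) hy; nia.
by split=> //; [apply: (IH z1 xi) => // y /(sub _ h1)/h |
                apply: (IH z2 xi) => // y /(sub _ h2)/h].
Qed.

Lemma measurable_bad n z : measurable (bad n z).
Proof. exact: (measurable_local (@local_bad n z)). Qed.

Variables (M : set (set (cfg d))) (mu : nat -> probability (configuration d) R).
Variables (p e : nat -> R).

(** [M] is either class of monotone events and [mu n] the measure at the parameter of level [n], so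
    one induction serves both cascades. The recursion is a union bound over the pairs of sites in a
    window, with one sprinkling per level. *)
Lemma cascade_prob :
  (forall n z, M (bad n z)) ->
  (forall n x1 x2 A1 A2, M A1 -> M A2 ->
     local (nball x1 (10 * scale n)) A1 -> local (nball x2 (10 * scale n)) A2 ->
     (r n * scale n <= normoo (x1 - x2)%R)%N ->
     prob (mu n.+1) (A1 `&` A2) <= prob (mu n) A1 * prob (mu n) A2 + e n) ->
  (forall z, prob (mu 0) (E z) <= p 0) ->
  (forall n, 0 <= e n) ->
  (forall n, (((2 * l n).*2.+1 ^ d) ^ 2)%:R * (p n ^+ 2 + e n) <= p n.+1) ->
  forall n z, prob (mu n) (bad n z) <= p n.
Proof.
move=> MB dec p0 e0 rec; elim=> [|n IH] z; first exact: p0.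
have [s [hs ss]] := nball_enum ((l n)%:Z *: z) (2 * l n).
pose F (zz : lattice d * lattice d) : set (configuration d) :=
  [set xi | (r n <= normoo (zz.1 - zz.2)%R)%N] `&` (bad n zz.1 `&` bad n zz.2).
pose S := [seq (z1, z2) | z1 <- s, z2 <- s].
have mF zz : measurable (F zz).
  apply: measurableI; first exact: measurable_constant.
  by apply: measurableI; exact: measurable_bad.
have -> : bad n.+1 z = [set xi | exists2 zz, zz \in S & F zz xi].
  apply/seteqP; split=> xi.
    move=> [z1 [z2 [/hs h1 /hs h2 h12 c1 c2]]]; exists (z1, z2) => //.
    by apply/allpairsP; exists (z1, z2).
  move=> [_ /allpairsP[[z1 z2] /= [/hs h1 /hs h2 ->]] [/= h12 [c1 c2]]].
  by exists z1, z2.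
have Fb zz : zz \in S -> prob (mu n.+1) (F zz) <= p n ^+ 2 + e n.
  move=> _; have [h12|h12] := leqP (r n) (normoo (zz.1 - zz.2)%R); last first.
    rewrite (_ : F zz = set0); first by rewrite prob0 addr_ge0 ?sqr_ge0.
    by apply/seteqP; split=> // xi []; rewrite /= leqNgt h12.
  have -> : F zz = bad n zz.1 `&` bad n zz.2.
    by apply/seteqP; split=> xi; [case | split].
  apply: le_trans (dec n ((scale n)%:Z *: zz.1) ((scale n)%:Z *: zz.2) _ _
    (MB n zz.1) (MB n zz.2) (@local_bad n _) (@local_bad n _) _) _.
    by rewrite -scalerBr normooZ mulnC leq_mul2l h12 orbT.
  by rewrite lerD2r expr2 ler_pM ?prob_ge0.
have ub := @prob_union_seq _ _ _ (mu n.+1) _ S F _ (fun zz _ => mF zz) Fb.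
apply: (le_trans ub); apply: le_trans (rec n).
apply: ler_wpM2r; first by rewrite addr_ge0 ?sqr_ge0.
by rewrite ler_nat /S size_allpairs -mulnn leq_mul.
Qed.

End CascadeProb.

(** * Condition P3 for local events *)

Section Decoupling.
Variables (R : realType) (d : nat) (a b : R).
Variable P : R -> probability (configuration d) R.

Lemma decoupling : condP3 a b P ->
  exists (RP LP epsP chiP : R) (fP : nat -> R),
  [/\ 0 < epsP, 0 < chiP,
      forall L : nat, LP <= L%:R -> expR (ln L%:R `^ epsP) <= fP L &
      forall (L : nat) (x1 x2 : lattice d) (r : nat) (u' u : R) (A1 A2 : set (cfg d)),
      (1 <= L)%N -> RP <= r%:R -> a < u' -> u' < u -> u < b ->
      (1 + r%:R `^ (- chiP)) * u' <= u -> (r * L <= normoo (x1 - x2)%R)%N ->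
      local (nball x1 (10 * L)) A1 -> local (nball x2 (10 * L)) A2 ->
      (decreasing A1 -> decreasing A2 -> prob (P u) (A1 `&` A2) <=
         prob (P u') A1 * prob (P u') A2 + expR (- fP L)) /\
      (increasing A1 -> increasing A2 -> prob (P u') (A1 `&` A2) <=
         prob (P u) A1 * prob (P u) A2 + expR (- fP L))].
Proof.
move=> [RP [LP [epsP [chiP [fP [eps0 chi0 hf h3]]]]]].
exists RP, LP, epsP, chiP, fP; split=> // L x1 x2 r u' u A1 A2 L1 rR au uu ub.
move=> ru rx loc1 loc2.
have sc (x : lattice d) A (lA : local (nball x (10 * L)) A) : sigma_coord (box x (10 * L%:R : R)) A.
  by apply: sigma_coord_nball lA; rewrite -natrM boxE.
have sc0 (x : lattice d) : sigma_coord (box x (10 * L%:R : R)) set0.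
  exact: (@measurable0 _ (g_sigma_algebraType (cylinders _))).
have dec0 : @decreasing d set0 by [].
have inc0 : @increasing d set0 by [].
have m1 : measurable (A1 : set (configuration d)) by exact: measurable_local loc1.
have m2 : measurable (A2 : set (configuration d)) by exact: measurable_local loc2.
have m12 : measurable (A1 `&` A2 : set (configuration d)) by exact: measurableI.
split=> hA1 hA2; rewrite -lee_fin EFinD EFinM !EFin_prob //.
  by case: (h3 L x1 x2 A1 A2 set0 set0 r u' u L1 (sc _ _ loc1) hA1 (sc _ _ loc2) hA2
    (sc0 x1) inc0 (sc0 x2) inc0 rR au uu ub ru rx).
by case: (h3 L x1 x2 set0 set0 A1 A2 r u' u L1 (sc0 x1) dec0 (sc0 x2) dec0
  (sc _ _ loc1) hA1 (sc _ _ loc2) hA2 rR au uu ub ru rx).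
Qed.

End Decoupling.

(** * Choice of the scales *)

Section Scales.
Variable R : realType.

Lemma two_le_expR1 : (2 : R) <= expR 1.
Proof. by have := expR_ge1Dx (1 : R); rewrite -natr1. Qed.

Lemma expr2_le_expR (n : nat) : (2 : R) ^+ n <= expR n%:R.
Proof.
rewrite -[n%:R]mulr1 expRM_natl; by apply: lerXn2r two_le_expR1; rewrite nnegrE // expR_ge0.
Qed.

(** Raise [t <= exp t] to the power [M] for [t = (n + 1) ln q / M]; [M = N + 1] keeps the
    denominator nonzero. *)
Lemma poly_le_exp (N : nat) (q : R) : 1 < q ->
  exists2 C : R, 0 < C & forall n : nat, n.+1%:R ^+ N <= C * q ^+ n.
Proof.
move=> q1; have q0 : 0 < q by apply: lt_trans q1.
have c0 : 0 < ln q by rewrite ln_gt0.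
pose M := N.+1; have M0 : 0 < M%:R :> R by rewrite ltr0n.
have Mc : 0 < M%:R / ln q by rewrite divr_gt0.
exists ((M%:R / ln q) ^+ M * q); first by rewrite mulr_gt0 // exprn_gt0.
move=> n; apply: (@le_trans _ _ (n.+1%:R ^+ M)).
  by rewrite ler_weXn2l // ler1n.
rewrite -mulrA -exprS.
have -> : q ^+ n.+1 = expR (n.+1%:R * ln q / M%:R) ^+ M.
  by rewrite -expRM_natl mulrC divfK ?gt_eqF // expRM_natl lnK.
rewrite -exprMn; apply: lerXn2r; rewrite ?nnegrE // ?mulr_ge0 ?expR_ge0 ?(ltW Mc) //.
  by rewrite invr_ge0 ltW.
rewrite -ler_pdivrMl // invf_div mulrC.
apply: le_trans (_ : 1 + n.+1%:R * ln q / M%:R <= _); last exact: expR_ge1Dx.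
by rewrite mulrA lerDr.
Qed.

Lemma exists_nat_ge (x : R) : exists n : nat, x <= n%:R.
Proof. by exists (Num.trunc x).+1; apply/ltW/truncnS_gt. Qed.

Lemma leq_expWl (m n e : nat) : (m <= n)%N -> (m ^ e <= n ^ e)%N.
Proof. by case: e => // e; rewrite leq_exp2r. Qed.

Definition ratio (K th n : nat) : nat := 2 ^ (K * n.+1 ^ th).

Definition sqratio (K th n : nat) : nat := ratio K th n ^ 2.

Lemma ratio_ge K th n : (0 < th)%N -> (2 ^ (K * n.+1) <= ratio K th n)%N.
Proof. by move=> th0; rewrite leq_exp2l // leq_mul2l -{1}[n.+1]expn1 leq_pexp2l ?orbT. Qed.

Lemma ln_natX (k n : nat) : (0 < k)%N -> ln ((k ^ n)%:R : R) = n%:R * ln k%:R.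
Proof. by move=> k0; rewrite natrX lnXn ?ltr0n // mulr_natl. Qed.

(** The number of pairs of sites in a window, doubled to absorb the two summands of the recursion.
    With [E = K (n+1)^th] the side is at most [2^(3 E)], so pairs give [6 d E], and the factor 2
    costs one more [E]. *)
Lemma sqratio_count (d K th n : nat) : (4 <= K)%N ->
  2 * (((2 * sqratio K th n).*2.+1 ^ d) ^ 2)%:R <=
    expR (((6 * d + 1) * (K * n.+1 ^ th))%N%:R : R).
Proof.
move=> K4; apply: le_trans (expr2_le_expR _).
rewrite -[2 * _]/(2%:R * _) -natrM -natrX ler_nat.
set E := (K * n.+1 ^ th)%N.
have E4 : (4 <= E)%N.
  by apply: leq_trans K4 _; rewrite /E leq_pmulr // expn_gt0.
have h : ((2 * sqratio K th n).*2.+1 <= 2 ^ (3 * E))%N.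
  rewrite /sqratio /ratio -/E -expnM.
  apply: (@leq_trans (2 ^ (3 + E * 2))%N); last by rewrite leq_exp2l //; lia.
  have := expn_gt0 2 (E * 2); rewrite expnD -[(2 ^ 3)%N]/8%N.
  by move: (2 ^ _)%N => p /=; lia.
apply: (@leq_trans (2 * ((2 ^ (3 * E)) ^ d) ^ 2)%N).
  by rewrite leq_mul2l /=; do 2!apply: leq_expWl.
by rewrite -!expnM -expnS leq_exp2l //; nia.
Qed.

(** The right side is the relative increment of the parameter that the geometric sprinkling can
    afford at level [n]. *)
Lemma ratio_powRN (K th n : nat) (chi kappa : R) : (0 < th)%N -> 0 < chi ->
  0 < kappa <= 1 -> ln 2 - ln kappa <= chi * K%:R * ln 2 ->
  (ratio K th n)%:R `^ (- chi) <= kappa / 2 ^+ n.+1.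
Proof.
move=> th0 chi0 /andP[k0 k1] hK.
have ln20 : 0 < ln 2 :> R by rewrite ln_gt0 // ltr1n.
have m0 : (0 : R) < (ratio K th n)%:R by rewrite ltr0n expn_gt0.
rewrite /powR gt_eqF //.
have -> : kappa / 2 ^+ n.+1 = expR (ln kappa - n.+1%:R * ln 2).
  by rewrite expRD expRN lnK ?posrE // expRM_natl lnK ?posrE.
rewrite ler_expR mulNr lerNl opprB.
have lm : K%:R * n.+1%:R * ln 2 <= ln (ratio K th n)%:R :> R.
  rewrite -natrM -ln_natX // ler_ln ?posrE ?ltr0n ?expn_gt0 // ler_nat.
  exact: ratio_ge.
apply: (@le_trans _ _ (chi * (K%:R * n.+1%:R * ln 2))); last by rewrite ler_pM2l.
have lk : 0 <= - ln kappa by rewrite oppr_ge0 ln_le0.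
have -> : chi * (K%:R * n.+1%:R * ln 2) = n.+1%:R * (chi * K%:R * ln 2) by ring.
apply: (@le_trans _ _ (n.+1%:R * (ln 2 - ln kappa))); last by rewrite ler_pM2l ?ltr0n.
rewrite mulrBr lerD2l lerN2; apply: (@le_trans _ _ (1 * ln kappa)); last by rewrite mul1r.
by rewrite -lerN2 -!mulrN; apply: ler_wpM2r => //; rewrite ler1n.
Qed.

Lemma scale_ge (K th L0 n : nat) : (L0 <= scale (sqratio K th) L0 n)%N.
Proof.
by rewrite /scale leq_pmulr // prodn_gt0 // => i; rewrite !expn_gt0.
Qed.

Lemma scale_ge_exp (K th L0 n : nat) : (0 < L0)%N ->
  (2 ^ (K * n.+1 ^ th) <= scale (sqratio K th) L0 n.+1)%N.
Proof.
move=> L00; rewrite scaleS.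
apply: (@leq_trans (1 * sqratio K th n)%N); last first.
  by rewrite leq_mul2r (leq_trans L00 (scale_ge _ _ _ _)) orbT.
by rewrite mul1n /sqratio /ratio -mulnn leq_pmulr // expn_gt0.
Qed.

Lemma scale_le (K th L0 n : nat) :
  (scale (sqratio K th) L0 n.+1 <= L0 * 2 ^ (2 * K * n.+1 ^ th.+1))%N.
Proof.
rewrite /scale leq_mul2l; apply/orP; right.
apply: (@leq_trans (\prod_(i < n.+1) 2 ^ (2 * K * n.+1 ^ th))%N).
  apply: leq_prod => i _; rewrite /sqratio /ratio -expnM leq_exp2l //.
  rewrite mulnC mulnA leq_mul2l; apply/orP; right; apply: leq_expWl.
  exact: ltn_ord.
by rewrite prod_nat_const card_ord -expnM leq_exp2l // expnSr mulnA.
Qed.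

(** Half of the left side comes from each source: a large [L0] gives [2 * X], and the growth of the
    ratios, through [th * eps >= 1] and [(K ln 2)^eps >= 2], gives [2 * n] whatever [L0] is. *)
Lemma scale_lower (eps X : R) (K th : nat) : 0 < eps -> 1 <= th%:R * eps ->
  0 <= X -> 2 `^ eps^-1 <= K%:R * ln 2 ->
  exists n0 : nat, forall L0 n, (n0 <= L0)%N ->
    X + n%:R <= ln (scale (sqratio K th) L0 n)%:R `^ eps.
Proof.
move=> eps0 the X0 hK.
have [n0 hn0] := @ln_pow_large R eps (2 * X) eps0 (mulr_ge0 (ler0n _ 2) X0).
exists (maxn n0 1) => L0 n; rewrite geq_max => /andP[nL L00].
have lnL0 : 0 <= ln L0%:R :> R by rewrite ln_ge0 // ler1n.
have lnsc : ln L0%:R <= ln (scale (sqratio K th) L0 n)%:R :> R.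
  rewrite ler_ln ?posrE ?ltr0n //; last exact: leq_trans L00 (scale_ge _ _ _ _).
  by rewrite ler_nat scale_ge.
have lnsc0 := le_trans lnL0 lnsc.
have h1 : 2 * X <= ln (scale (sqratio K th) L0 n)%:R `^ eps.
  apply: le_trans (hn0 _ nL) _.
  by apply: ge0_ler_powR; rewrite ?nnegrE // ltW.
have h2 : 2 * n%:R <= ln (scale (sqratio K th) L0 n)%:R `^ eps.
  case: n {h1 lnsc} lnsc0 => [|n] lnsc0; first by rewrite mulr0 powR_ge0.
  have e1 : 2 `^ eps^-1 * n.+1%:R ^+ th <= ln (scale (sqratio K th) L0 n.+1)%:R.
    apply: (@le_trans _ _ (K%:R * ln 2 * n.+1%:R ^+ th)).
      by rewrite ler_wpM2r // exprn_ge0.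
    have -> : K%:R * ln 2 * n.+1%:R ^+ th = ln (2 ^ (K * n.+1 ^ th))%:R :> R.
      by rewrite ln_natX // natrM natrX; ring.
    rewrite ler_ln ?posrE ?ltr0n ?expn_gt0 //.
      by rewrite ler_nat scale_ge_exp.
    exact: leq_trans L00 (scale_ge _ _ _ _).
  have p0 : 0 <= 2 `^ eps^-1 * n.+1%:R ^+ th :> R by rewrite mulr_ge0 ?powR_ge0.
  apply: le_trans (ge0_ler_powR (ltW eps0) _ _ e1); rewrite ?nnegrE //.
  rewrite powRM ?powR_ge0 // -powRrM mulVf ?gt_eqF // powRr1 // ler_wpM2l //.
  rewrite -powR_mulrn // -powRrM; apply: le_trans (ler_powR _ the); last by rewrite ler1n.
  by rewrite powRr1.
by lra.
Qed.

(** [log L_(s+1)] is at most a multiple of [(s+1)^(th+1)], and so are its powers dominated by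
    [(3/2)^s]. The shift is deliberate: the radius is only known to be below a multiple of the scale
    after the one used. *)
Lemma scale_upper (K th L0 : nat) (Delta : R) : (1 <= L0)%N -> 0 < Delta ->
  exists2 c : R, 0 < c & forall s,
    c * ln (scale (sqratio K th) L0 s.+1)%:R `^ (1 + Delta) <= (3 / 2) ^+ s.
Proof.
move=> L01 D0; have [N hN] := exists_nat_ge (1 + Delta).
have q1 : 1 < 3 / 2 :> R by lra.
have [C C0 hC] := poly_le_exp (th.+1 * N) q1.
pose B : R := (L0 + 2 * K)%N%:R.
have B1 : 1 <= B by rewrite ler1n (leq_trans L01) // leq_addr.
have B0 : 0 < B by apply: lt_le_trans B1.
have BC : 0 < B ^+ N * C by rewrite mulr_gt0 // exprn_gt0.
exists (B ^+ N * C)^-1; first by rewrite invr_gt0.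
move=> s; rewrite ler_pdivrMl //.
set x : R := s.+1%:R ^+ th.+1.
have x1 : 1 <= x by rewrite exprn_ege1 // ler1n.
have sc1 : (1 <= scale (sqratio K th) L0 s.+1)%N by exact: leq_trans L01 (scale_ge _ _ _ _).
have hln : ln (scale (sqratio K th) L0 s.+1)%:R <= B * x.
  apply: (@le_trans _ _ (ln (L0 * 2 ^ (2 * K * s.+1 ^ th.+1))%:R)).
    rewrite ler_ln ?posrE ?ltr0n // ?ler_nat ?scale_le //.
    by rewrite muln_gt0 L01 expn_gt0.
  rewrite natrM lnM ?posrE ?ltr0n ?expn_gt0 // ln_natX //.
  have l1 : ln L0%:R <= L0%:R * x.
    apply: (@le_trans _ _ L0%:R); last by rewrite ler_peMr.
    have : (1 : R) <= L0%:R by rewrite ler1n.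
    by have := @le_ln1Dx R (L0%:R - 1); rewrite [1 + _]addrC subrK; lra.
  have l2 : ln 2 <= 1 :> R.
    by rewrite -ler_expR lnK ?posrE //; exact: two_le_expR1.
  have -> : B * x = L0%:R * x + (2 * K * s.+1 ^ th.+1)%:R.
    by rewrite /B /x -natrX natrD mulrDl -!natrM.
  by apply: lerD => //; rewrite ler_piMr.
have Bx1 : 1 <= B * x by rewrite mulr_ege1.
apply: (@le_trans _ _ ((B * x) `^ (1 + Delta))).
  apply: ge0_ler_powR => //; rewrite ?nnegrE //; first lra.
    by rewrite ln_ge0 // ler1n.
  by apply: le_trans Bx1.
apply: le_trans (ler_powR Bx1 hN) _.
rewrite powR_mulrn; last by apply: le_trans Bx1.
rewrite exprMn -mulrA ler_pM2l ?exprn_gt0 // -exprM; exact: hC.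
Qed.

End Scales.

(** * Sprinkling: bad vertices are unlikely at every level *)

Section BadProb.
Variables (R : realType) (d : nat) (a b : R).
Variables (P : R -> probability (configuration d) R) (DeltaS : R -> R).
Implicit Types (x y z : lattice d) (xi : cfg d).

Lemma bad_decreasing (l r : nat -> nat) (E : lattice d -> set (configuration d)) n z :
  (forall z, decreasing (E z)) -> decreasing (bad l r E n z : set (cfg d)).
Proof. by move=> dE xi xi' h hx; apply: cascade_mono h => w Ew; exact: dE hx. Qed.

Lemma bad_increasing (l r : nat -> nat) (E : lattice d -> set (configuration d)) n z :
  (forall z, increasing (E z)) -> increasing (bad l r E n z : set (cfg d)).
Proof. by move=> dE xi xi' h hx; apply: cascade_mono h => w Ew; exact: dE hx. Qed.

Lemma decreasingC (G : set (cfg d)) : increasing G -> decreasing (~` G).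
Proof. by move=> iG xi xi' nG h G'; apply: nG; exact: iG h. Qed.

Lemma increasingC (G : set (cfg d)) : decreasing G -> increasing (~` G).
Proof. by move=> iG xi xi' nG h G'; apply: nG; exact: iG h. Qed.

Lemma localC (K : set (lattice d)) (G : set (cfg d)) : local K G -> local K (~` G).
Proof. by move=> lG xi xi' h nG G'; apply: nG; apply: lG G' => y /h. Qed.

(** Squaring doubles the exponent and only 3/2 of it is claimed. The remaining [Q / 2 * (3/2)^n]
    pays for the pairs, and [Q] is chosen for exactly this. *)
Lemma recursion_step (K th n : nat) (Q C e : R) :
  (4 <= K)%N -> n.+1%:R ^+ th <= C * (3 / 2) ^+ n ->
  Q = 2 * ((6 * d + 1) * K)%N%:R * C -> e <= expR (- (2 * Q * (3 / 2) ^+ n)) ->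
  (((2 * sqratio K th n).*2.+1 ^ d) ^ 2)%:R *
    (expR (- (Q * (3 / 2) ^+ n)) ^+ 2 + e) <= expR (- (Q * (3 / 2) ^+ n.+1)).
Proof.
move=> K4 hC QE he.
have h2 : expR (- (Q * (3 / 2) ^+ n)) ^+ 2 = expR (- (2 * Q * (3 / 2) ^+ n)).
  by rewrite -expRM_natl; congr expR; ring.
have cnt := @sqratio_count R d K th n K4.
set N := (X in 2 * X) in cnt *.
have N0 : 0 <= N by rewrite ler0n.
apply: (@le_trans _ _ (2 * N * expR (- (2 * Q * (3 / 2) ^+ n)))).
  by rewrite h2; move: he N0; nra.
apply: (@le_trans _ _ (expR (Q / 2 * (3 / 2) ^+ n) * expR (- (2 * Q * (3 / 2) ^+ n)))).
  rewrite ler_wpM2r ?expR_ge0 //; apply: le_trans cnt _; rewrite ler_expR.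
  rewrite mulnA natrM natrX QE; set W := _%:R.
  have W0 : 0 <= W by rewrite ler0n.
  by have := ler_wpM2l W0 hC; lra.
by rewrite -expRD ler_expR exprS; lra.
Qed.

Lemma sqratio_ge2 K th n : (0 < K)%N -> (0 < th)%N -> (2 <= sqratio K th n)%N.
Proof.
move=> K0 th0; rewrite /sqratio -mulnn; have := @ratio_ge K th n th0.
have : (2 ^ 1 <= 2 ^ (K * n.+1))%N by rewrite leq_exp2l // muln_gt0 K0.
by move: (2 ^ (K * n.+1))%N (ratio K th n) => p q; nia.
Qed.

(** The gap to [t] is halved each time, so step [n] gains [(t - s) / 2^(n+1)], at least the fraction
    [kappa / 2^(n+1)] of any value up to [t]. *)
Lemma geometric_approach (n : nat) (s t kappa : R) : 0 <= s -> s <= t ->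
  0 <= kappa -> kappa * t <= t - s ->
  let v k := s + (t - s) * (1 - (2 ^+ k)^-1) in
  [/\ s <= v n, v n <= v n.+1, v n.+1 <= t &
      forall rho, rho <= kappa / 2 ^+ n.+1 -> (1 + rho) * v n <= v n.+1].
Proof.
move=> s0 st k0 kt v.
have p0 : 0 < (2 ^+ n.+1)^-1 :> R by rewrite invr_gt0 exprn_gt0.
have pE : (2 ^+ n)^-1 = 2 * (2 ^+ n.+1)^-1 :> R.
  by rewrite exprS invfM mulrA divff ?mul1r.
have p1 : (2 ^+ n)^-1 <= 1 :> R.
  by rewrite invf_le1 ?exprn_gt0 // exprn_ege1 // ler1n.
rewrite /v pE; rewrite pE in p1; move: p0 p1; set p := (2 ^+ n.+1)^-1 => p0 p1.
split; [nra|nra|nra|] => rho hr.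
have v0 : 0 <= s + (t - s) * (1 - 2 * p) by nra.
have vt : s + (t - s) * (1 - 2 * p) <= t by nra.
have := ler_wpM2r v0 hr.
have : kappa * p * (s + (t - s) * (1 - 2 * p)) <= (t - s) * p.
  apply: (@le_trans _ _ (kappa * p * t)); last by nra.
  by apply: ler_wpM2l => //; rewrite mulr_ge0 // ltW.
by lra.
Qed.

Lemma geometric_descent (n : nat) (s t kappa : R) : 0 <= s -> s <= t ->
  0 <= kappa -> kappa * t <= t - s ->
  let v k := t - (t - s) * (1 - (2 ^+ k)^-1) in
  [/\ v n <= t, v n.+1 <= v n, s <= v n.+1 &
      forall rho, rho <= kappa / 2 ^+ n.+1 -> (1 + rho) * v n.+1 <= v n].
Proof.
move=> s0 st k0 kt v.
have p0 : 0 < (2 ^+ n.+1)^-1 :> R by rewrite invr_gt0 exprn_gt0.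
have pE : (2 ^+ n)^-1 = 2 * (2 ^+ n.+1)^-1 :> R.
  by rewrite exprS invfM mulrA divff ?mul1r.
have p1 : (2 ^+ n)^-1 <= 1 :> R.
  by rewrite invf_le1 ?exprn_gt0 // exprn_ege1 // ler1n.
rewrite /v pE; rewrite pE in p1; move: p0 p1; set p := (2 ^+ n.+1)^-1 => p0 p1.
split; [nra|nra|nra|] => rho hr.
have v0 : 0 <= t - (t - s) * (1 - p) by nra.
have vt : t - (t - s) * (1 - p) <= t by nra.
have := ler_wpM2r v0 hr.
have : kappa * p * (t - (t - s) * (1 - p)) <= (t - s) * p.
  apply: (@le_trans _ _ (kappa * p * t)); last by nra.
  by apply: ler_wpM2l => //; rewrite mulr_ge0 // ltW.
by lra.
Qed.

Hypothesis d_gt0 : (0 < d)%N.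
Hypothesis a_ge0 : 0 <= a.
Hypotheses (hP1 : condP1 a b P) (hP2 : condP2 a b P) (hP3 : condP3 a b P).
Hypotheses (hS1 : condS1 a b P DeltaS) (hS2 : condS2 a b P).

(* The seeds are unlikely at [um < u] (connectedness) and at [up > u] (sparsity);
   the sprinkling moves the parameter monotonically towards [u] without ever
   crossing it. [L0] is chosen last, so that the seed probability beats [Q]. *)
Lemma bad_seeds_prob u : a < u < b ->
  exists (K th k L0 : nat) (Q : R),
  [/\ (4 <= K)%N /\ (0 < th)%N, 0 < Q, (0 < L0)%N /\ 0 < eta P u,
      ((k.*2.+1) ^ d)%:R < 3 / 4 * eta P u * (L0 ^ d)%:R &
   forall n z,
     [/\ measurable (bad (sqratio K th) (ratio K th)
           (fun w => ~` connected_seed L0 (eta P u) w) n z),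
         measurable (bad (sqratio K th) (ratio K th)
           (fun w => ~` sparse_seed L0 k (eta P u) w) n z),
         prob (P u) (bad (sqratio K th) (ratio K th)
           (fun w => ~` connected_seed L0 (eta P u) w) n z)
             <= expR (- (Q * (3 / 2) ^+ n)) &
         prob (P u) (bad (sqratio K th) (ratio K th)
           (fun w => ~` sparse_seed L0 k (eta P u) w) n z)
             <= expR (- (Q * (3 / 2) ^+ n))]].
Proof.
move=> hu; have /andP[au ub] := hu; have u0 : 0 < u by exact: le_lt_trans au.
have [hpos _] := hS2; have g0 : 0 < eta P u := hpos _ hu.
have g1 : eta P u <= 1 by rewrite etaE prob_le1 //; exact: measurable_infinite.
set g := eta P u in g0 g1 *.
have g01 : 0 < g <= 1 by rewrite g0.
have g8 : 0 < g / 8 by rewrite divr_gt0.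
have [s s0 hs] := eta_near hS2 hu g8.
pose um := u - Num.min (s / 2) ((u - a) / 2).
pose up := u + Num.min (s / 2) ((b - u) / 2).
have [um1 um2 um3] : [/\ a < um, um < u & `|um - u| < s].
  rewrite /um.
  have h1 : Num.min (s / 2) ((u - a) / 2) <= s / 2 by rewrite ge_min lexx.
  have h2 : Num.min (s / 2) ((u - a) / 2) <= (u - a) / 2 by rewrite ge_min lexx orbT.
  have h3 : 0 < Num.min (s / 2) ((u - a) / 2) by rewrite lt_min !divr_gt0 //= subr_gt0.
  move: h1 h2 h3; set q := Num.min _ _ => h1 h2 h3.
  split; [lra|lra|]; rewrite ltr_norml; apply/andP; split; lra.
have [up1 up2 up3] : [/\ u < up, up < b & `|up - u| < s].
  rewrite /up.
  have h1 : Num.min (s / 2) ((b - u) / 2) <= s / 2 by rewrite ge_min lexx.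
  have h2 : Num.min (s / 2) ((b - u) / 2) <= (b - u) / 2 by rewrite ge_min lexx orbT.
  have h3 : 0 < Num.min (s / 2) ((b - u) / 2) by rewrite lt_min !divr_gt0 //= subr_gt0.
  move: h1 h2 h3; set q := Num.min _ _ => h1 h2 h3.
  split; [lra|lra|]; rewrite ltr_norml; apply/andP; split; lra.
have um0 : 0 < um by exact: le_lt_trans um1.
have up0 : 0 < up by exact: lt_trans up1.
have hum : a < um < b by rewrite um1 (lt_trans um2).
have hup : a < up < b by rewrite (lt_trans au).
have etam : 7 / 8 * g <= eta P um.
  by have := hs _ um3; rewrite ler_distl -/g => /andP[]; lra.
have etap : eta P up <= 9 / 8 * g.
  by have := hs _ up3; rewrite ler_distl -/g => /andP[]; lra.
(* The relative room for sprinkling on both sides of [u]; the cap at 1 makes [ln kappa <= 0] for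
   [ratio_powRN]. *)
pose kappa := Num.min 1 (Num.min ((u - um) / u) ((up - u) / up)).
have kappa01 : 0 < kappa <= 1.
  by rewrite !lt_min ltr01 !divr_gt0 ?subr_gt0 //= ge_min lexx.
have kappam : kappa * u <= u - um.
  by rewrite -ler_pdivlMr // !ge_min lexx /= orbT.
have kappap : kappa * up <= up - u.
  by rewrite -ler_pdivlMr // !ge_min lexx /= !orbT.
have [RP [LP [eps [chi [fP [eps0 chi0 hf dec]]]]]] := decoupling hP3.
pose th := (Num.trunc eps^-1).+1.
have th0 : (0 < th)%N by [].
have the : 1 <= th%:R * eps.
  by rewrite -ler_pdivrMr // div1r; apply/ltW/truncnS_gt.
have ln20 : 0 < ln 2 :> R by rewrite ln_gt0 // ltr1n.
have [K1 hK1] := exists_nat_ge RP.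
have [K2 hK2] := exists_nat_ge (2 `^ eps^-1 / ln 2).
have [K3 hK3] := exists_nat_ge ((ln 2 - ln kappa) / (chi * ln 2)).
(* 4 gives [16 * r n <= l n]; the others bring the ratios above [RP], the scales to the growth of
   [scale_lower], and the increments within the room [kappa]. *)
pose K := maxn 4 (maxn K1 (maxn K2 K3)).
have K4 : (4 <= K)%N by rewrite leq_max leqnn.
have KRP : RP <= K%:R by apply: le_trans hK1 _; rewrite ler_nat /K !leq_max leqnn ?orbT.
have Keps : 2 `^ eps^-1 <= K%:R * ln 2.
  rewrite -ler_pdivrMr //; apply: le_trans hK2 _; by rewrite ler_nat /K !leq_max leqnn ?orbT.
have Kchi : ln 2 - ln kappa <= chi * K%:R * ln 2.
  rewrite mulrAC mulrC -ler_pdivrMr ?mulr_gt0 //; apply: le_trans hK3 _.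
  by rewrite ler_nat /K !leq_max leqnn ?orbT.
have q1 : 1 < 3 / 2 :> R by lra.
have [C C0 hC] := poly_le_exp th q1.
pose Q := 2 * ((6 * d + 1) * K)%N%:R * C.
have Q0 : 0 < Q.
  rewrite /Q !mulr_gt0 // ltr0n muln_gt0 (leq_trans _ K4) // andbT.
  by rewrite addn1.
have eQ : 0 < expR (- Q) <= 1 by rewrite expR_gt0 /= expR_le1 oppr_le0 ltW.
have [k [n1 hn1]] := sparse_seed_prob d_gt0 a_ge0 hP1 hP2 hP3 hS2 hup g01 eQ etap.
have [n2 hn2] := connected_seed_prob d_gt0 a_ge0 hP1 hP2 hP3 hS1 hS2 hum g01 eQ etam.
have [n3 hn3] := scale_lower eps0 the (ltW (mulr_gt0 (ltr0Sn R 1) Q0)) Keps.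
have [n4 hn4] := exists_nat_ge LP.
have [n5 hn5] := exists_nat_ge (((k.*2.+1) ^ d)%:R / (3 / 4 * g)).
(* [k] makes sparsity local, [n1] and [n2] make the seeds likely, [n3] and [n4] control the error of
   P3, and [n5] gives the volume bound required by [hub_joined]. *)
pose L0 := maxn 1 (maxn k (maxn n1 (maxn n2 (maxn n3 (maxn n4 n5.+1))))).
have g34 : 0 < 3 / 4 * g by rewrite mulr_gt0.
have L00 : (0 < L0)%N by rewrite leq_max leqnn.
have l2 n : (2 <= sqratio K th n)%N by apply: sqratio_ge2 => //; exact: leq_trans K4.
have loc1 z : local (nball (L0%:Z *: z) (4 * L0)) (~` connected_seed L0 g z).
  by apply: localC; exact: local_connected_seed.
have loc2 z : local (nball (L0%:Z *: z) (4 * L0)) (~` sparse_seed L0 k g z).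
  by apply: localC; apply: local_sparse_seed; rewrite /L0 !leq_max leqnn ?orbT.
pose p n := expR (- (Q * (3 / 2) ^+ n)).
pose e n := expR (- fP (scale (sqratio K th) L0 n)).
have scL0 n : (L0 <= scale (sqratio K th) L0 n)%N by exact: scale_ge.
have eP n : e n <= expR (- (2 * Q * (3 / 2) ^+ n)).
  rewrite ler_expR lerN2; apply: le_trans (hf _ _); last first.
    by apply: le_trans hn4 _; rewrite ler_nat (leq_trans _ (scL0 n)) // /L0 !leq_max leqnn ?orbT.
  (* [exp (2 Q)] exceeds [2 Q], and [exp n] exceeds [2^n], hence [(3/2)^n]. *)
  apply: (@le_trans _ _ (expR (2 * Q + n%:R))); last first.
    by rewrite ler_expR; apply: hn3; rewrite /L0 !leq_max leqnn ?orbT.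
  rewrite expRD; apply: ler_pM.
  - by rewrite mulr_ge0 // ltW.
  - by rewrite exprn_ge0 // ltW // (lt_trans ltr01).
  - by apply: le_trans (expR_ge1Dx _); rewrite lerDr.
  apply: le_trans (expr2_le_expR R n).
  by apply: lerXn2r; rewrite ?nnegrE // ?ler_pdivrMr // ?(ltW (lt_trans ltr01 q1)) //
    -natrM ler_nat.
have rec n := recursion_step K4 (hC n) (erefl Q) (eP n).
have rRP n : RP <= (ratio K th n)%:R.
  apply: le_trans KRP _; rewrite ler_nat (leq_trans _ (ratio_ge _ _ th0)) //.
  apply: (leq_trans (ltnW (ltn_expl K (isT : (1 < 2)%N)))).
  by rewrite leq_exp2l // leq_pmulr.
have rchi n := @ratio_powRN R K th n chi kappa th0 chi0 kappa01 Kchi.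
have sc1 n : (1 <= scale (sqratio K th) L0 n)%N by exact: leq_trans (scL0 n).
exists K, th, k, L0, Q; split => //.
  apply: (@lt_le_trans _ _ (3 / 4 * g * L0%:R)).
    rewrite mulrC -ltr_pdivrMr //; apply: le_lt_trans hn5 _.
    by rewrite ltr_nat /L0 !leq_max leqnn ?orbT.
  rewrite ler_pM2l // ler_nat -{1}[L0]expn1 leq_pexp2l //.
(* P3 bounds decreasing pairs at the larger parameter by probabilities at the smaller one, and
   increasing pairs the other way round: failures of connectedness climb from [um], failures of
   sparsity descend from [up]. *)
pose v n := um + (u - um) * (1 - (2 ^+ n)^-1).
pose w n := up - (up - u) * (1 - (2 ^+ n)^-1).
have k0 : 0 <= kappa by case/andP: kappa01 => /ltW.
have hv n := geometric_approach n (ltW um0) (ltW um2) k0 kappam.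
have hw n := geometric_descent n (ltW u0) (ltW up1) k0 kappap.
have vlt n : v n < v n.+1.
  rewrite /v ltrD2l ltr_pM2l ?subr_gt0 // ltrD2l ltrN2 ltf_pV2 ?posrE ?exprn_gt0 //.
  by rewrite exprS ltr_pMl ?exprn_gt0 // ltr1n.
have wlt n : w n.+1 < w n.
  rewrite /w ltrD2l ltrN2 ltr_pM2l ?subr_gt0 // ltrD2l ltrN2 ltf_pV2 ?posrE ?exprn_gt0 //.
  by rewrite exprS ltr_pMl ?exprn_gt0 // ltr1n.
have dD n z : decreasing (bad (sqratio K th) (ratio K th)
    (fun w => ~` connected_seed L0 g w) n z : set (cfg d)).
  by apply: bad_decreasing => {}z; apply: decreasingC; exact: increasing_connected_seed.
have iI n z : increasing (bad (sqratio K th) (ratio K th)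
    (fun w => ~` sparse_seed L0 k g w) n z : set (cfg d)).
  by apply: bad_increasing => {}z; apply: increasingC; exact: decreasing_sparse_seed.
move=> n z.
have mD := measurable_bad (ratio K th) l2 loc1 n z.
have mI := measurable_bad (ratio K th) l2 loc2 n z.
split=> //.
  have [h1 h2 h3 _] := hv n.
  apply: (@le_trans _ _ (prob (P (v n)) (bad (sqratio K th) (ratio K th)
           (fun w => ~` connected_seed L0 (eta P u) w) n z))).
    apply: (prob_decreasing hP2) => //; first exact: lt_le_trans h1.
    exact: le_trans h3.
  apply: (@cascade_prob _ _ _ _ L0 _ l2 loc1 (@decreasing d) (fun n => P (v n)) p e dD _ _ _ rec).
  - move=> m x1 x2 A1 A2 dA1 dA2 lA1 lA2 far12.
    have [q1' q2 q3 q4] := hv m.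
    have av : a < v m by exact: lt_le_trans q1'.
    have vb : v m.+1 < b by exact: le_lt_trans ub.
    have [h _] := dec _ _ _ _ (v m) (v m.+1) A1 A2 (sc1 m) (rRP m) av (vlt m) vb
      (q4 _ (rchi m)) far12 lA1 lA2.
    exact: h.
  - move=> x; rewrite /v expr0 invr1 subrr mulr0 addr0 /p expr0 mulr1.
    by apply: hn2; rewrite /L0 !leq_max leqnn ?orbT.
  - by move=> m; exact: expR_ge0.
have [h1 h2 h3 _] := hw n.
apply: (@le_trans _ _ (prob (P (w n)) (bad (sqratio K th) (ratio K th)
         (fun w => ~` sparse_seed L0 k (eta P u) w) n z))).
  apply: (prob_increasing hP2) => //; first exact: le_trans h2.
  exact: le_lt_trans up2.
apply: (@cascade_prob _ _ _ _ L0 _ l2 loc2 (@increasing d) (fun n => P (w n)) p e iI _ _ _ rec).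
- move=> m x1 x2 A1 A2 dA1 dA2 lA1 lA2 far12.
  have [q1' q2 q3 q4] := hw m.
  have aw : a < w m.+1 by exact: lt_le_trans q3.
  have wb : w m < b by exact: le_lt_trans up2.
  have [_ h] := dec _ _ _ _ (w m.+1) (w m) A1 A2 (sc1 m) (rRP m) aw (wlt m) wb
    (q4 _ (rchi m)) far12 lA1 lA2.
  exact: h.
- move=> x; rewrite /w expr0 invr1 subrr mulr0 subr0 /p expr0 mulr1.
  by apply: hn1; rewrite /L0 !leq_max leqnn ?orbT.
- by move=> m; exact: expR_ge0.
Qed.

End BadProb.

(** * Chemical distance *)

Section ChemicalDistance.
Variables (R : realType) (d : nat).
Implicit Types (x y z w c : lattice d).

Lemma divz_lattice (L : nat) x : (0 < L)%N ->
  exists z, (normoo (L%:Z *: z - x)%R <= L)%N.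
Proof.
move=> L0; exists (\row_i (x ord0 i %/ L%:Z)%Z); apply/normooP => i.
rewrite coordD coordN coordZ.
have -> : (\row_i (x ord0 i %/ L%:Z)%Z) ord0 i = (x ord0 i %/ L%:Z)%Z :> int.
  by rewrite mxE.
have := divz_eq (x ord0 i) L%:Z; have := @ltz_pmod (x ord0 i) L%:Z.
have := modz_ge0 (x ord0 i) (d := L%:Z).
move: (x ord0 i) => v; move: (v %/ _)%Z (v %% _)%Z => q m.
have : L%:Z != 0 by rewrite eqz_nat -lt0n.
have : 0 < L%:Z by rewrite ltz_nat.
by move=> h1 h2 /(_ h2) h3 /(_ h1) h4; lia.
Qed.

Variables (K th L0 k : nat) (g : R) (xi : cfg d).
Hypotheses (hd : (2 <= d)%N) (K4 : (4 <= K)%N) (th0 : (0 < th)%N).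
Hypotheses (L00 : (0 < L0)%N) (g0 : 0 < g).
Hypothesis kL0 : ((k.*2.+1) ^ d)%:R < 3 / 4 * g * (L0 ^ d)%:R.

Let l := sqratio K th.
Let r := ratio K th.
Let D0 : set (lattice d) := [set w | ~ connected_seed L0 g w xi].
Let I0 : set (lattice d) := [set w | ~ sparse_seed L0 k g w xi].

Lemma ratio_gt0 n : (0 < r n)%N.
Proof. by rewrite expn_gt0. Qed.

Lemma ratio_sqratio n : (16 * r n <= l n)%N.
Proof.
rewrite /l /sqratio -mulnn leq_mul2r; apply/orP; right.
apply: leq_trans (ratio_ge K n th0).
by apply: (@leq_trans (2 ^ 4)); rewrite // leq_exp2l // (leq_trans K4) // leq_pmulr.
Qed.

(** Each factor [1 + 10 * r / l] is [1 + 10 / r], at most [exp (10 / 2^(n+1))]; the exponents sum to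
    less than 10. *)
Lemma prod_ratio n :
  (\prod_(i < n) (l i + 10 * r i))%N%:R <= expR 10 * (\prod_(i < n) l i)%N%:R :> R.
Proof.
suff H : (\prod_(i < n) (l i + 10 * r i))%N%:R <=
    expR (10 * (1 - (2 ^+ n)^-1)) * (\prod_(i < n) l i)%N%:R :> R.
  apply: (le_trans H); apply: ler_wpM2r; rewrite // ler_expR.
  have : 0 <= (2 ^+ n)^-1 :> R by rewrite invr_ge0 exprn_ge0.
  by lra.
elim: n => [|n IH]; first by rewrite !big_ord0 expr0 invr1 subrr mulr0 expR0 mulr1.
rewrite !big_ord_recr /= !natrM.
set A := (\prod_(i < n) _)%N%:R in IH *; set B := (\prod_(i < n) l i)%N%:R in IH *.
have p0 : 0 < (2 ^+ n.+1)^-1 :> R by rewrite invr_gt0 exprn_gt0.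
have pE : (2 ^+ n)^-1 = 2 * (2 ^+ n.+1)^-1 :> R.
  by rewrite exprS invfM mulrA divff ?mul1r.
have lr : (l n + 10 * r n)%N%:R <= expR (10 * (2 ^+ n.+1)^-1) * (l n)%:R :> R.
  apply: le_trans (ler_wpM2r _ (expR_ge1Dx _)) => //.
  rewrite mulrDl mul1r natrD lerD2l natrM -mulrA ler_pM2l //.
  rewrite mulrC ler_pdivlMr ?exprn_gt0 // /l /sqratio -mulnn natrM ler_pM2l ?ltr0n ?ratio_gt0 //.
  rewrite -natrX ler_nat (leq_trans _ (ratio_ge K n th0)) // leq_exp2l // leq_pmull //.
  exact: leq_trans K4.
apply: (@le_trans _ _ ((expR (10 * (1 - (2 ^+ n)^-1)) * B) *
    (expR (10 * (2 ^+ n.+1)^-1) * (l n)%:R))); first exact: ler_pM.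
rewrite mulrACA -expRD le_eqVlt; apply/orP; left; apply/eqP.
congr (expR _ * _); first by rewrite pE; lra.
by rewrite -[in RHS]natrM mulnn.
Qed.

Lemma hubs : exists c : lattice d -> lattice d,
  forall w, good l r D0 I0 0 w -> hub L0 g w xi (c w).
Proof.
suff /choice[c hc] : forall w, exists c, good l r D0 I0 0 w -> hub L0 g w xi c.
  by exists c.
move=> w; case: (pselect (good l r D0 I0 0 w)) => [gw|]; last by exists 0.
by have [/contrapT [c hc] _] := gw; exists c.
Qed.

(** Descend to a good seed, then take its hub: the first moves by at most [L_n], the second by at
    most [4 * L0]. *)
Lemma cluster_map n : exists f : lattice d -> lattice d,
  (forall z, good l r D0 I0 n z ->
     (normoo (f z - (scale l L0 n)%:Z *: z)%R <= 5 * scale l L0 n)%N) /\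
  (forall m z z', joined (good l r D0 I0 n) m z z' ->
     joined (occupied xi)
       (m * (\prod_(i < n) (l i + 10 * r i) * (2 * ((4 * L0).*2.+1) ^ d))) (f z) (f z')).
Proof.
have [h [hg hj]] := good_representatives D0 I0 hd ratio_gt0 ratio_sqratio n.
have [c hc] := hubs.
have adj w w' : good l r D0 I0 0 w -> good l r D0 I0 0 w' -> adjacent w w' ->
    joined (occupied xi) (2 * ((4 * L0).*2.+1) ^ d) (c w) (c w').
  move=> gw gw'; have [_ /contrapT sp] := gw'.
  exact: hub_joined g0 L00 kL0 (hc _ gw) (hc _ gw') sp.
exists (c \o h); split=> [z gz|m z z'].
  have [g0z hz] := hg _ gz.
  have [_ cz] := hub_mem g0 L00 (hc _ g0z).
  have := normoo_dist3 (L0%:Z *: h z) (c (h z)) ((scale l L0 n)%:Z *: z).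
  rewrite [X in (_ <= X + _)%N]normoo_distC => /leq_trans; apply.
  rewrite {1}/scale PoszM -scalerA -scalerBr normooZ.
  move: cz; rewrite /nball /= => cz.
  have : (L0 * normoo (h z - (\prod_(i < n) l i)%N%:Z *: z)%R <= scale l L0 n)%N.
    by rewrite /scale leq_mul2l hz orbT.
  have : (L0 <= scale l L0 n)%N by exact: scale_ge.
  by move: cz; move: (normoo _) (normoo _) => u v; lia.
apply: joined_map.
  by move=> w /hg[/hc/(hub_mem g0 L00)[]].
move=> w w' gw gw' ww'; apply: (joined_map (f := c)) (hj _ _ gw gw' ww').
  by move=> v /hc/(hub_mem g0 L00)[].
exact: adj.
Qed.

(** Each endpoint is attached to a hub at the cost of the volume of a box of radius [2 * rho];
    between the hubs runs a shortest lattice path of good level [n] vertices, whose length in sites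
    is linear in [N]. *)
Lemma chemical_distance n N rho : (1 <= N)%N -> (rho <= N)%N ->
  (20 * scale l L0 n <= rho)%N ->
  (forall z, nball 0 (3 * N) z -> good l r D0 I0 n z) ->
  (forall x, nball 0 N x -> unique_at R rho x xi) ->
  forall x y, nball 0 N x -> nball 0 N y ->
    occupied_ge (rho%:R / 10 : R)%:E xi x -> occupied_ge (rho%:R / 10 : R)%:E xi y ->
    exists m, joined (occupied xi) m x y /\
      m%:R <= (2 * ((2 * rho).*2.+1) ^ d)%N%:R +
        4 * d%:R * expR 10 * (2 * ((4 * L0).*2.+1) ^ d)%N%:R * N%:R :> R.
Proof.
move=> N1 rN Lr goodN uniq x y nx ny ox oy.
set Ln := scale l L0 n in Lr.
have Ln0 : (0 < Ln)%N by apply: leq_trans L00 (scale_ge _ _ _ _).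
have [f [floc fj]] := cluster_map n.
have cover v : nball 0 N v -> exists z, (normoo (Ln%:Z *: z - v)%R <= Ln)%N /\
    nball 0 N.+1 z.
  move=> nv; have [z hz] := divz_lattice v Ln0; exists z; split=> //.
  move: nv; rewrite /nball /= !sub0r !normooN => nv.
  have := normoo_dist3 v (Ln%:Z *: z) 0; rewrite !subr0 normooZ => h.
  by move: hz nv h; move: (normoo _) (normoo _) (normoo _) => p q s; nia.
have nsub m m' z : (m <= m')%N -> nball (0 : lattice d) m z -> nball 0 m' z.
  by rewrite /nball /= => mm /leq_trans; apply.
have attach v z : nball 0 N v -> occupied_ge (rho%:R / 10 : R)%:E xi v ->
    (normoo (Ln%:Z *: z - v)%R <= Ln)%N -> nball 0 N.+1 z ->
    joined (occupied xi) (((2 * rho).*2.+1) ^ d) v (f z).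
  move=> nv ov zv nz.
  have gz : good l r D0 I0 n z by apply: goodN; apply: nsub nz; lia.
  have fzv : (normoo (v - f z)%R <= rho)%N.
    have h1 := normoo_dist3 (Ln%:Z *: z) v (f z); have h2 := floc _ gz.
    rewrite [normoo (v - Ln%:Z *: z)%R]normoo_distC in h1.
    rewrite -/Ln normoo_distC in h2.
    by move: h1 h2 zv Lr; move: (normoo _) (normoo _) (normoo _) => p q s; lia.
  (* [rho] steps of level [n] separate the images by at least [L_n * (rho - 10)], ample since
     [rho >= 20], and [N + 1 + rho <= 3 * N] stays among good vertices. *)
  pose z' := z + axis (Ordinal hd) rho%:Z.
  have nz' : nball 0 (3 * N) z'.
    rewrite /nball /= sub0r normooN (leq_trans (normooD _ _)) // normoo_axis.
    by move: nz; rewrite /nball /= sub0r normooN; lia.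
  have gz' := goodN _ nz'.
  (* [f z] is joined to the distant [f z'], hence its component is large and
     local uniqueness around [v] applies to it. *)
  have ofz : occupied_ge (rho%:R / 10 : R)%:E xi (f z).
    have zz' : joined (good l r D0 I0 n) (norm1 (z' - z)) z z'.
      by apply: (joined_nball_hull (c := 0) (m := 3 * N)) => //; apply: nsub nz; lia.
    apply: connected_occupied_ge (joined_connected (fj _ _ _ zz')) _.
    have far' : (rho <= 10 * normoo (f z - f z')%R)%N.
      have h1 := floc _ gz; have h2 := floc _ gz'; rewrite -/Ln in h1 h2.
      have h3 : normoo (Ln%:Z *: z - Ln%:Z *: z')%R = (Ln * rho)%N.
        by rewrite -scalerBr normooZ /z' opprD addrA subrr sub0r normooN normoo_axis.
      have h4 := normoo_dist3 (f z) (Ln%:Z *: z) (Ln%:Z *: z').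
      have h5 := normoo_dist3 (f z') (f z) (Ln%:Z *: z').
      rewrite [normoo (_ - f z)%R]normoo_distC h3 in h4.
      move: h1 h2 h4 h5 Lr Ln0.
      by move: (normoo _) (normoo _) (normoo _) (normoo _) => p q s t; nia.
    by rewrite ler_pdivrMr // mulrC -natrM ler_nat.
  have cv := uniq _ nv v (f z) ov _ ofz fzv.
  apply: joined_mono (joined_nball (cv _) (c := v) (m := 2 * rho) _) => //.
  - by move=> ? [].
  - by rewrite /nball /= subrr normoo0.
  - by move=> ? [].
have N3 : (N.+1 <= 3 * N)%N by lia.
have [zx [hx nzx]] := cover _ nx; have [zy [hy nzy]] := cover _ ny.
have jx := attach _ _ nx ox hx nzx; have jy := attach _ _ ny oy hy nzy.
have zxy : joined (good l r D0 I0 n) (norm1 (zy - zx)) zx zy.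
  by apply: (joined_nball_hull (c := 0) (m := 3 * N)) => //;
    [exact: nsub N3 nzx | exact: nsub N3 nzy].
have jxy := fj _ _ _ zxy.
eexists; split; first exact: joined_trans (joined_trans jx jxy) (joined_sym jy).
set J := (2 * (4 * L0).*2.+1 ^ d)%N; set T := norm1 _; set p := (\prod_(i < n) _)%N.
(* The endpoints are at most [2 * N] apart and each rounding adds [L_n <= N]; the factor [d]
   converts the sup norm to the l1 norm. *)
have TL : (T * Ln <= 4 * d * N)%N.
  have h1 := norm1_le_normoo (zy - zx); rewrite -/T in h1.
  have h2 : (Ln * normoo (zy - zx)%R <= 4 * N)%N.
    rewrite -normooZ scalerBr.
    have := normoo_dist3 y (Ln%:Z *: zy) (Ln%:Z *: zx).
    have := normoo_dist3 x y (Ln%:Z *: zx).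
    have := normoo_dist3 0 y x; rewrite sub0r subr0 normooN.
    rewrite [normoo (x - _)%R]normoo_distC.
    move: nx ny hx hy Lr rN; rewrite /nball /= !sub0r !normooN.
    by move: (normoo _) (normoo _) (normoo _) (normoo _) (normoo _) (normoo _) (normoo _) => *; lia.
  apply: (@leq_trans (d * (Ln * normoo (zy - zx)%R))).
    by rewrite mulnCA mulnC leq_mul2l h1 orbT.
  by rewrite [(4 * d * N)%N]mulnAC mulnC leq_mul2r h2 orbT.
have TLR : T%:R * Ln%:R <= 4 * d%:R * N%:R :> R.
  by rewrite -!natrM ler_nat.
have pL : p%:R <= expR 10 * Ln%:R :> R.
  apply: le_trans (prod_ratio n) _; rewrite ler_wpM2l ?expR_ge0 // ler_nat.
  by rewrite /Ln /scale leq_pmull.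
rewrite addnAC addnn -mul2n natrD; apply: lerD => //; rewrite !(natrM _ T) (natrM _ p).
have J0 : 0 <= J%:R :> R by [].
apply: (@le_trans _ _ (T%:R * ((expR 10 * Ln%:R) * J%:R))).
  by rewrite ler_wpM2l // ler_wpM2r.
have -> : T%:R * ((expR 10 * Ln%:R) * J%:R) = (T%:R * Ln%:R) * (expR 10 * J%:R) :> R by ring.
have -> : 4 * d%:R * expR 10 * J%:R * N%:R = (4 * d%:R * N%:R) * (expR 10 * J%:R) :> R by ring.
by rewrite ler_wpM2r // mulr_ge0 // expR_ge0.
Qed.

End ChemicalDistance.

(** * Elementary estimates for the final radius *)

Section FinalBounds.
Variable R : realType.

Lemma side_le (k m : nat) : (0 < m)%N -> ((k * m).*2.+1 <= k.*2.+1 * m)%N.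
Proof. by move=> m0; rewrite doubleMl mulSn -add1n leq_add2r. Qed.

Lemma exists_root (d N : nat) : (0 < d)%N -> (1 <= N)%N ->
  exists2 rho : nat, (rho ^ d <= N)%N & (N < rho.+1 ^ d)%N.
Proof.
move=> d0 N1.
have ex : exists m, (m ^ d <= N)%N by exists 0%N; rewrite exp0n.
have ub m : (m ^ d <= N)%N -> (m <= N)%N.
  case: m => // m; apply: leq_trans.
  by rewrite -{1}[m.+1]expn1 leq_pexp2l.
case: (ex_maxnP ex ub) => m hm hmax; exists m => //.
by rewrite ltnNge; apply/negP => /hmax; rewrite ltnn.
Qed.

Lemma exists_scale (K th L0 rho : nat) : (0 < K)%N -> (0 < th)%N -> (0 < L0)%N ->
  (20 * L0 <= rho)%N ->
  exists2 s : nat, (20 * scale (sqratio K th) L0 s <= rho)%N &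
    (rho < 20 * scale (sqratio K th) L0 s.+1)%N.
Proof.
move=> K0 th0 L00 hL.
have ex : exists s, (20 * scale (sqratio K th) L0 s <= rho)%N.
  by exists 0%N; rewrite /scale big_ord0 muln1.
have ub s : (20 * scale (sqratio K th) L0 s <= rho)%N -> (s <= rho)%N.
  case: s => // s; apply: leq_trans.
  apply: (@leq_trans (scale (sqratio K th) L0 s.+1)); last by rewrite leq_pmull.
  apply: leq_trans (scale_ge_exp K th s L00).
  apply: leq_trans (ratio_ge K s th0).
  apply: (leq_trans (ltnW (ltn_expl s.+1 (isT : (1 < 2)%N)))).
  by rewrite leq_exp2l // leq_pmull.
case: (ex_maxnP ex ub) => s hs hmax; exists s => //.
by rewrite ltnNge; apply/negP => /hmax; rewrite ltnn.
Qed.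

(** Beyond [(e / c)^(1/D)] the power wins, and below it the linear term is bounded. With [x = log r]
    this absorbs the union bound over about [r^d] sites, thanks to [D > 0]. *)
Lemma linear_le_power (e c D : R) : 0 <= e -> 0 < c -> 0 < D ->
  exists2 C : R, 0 <= C & forall x, 0 <= x -> e * x <= c * x `^ (1 + D) + C.
Proof.
move=> e0 c0 D0; exists (e * (e / c) `^ D^-1); first by rewrite mulr_ge0 // powR_ge0.
move=> x x0; have ec0 : 0 <= e / c by rewrite divr_ge0 // ltW.
have D1 : 0 < D^-1 by rewrite invr_gt0.
have [h|h] := lerP x ((e / c) `^ D^-1).
  apply: (@le_trans _ _ (e * (e / c) `^ D^-1)); first exact: ler_wpM2l.
  by rewrite lerDr mulr_ge0 ?powR_ge0 // ltW.
have xp : 0 < x by apply: le_lt_trans h; rewrite powR_ge0.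
rewrite -[leLHS]addr0; apply: lerD; last by rewrite mulr_ge0 // powR_ge0.
rewrite powRD ?powRr1 //; last by apply/implyP => _; rewrite gt_eqF.
rewrite mulrA [c * x]mulrC -mulrA mulrC; apply: ler_wpM2l => //.
have : e / c <= x `^ D.
  have -> : e / c = ((e / c) `^ D^-1) `^ D by rewrite -powRrM mulVf ?gt_eqF // powRr1.
  apply: ge0_ler_powR; rewrite ?nnegrE ?powR_ge0 //; exact: ltW.
by rewrite ler_pdivrMr // mulrC.
Qed.

Lemma ln_root_ge (d N rho : nat) (t : R) : (0 < d)%N -> (2 <= rho)%N ->
  t < N.+1%:R -> 1 <= t -> (N < rho.+1 ^ d)%N -> ln t <= 2 * d%:R * ln rho%:R.
Proof.
move=> d0 rho2 tN t1 Nrho.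
have -> : 2 * d%:R * ln rho%:R = ln ((rho ^ (2 * d))%N%:R) :> R.
  by rewrite ln_natX ?natrM // (leq_trans _ rho2).
rewrite ler_ln ?posrE; last 2 first.
- exact: lt_le_trans t1.
- by rewrite ltr0n expn_gt0 (leq_trans _ rho2).
apply: le_trans (ltW tN) _; rewrite ler_nat (leq_trans Nrho) // expnM leq_expWl //.
by rewrite -mulnn; nia.
Qed.

(** [rho^2 < 400 sc^2 <= rho sc^2], hence [rho < sc^2]. *)
Lemma half_ln_le (rho sc : nat) : (400 <= rho)%N -> (rho < 20 * sc)%N ->
  2^-1 * ln rho%:R <= ln sc%:R :> R.
Proof.
move=> h1 h2; have sc0 : (0 < sc)%N by case: sc h2; rewrite ?muln0.
have : ln rho%:R <= ln ((sc ^ 2)%N%:R) :> R.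
  rewrite ler_ln ?posrE ?ltr0n ?expn_gt0 ?sc0 ?(leq_trans _ h1) // ler_nat -mulnn.
  by nia.
rewrite ln_natX //; lra.
Qed.

Lemma nat_pow_le_expR (d N : nat) (t : R) : 1 <= t -> N%:R <= t ->
  (N ^ d)%:R <= expR (d%:R * ln t).
Proof.
move=> t1 Nt; rewrite expRM_natl lnK ?posrE ?(lt_le_trans ltr01) // natrX.
by apply: lerXn2r; rewrite ?nnegrE // (le_trans ler01).
Qed.

Lemma sum_counts (n3 n1 a3 a1 w e : R) : 0 <= e -> n3 <= a3 * w -> n1 <= a1 * w ->
  n3 * e + (n3 * e + n1 * e) <= (2 * a3 + a1) * w * e.
Proof. by move=> e0 /(ler_wpM2r e0) h3 /(ler_wpM2r e0) h1; lra. Qed.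

Lemma absorb_linear (e x c X C : R) : e * x <= c * X + C ->
  e * x + - (2 * c * X) <= C + - c * X.
Proof. by lra. Qed.

Lemma halve (m y : R) : 2 * m * y = 4 * m * (2^-1 * y).
Proof. by lra. Qed.

End FinalBounds.

(** * Choice of constants and union bound *)

Theorem theorem1p3 (R : realType) (d : nat) (a b : R)
    (P : R -> probability (configuration d) R) (DeltaS : R -> R)
    (hd : (2 <= d)%N) (ha : 0 <= a) (hab : a < b)
    (hP1 : condP1 a b P) (hP2 : condP2 a b P) (hP3 : condP3 a b P)
    (hS1 : condS1 a b P DeltaS) (hS2 : condS2 a b P) :
  forall u : R, a < u < b ->
  exists c C : R, 0 < c /\
    forall r : R, 1 <= r ->
      (P u [set xi | forall x y,
              (occupied_ge r%:E xi `&` box 0 r) x ->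
              (occupied_ge r%:E xi `&` box 0 r) y ->
              graph_dist R (occupied xi) x y <= (C * r)%:E]
         >= (1 - C * expR (- c * ln r `^ (1 + DeltaS u)))%:E)%E.
Proof.
move=> u hu; have d0 : (0 < d)%N by exact: leq_trans hd.
have [K [th [k [L0 [Q [[K4 th0] Q0 [L00 g0] kL0 hbad]]]]]] :=
  bad_seeds_prob d0 ha hP1 hP2 hP3 hS1 hS2 hu.
have [D0 [r0 hr0]] := unique_at_prob hP1 hS1 hu.
have [c1 c10 hc1] := scale_upper K th L00 D0.
set Delta := DeltaS u in D0 hr0 hc1 *.
have d0R : 0 < d%:R :> R by rewrite ltr0n.
(* The price of passing from [ln t] to [ln L_(s+1)]: a factor [2 d] for the root, and 2 for the next
   scale. *)
pose A : R := (4 * d%:R)^-1 `^ (1 + Delta).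
have A0 : 0 < A by rewrite powR_gt0 // invr_gt0 mulr_gt0.
(* Each bad event has probability at most [exp (- 2 c x^(1+Delta))]; half of the exponent is spent
   on the number of sites. *)
pose c := Num.min (Q * c1 * A) A / 2.
have c0 : 0 < c by rewrite divr_gt0 // lt_min A0 !mulr_gt0.
have [C3 C30 hC3] := linear_le_power (ltW d0R) c0 D0.
pose rho0 := maxn 400 (maxn (20 * L0) r0).
pose T0 : R := (rho0 ^ d)%:R.
pose M1 : R := (2 * 5 ^ d)%N%:R + 4 * d%:R * expR 10 * (2 * ((4 * L0).*2.+1) ^ d)%N%:R.
(* Two cascades over a ball of radius [3 * N] and local uniqueness over one of radius [N]. *)
pose C2 : R := (2 * 7 ^ d + 3 ^ d)%N%:R.
(* One [C] serves as stretch factor ([M1]), as prefactor of the probability, and for the radii below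
   [T0], where it makes the claimed lower bound nonpositive. *)
pose C := M1 + C2 * expR C3 + expR (c * ln T0 `^ (1 + Delta)).
have M10 : 0 <= M1 by rewrite addr_ge0 // !mulr_ge0 ?expR_ge0.
have C20 : 0 <= C2 * expR C3 by rewrite mulr_ge0 ?expR_ge0.
have CT : expR (c * ln T0 `^ (1 + Delta)) <= C by rewrite lerDr addr_ge0.
have CM : M1 <= C by rewrite /C -addrA lerDl addr_ge0 ?expR_ge0.
have CC : C2 * expR C3 <= C by rewrite /C addrAC lerDr addr_ge0 ?expR_ge0.
move: C CT CM CC => C CT CM CC.
exists c, C; split=> // t t1.
have t0 : 0 < t by exact: lt_le_trans t1.
have x0 : 0 <= ln t by rewrite ln_ge0.
set x := ln t in x0 *.
set G := (X in P u X).
have D1 : 0 <= 1 + Delta by rewrite addr_ge0 // ltW.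
have [tT|Tt] := ltrP t T0.
  have CX : expR (c * x `^ (1 + Delta)) <= C.
    apply: le_trans CT; rewrite ler_expR ler_pM2l //; apply: ge0_ler_powR => //.
      by rewrite nnegrE ln_ge0 // ltW // (le_lt_trans t1).
    by rewrite ler_ln ?posrE ?(ltW tT) // (lt_trans t0).
  apply: le_trans (measure_ge0 _ _); rewrite lee_fin subr_le0 mulNr expRN.
  by rewrite ler_pdivlMr ?mul1r; [exact: CX | exact: expR_gt0].
pose N := Num.trunc t.
have tN : t < N.+1%:R by exact: truncnS_gt.
have Nt : N%:R <= t by rewrite truncn_le // ltW.
have rho0_gt0 : (0 < rho0)%N by rewrite leq_max.
have NT : (rho0 ^ d <= N)%N by rewrite truncn_ge_nat ?(ltW t0).
have N1 : (1 <= N)%N by apply: leq_trans NT; rewrite expn_gt0 rho0_gt0.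
have [rho rho1 rho2] := exists_root d0 N1.
have rho_ge : (rho0 <= rho)%N.
  by rewrite -ltnS -(ltn_exp2r _ _ d0) (leq_ltn_trans NT).
have [ra rb rc] : [/\ (400 <= rho)%N, (20 * L0 <= rho)%N & (r0 <= rho)%N].
  by move: rho_ge; rewrite /rho0 !geq_max => /and3P.
have [s s1 s2] := exists_scale (leq_trans (isT : (0 < 4)%N) K4) th0 L00 rb.
have rhoN : (rho <= N)%N.
  apply: leq_trans rho1; rewrite -{1}[rho]expn1 leq_pexp2l //.
  exact: leq_trans ra.
have lnrho : x <= 2 * d%:R * ln rho%:R.
  by apply: (@ln_root_ge R d N) => //; exact: leq_trans ra.
have lnsc := half_ln_le R ra s2.
have Ax y : x <= 4 * d%:R * y -> A * x `^ (1 + Delta) <= y `^ (1 + Delta).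
  move=> xy; have d4 : 0 < 4 * d%:R :> R by rewrite mulr_gt0.
  rewrite /A -powRM ?invr_ge0 ?(ltW d4) //.
  have xy' : (4 * d%:R)^-1 * x <= y by rewrite ler_pdivrMl.
  have xy0 : 0 <= (4 * d%:R)^-1 * x by rewrite mulr_ge0 // invr_ge0 ltW.
  by apply: ge0_ler_powR; rewrite ?nnegrE // (le_trans xy0).
have lnrho0 : 0 <= ln rho%:R :> R by rewrite ln_ge0 // ler1n (leq_trans _ ra).
have e1 : expR (- (Q * (3 / 2) ^+ s)) <= expR (- (2 * c * x `^ (1 + Delta))).
  rewrite ler_expR lerN2.
  have h2 : A * x `^ (1 + Delta) <= ln (scale (sqratio K th) L0 s.+1)%:R `^ (1 + Delta).
    apply: Ax; apply: (le_trans lnrho).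
    by rewrite halve ler_pM2l // mulr_gt0.
  apply: (@le_trans _ _ (Q * c1 * A * x `^ (1 + Delta))).
    by rewrite ler_wpM2r ?powR_ge0 // /c mulrC divfK // ge_min lexx.
  rewrite -!mulrA ler_pM2l //; apply: le_trans (hc1 s).
  by rewrite ler_pM2l.
have e2 : expR (- ln rho%:R `^ (1 + Delta)) <= expR (- (2 * c * x `^ (1 + Delta))).
  rewrite ler_expR lerN2; apply: (@le_trans _ _ (A * x `^ (1 + Delta))).
    by rewrite ler_wpM2r ?powR_ge0 // /c mulrC divfK // ge_min lexx orbT.
  apply: Ax; apply: (le_trans lnrho); apply: ler_wpM2r => //.
  by rewrite ler_pM2r // ler_nat.
have [S3 [hS3 sS3]] := nball_enum (0 : lattice d) (3 * N).
have [S1 [hS1' sS1]] := nball_enum (0 : lattice d) N.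
pose E1 (z : lattice d) := bad (sqratio K th) (ratio K th)
  (fun w => ~` connected_seed L0 (eta P u) w) s z.
pose E2 (z : lattice d) := bad (sqratio K th) (ratio K th)
  (fun w => ~` sparse_seed L0 k (eta P u) w) s z.
pose E3 (z : lattice d) := ~` unique_at R rho z.
have mE1 z : z \in S3 -> measurable (E1 z) by move=> _; case: (hbad s z).
have mE2 z : z \in S3 -> measurable (E2 z) by move=> _; case: (hbad s z).
have mE3 z : z \in S1 -> measurable (E3 z).
  by move=> _; apply: measurableC; exact: measurable_unique_at.
have pE1 := @prob_union_seq _ _ _ (P u) _ S3 E1 _ mE1
  (fun z _ => let: And4 _ _ h _ := hbad s z in le_trans h e1).
have pE2 := @prob_union_seq _ _ _ (P u) _ S3 E2 _ mE2
  (fun z _ => let: And4 _ _ _ h := hbad s z in le_trans h e1).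
have pE3 := @prob_union_seq _ _ _ (P u) _ S1 E3 _ mE3
  (fun z _ => le_trans (hr0 rho z rc) e2).
have mG : measurable (G : set (configuration d)).
  apply: measurable_forall => y; apply: measurable_forall => z.
  apply: measurable_imply.
    by apply: measurableI; [exact: measurable_occupied_ge|exact: measurable_constant].
  apply: measurable_imply.
    by apply: measurableI; [exact: measurable_occupied_ge|exact: measurable_constant].
  exact: measurable_graph_dist.
rewrite -(EFin_prob (P u) mG) lee_fin lerBlDr -lerBlDl -(probC (P u) mG).
have sub : ~` G `<=` [set xi | exists2 z, z \in S3 & E1 z xi] `|`
    ([set xi | exists2 z, z \in S3 & E2 z xi] `|` [set xi | exists2 z, z \in S1 & E3 z xi]).
  move=> xi nG; apply: contrapT => /not_orP[n1 /not_orP[n2 n3]].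
  apply: nG => y z [oy by0] [oz bz].
  have inN (v : lattice d) : box 0 t v -> nball 0 N v.
    rewrite /box /nball /= => hv; rewrite truncn_ge_nat ?(ltW t0) //.
    by rewrite pmulrn -floor_ge_int_tmp.
  have rt : rho%:R / 10 <= t.
    apply: le_trans Nt; rewrite ler_pdivrMr //; apply: (@le_trans _ _ N%:R).
      by rewrite ler_nat.
    by rewrite ler_peMr // ler1n.
  have goodN v : nball 0 (3 * N) v -> good (sqratio K th) (ratio K th)
      [set w | ~ connected_seed L0 (eta P u) w xi]
      [set w | ~ sparse_seed L0 k (eta P u) w xi] s v.
    by move=> /hS3 hv; split=> bv; [apply: n1 | apply: n2]; exists v.
  have uniq v : nball 0 N v -> unique_at R rho v xi.
    by move=> /hS1' hv; apply: contrapT => nv; apply: n3; exists v.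
  have [m [[p [wp pm]] mle]] := chemical_distance hd K4 th0 L00 g0 kL0 N1 rhoN s1
    goodN uniq (inN _ by0) (inN _ bz) (occupied_ge_le rt oy) (occupied_ge_le rt oz).
  apply/graph_dist_leP; exists p; split=> //.
  apply: (@le_trans _ _ m%:R); first by rewrite ler_nat.
  apply: (le_trans mle); apply: (@le_trans _ _ (M1 * N%:R)); last first.
    apply: (@le_trans _ _ (M1 * t)); first exact: ler_wpM2l.
    by rewrite ler_pM2r.
  rewrite {1}/M1 [leRHS]mulrDl; apply: lerD => //.
  rewrite -natrM ler_nat -mulnA leq_mul2l /=.
  apply: (@leq_trans ((5 * rho) ^ d)); first by apply/leq_expWl/side_le; exact: leq_trans ra.
  by rewrite expnMn leq_mul2l rho1 orbT.
have mU3 := measurable_union_seq mE3.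
have mU2 := measurable_union_seq mE2.
have mU1 := measurable_union_seq mE1.
have mU23 := measurableU _ _ mU2 mU3.
apply: le_trans (prob_le (P u) (measurableC mG) (measurableU _ _ mU1 mU23) sub) _.
apply: le_trans (probU2 (P u) mU1 mU23) _.
apply: le_trans (lerD pE1 (le_trans (probU2 (P u) mU2 mU3) (lerD pE2 pE3))) _.
set eps := expR _; have eps0 : 0 <= eps by exact: expR_ge0.
have Nd := nat_pow_le_expR d t1 Nt; rewrite -/x in Nd.
have sz3 : (size S3)%:R <= (7 ^ d)%N%:R * expR (d%:R * x).
  apply: (@le_trans _ _ ((7 ^ d * N ^ d)%N%:R)); last by rewrite natrM ler_wpM2l.
  by rewrite ler_nat -expnMn (leq_trans sS3) // leq_expWl // side_le.
have sz1 : (size S1)%:R <= (3 ^ d)%N%:R * expR (d%:R * x).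
  apply: (@le_trans _ _ ((3 ^ d * N ^ d)%N%:R)); last by rewrite natrM ler_wpM2l.
  by rewrite ler_nat -expnMn (leq_trans sS1) // leq_expWl // -[N in N.*2]mul1n side_le.
apply: (@le_trans _ _ (C2 * expR (d%:R * x) * eps)).
  by rewrite /C2 natrD natrM; exact: sum_counts eps0 sz3 sz1.
apply: (@le_trans _ _ (C2 * expR C3 * expR (- c * x `^ (1 + Delta)))); last first.
  by rewrite ler_pM2r ?expR_gt0.
rewrite -!mulrA -!expRD; apply: ler_wpM2l => //; rewrite ler_expR.
by apply: absorb_linear; exact: hC3.
Qed.
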